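(* Let $m\ge 1$ be an integer. There exists a constant $c_m>0$, independent of $a$, such that for every real-valued function $a\in C^\infty(\mathbb{S})$, setting $b=a^m$, one has $$Z_m(a)\ge c_m\sum_{n=m+1}^\infty n^{2m+1}|\hat b_n|^2 .$$ In particular, $Z_m(a)\ge 0$ for every integer $m\ge1$ and every real-valued function $a\in C^\infty(\mathbb{S})$.
   Context: $\mathbb{S}=\{e^{i\theta}:\theta\in\mathbb{R}\}\subset\mathbb{C}$ is the unit circle; for a function $u$ on $\mathbb{S}$ one writes $u(\theta)$ for $u(e^{i\theta})$, and $\hat u_n$ ($n\in\mathbb{Z}$) are the Fourier coefficients, $u(\theta)=\sum_{n\in\mathbb{Z}}\hat u_n e^{in\theta}$. $\Lambda:C^\infty(\mathbb{S})\to C^\infty(\mathbb{S})$ is the Dirichlet-to-Neumann operator of the unit disk, i.e. $\Lambda e^{in\theta}=|n|e^{in\theta}$, and $D=-i\frac{d}{d\theta}$, i.e. $De^{in\theta}=ne^{in\theta}$. A function $a$ also denotes the operator of multiplication by $a$. For $a\in C^\infty(\mathbb{S})$ and an integer $m\ge1$, the operator $(a\Lambda)^{2m}-(aD)^{2m}$ is a smoothing operator on $\mathbb{S}$ (hence has a finite trace), and the Steklov zeta-invariant is $Z_m(a)=\mathrm{Tr}\big[(a\Lambda)^{2m}-(aD)^{2m}\big]$, which is real for real $a$. *)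

(* Defs.v *)
From Stdlib Require Import Reals ZArith.
From Coquelicot Require Import Coquelicot.

Open Scope R_scope.

(* A function u on the unit circle is given by its angular form u(theta), a
   2 PI-periodic function of a real variable.  This is membership of a
   real-valued function in C^oo of the circle. *)
Definition smooth_on_circle (a : R -> R) : Prop :=
  (forall t : R, a (t + 2 * PI) = a t) /\
  (forall (k : nat) (t : R), ex_derive_n a k t).

(* e^{i n theta} *)
Definition expi (n : Z) (t : R) : C := (cos (IZR n * t), sin (IZR n * t)).

Definition fourier (u : R -> C) (n : Z) : C :=
  (RtoC (/ (2 * PI)) *
   RInt (V := C_R_CompleteNormedModule)
     (fun t => u t * expi (- n) t)%C 0 (2 * PI))%C.

(* Sums over Z, split into the indices n >= 0 and n < 0.  [Zsum] is total, and
   is meaningful for the absolutely summable families of [Zsummable]. *)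
Definition Zsummable (c : Z -> C) : Prop :=
  ex_series (fun n : nat => Cmod (c (Z.of_nat n))) /\
  ex_series (fun n : nat => Cmod (c (- Z.of_nat (S n))%Z)).

Definition Cseries (c : nat -> C) : C :=
  (Series (fun n => Re (c n)), Series (fun n => Im (c n))).

Definition Zsum (c : Z -> C) : C :=
  (Cseries (fun n => c (Z.of_nat n)) +
   Cseries (fun n => c (- Z.of_nat (S n))%Z))%C.

Definition operator : Type := (R -> C) -> (R -> C).

(* The Dirichlet-to-Neumann operator of the unit disk: the Fourier multiplier
   e^{i n theta} |-> |n| e^{i n theta}. *)
Definition Lambda : operator := fun u t =>
  Zsum (fun n => RtoC (IZR (Z.abs n)) * fourier u n * expi n t)%C.

(* D = - i d/dtheta *)
Definition D : operator := fun u t =>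
  (- Ci * (Derive (fun s => Re (u s)) t, Derive (fun s => Im (u s)) t))%C.

Definition mul_by (a : R -> R) : operator := fun u t => (RtoC (a t) * u t)%C.

Definition op_comp (A B : operator) : operator := fun u => A (B u).

Definition op_pow (A : operator) (k : nat) : operator := fun u => Nat.iter k A u.

Definition op_sub (A B : operator) : operator := fun u t => (A u t - B u t)%C.

(* <A e_n, e_n> in L^2 of the circle, for the orthonormal basis
   e_n = (2 PI)^{-1/2} e^{i n theta}. *)
Definition diag_coef (A : operator) (n : Z) : C := fourier (A (expi n)) n.

Definition is_trace (A : operator) (z : C) : Prop :=
  Zsummable (diag_coef A) /\ z = Zsum (diag_coef A).

(* (a Lambda)^{2m} - (a D)^{2m} *)
Definition zeta_operator (m : nat) (a : R -> R) : operator :=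
  op_sub (op_pow (op_comp (mul_by a) Lambda) (2 * m))
         (op_pow (op_comp (mul_by a) D) (2 * m)).

(* [is_zeta_invariant m a z] : the trace exists, is real, and equals z. *)
Definition is_zeta_invariant (m : nat) (a : R -> R) (z : R) : Prop :=
  is_trace (zeta_operator m a) (RtoC z).

(* Main.v *)
Require Import Defs.
From Stdlib Require Import Reals ZArith Lra Lia List FinFun FunctionalExtensionality.
From Coquelicot Require Import Coquelicot.

Open Scope R_scope.

(** Write [a_k] for the Fourier coefficients of [a].  In the basis of exponentials the operators
    [a Lambda] and [a D] have the matrices [a_{k-h} |h|] and [a_{k-h} h].  Conjugating by
    [Lambda^{1/2}] turns them into [A] and [A J], where [A] is the Hermitian matrix
    [|k|^{1/2} a_{k-h} |h|^{1/2}] and [J] is the diagonal matrix of the signs of the frequencies.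

    If all traces were finite, then with [B = (A J)^m] one would have
      [Z = Tr A^{2m} - Tr B^2 >= Tr (B adj B) - Tr B^2],
    because [Tr A^{2m} = Tr (C adj C)^m >= Tr (C^m adj (C^m))] for [C = A J], a case of Hoelder's
    inequality for Schatten norms.  As [adj B = J B J], the right-hand side is the sum over [k], [h]
    of [(1 - J_k J_h) |B_{k h}|^2]: it is nonnegative, and only entries joining frequencies of
    opposite sign count.  This is [trace_gap], stated for finite matrices and proved by
    reflecting words in [A] and [A J].

    The two infinite traces do not exist separately, so the inequality is applied to the truncated
    matrices.  Expanding both powers over closed paths of frequencies, the terms of a path cancel
    unless the path changes sign, and then the total length of its steps bounds all of its points;
    the rapid decay of [a_k] then dominates the whole sum by a summable product weight
    ([closed_path_term_tuple_dominated]).  Hence the trace exists and is the limit of the truncated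
    ones ([zeta_trace]).  The entries of [B] converge as well, to Fourier coefficients of
    [(a D)^m e_h].  Identifying the powers of [a D] with sums over paths uses the convergence of
    Fourier series of smooth functions, [fourier_inversion].

    It remains to bound the corner of [B] from below.  Since [D (e_h u) = e_h (D + h) u], the
    function [(a D)^m e_h] is [h e_h] times a polynomial in [h] of degree [m - 1] with leading
    coefficient [a^m] ([aD_pow_polynomial]).  So on the anti-diagonal [k - h = n], with [h = - y],
    the sum is that of [(n - y) y |P_n (- y)|^2] over [1 <= y <= n - 1], where [P_n] is a polynomial
    of degree [m - 1] with leading coefficient [b_n].  A polynomial of degree [m - 1] cannot be small
    at [m] points without a small leading coefficient; there are that many points exactly when
    [n >= m + 1], and averaging over progressions of step proportional to [n] gives the power
    [n^{2m+1}] ([poly_of_weighted_bound]). *)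

(** * Finite sums *)

Definition csum {A : Type} (l : list A) (f : A -> C) : C :=
  fold_right (fun x s => (f x + s)%C) (RtoC 0) l.

Definition rsum {A : Type} (l : list A) (f : A -> R) : R :=
  fold_right (fun x s => f x + s) 0 l.

Lemma csum_app {A} (l l' : list A) f : csum (l ++ l') f = (csum l f + csum l' f)%C.
Proof. induction l as [|x l IH]; simpl; [ring|]. rewrite IH. ring. Qed.

Lemma csum_ext {A} (l : list A) f g :
  (forall x, In x l -> f x = g x) -> csum l f = csum l g.
Proof.
  induction l as [|x l IH]; simpl; intros H; [reflexivity|].
  rewrite (H x (or_introl eq_refl)). rewrite IH; [reflexivity|]. intros y Hy; apply H; now right.
Qed.

Lemma csum_plus {A} (l : list A) f g :
  csum l (fun x => f x + g x)%C = (csum l f + csum l g)%C.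
Proof. induction l as [|x l IH]; simpl; [ring|]. rewrite IH. ring. Qed.

Lemma csum_scal_l {A} (l : list A) (c : C) f :
  csum l (fun x => c * f x)%C = (c * csum l f)%C.
Proof. induction l as [|x l IH]; simpl; [ring|]. rewrite IH. ring. Qed.

Lemma csum_scal_r {A} (l : list A) (c : C) f :
  csum l (fun x => f x * c)%C = (csum l f * c)%C.
Proof. induction l as [|x l IH]; simpl; [ring|]. rewrite IH. ring. Qed.

Lemma csum_minus {A} (l : list A) f g :
  csum l (fun x => f x - g x)%C = (csum l f - csum l g)%C.
Proof. induction l as [|x l IH]; simpl; [ring|]. rewrite IH. ring. Qed.

Lemma csum_0 {A} (l : list A) : csum l (fun _ => RtoC 0) = RtoC 0.
Proof. induction l as [|x l IH]; simpl; [ring|]. rewrite IH. ring. Qed.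

Lemma csum_exchange {A B} (l : list A) (l' : list B) f :
  csum l (fun x => csum l' (fun y => f x y)) = csum l' (fun y => csum l (fun x => f x y)).
Proof.
  induction l as [|x l IH]; simpl.
  - now rewrite csum_0.
  - now rewrite IH, csum_plus.
Qed.

Lemma csum_conj {A} (l : list A) f : Cconj (csum l f) = csum l (fun x => Cconj (f x)).
Proof.
  induction l as [|x l IH]; simpl.
  - apply injective_projections; simpl; ring.
  - now rewrite Cplus_conj, IH.
Qed.

Lemma csum_RtoC {A} (l : list A) (f : A -> R) : csum l (fun x => RtoC (f x)) = RtoC (rsum l f).
Proof. induction l as [|x l IH]; simpl; [reflexivity|]. now rewrite IH, RtoC_plus. Qed.

Lemma csum_single {A} (l : list A) (a : A) f :
  NoDup l -> In a l -> (forall x, x <> a -> f x = RtoC 0) -> csum l f = f a.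
Proof.
  intros Hl Ha Hf. induction Hl as [|x l Hx Hl IH]; [easy|]. simpl.
  destruct Ha as [->|Ha].
  - rewrite (csum_ext l f (fun _ => RtoC 0)); [rewrite csum_0; ring|].
    intros y Hy. apply Hf. intros ->. contradiction.
  - rewrite (IH Ha), (Hf x); [ring|]. intros ->. contradiction.
Qed.

Lemma rsum_app {A} (l l' : list A) f : rsum (l ++ l') f = rsum l f + rsum l' f.
Proof. induction l as [|x l IH]; simpl; [ring|]. rewrite IH. ring. Qed.

Lemma rsum_ext {A} (l : list A) f g :
  (forall x, In x l -> f x = g x) -> rsum l f = rsum l g.
Proof.
  induction l as [|x l IH]; simpl; intros H; [reflexivity|].
  rewrite (H x (or_introl eq_refl)). rewrite IH; [reflexivity|]. intros y Hy; apply H; now right.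
Qed.

Lemma rsum_map {A B} (h : A -> B) (l : list A) f : rsum (map h l) f = rsum l (fun x => f (h x)).
Proof. induction l as [|x l IH]; simpl; [easy|]. now rewrite IH. Qed.

Lemma csum_map {A B} (h : A -> B) (l : list A) f : csum (map h l) f = csum l (fun x => f (h x)).
Proof. induction l as [|x l IH]; simpl; [easy|]. now rewrite IH. Qed.

Lemma rsum_plus {A} (l : list A) f g : rsum l (fun x => f x + g x) = rsum l f + rsum l g.
Proof. induction l as [|x l IH]; simpl; [ring|]. rewrite IH. ring. Qed.

Lemma rsum_scal_l {A} (l : list A) c f : rsum l (fun x => c * f x) = c * rsum l f.
Proof. induction l as [|x l IH]; simpl; [ring|]. rewrite IH. ring. Qed.

Lemma rsum_const {A} (l : list A) c : rsum l (fun _ => c) = INR (length l) * c.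
Proof.
  induction l as [|x l IH]; [simpl; ring|].
  change (length (x :: l)) with (S (length l)). rewrite S_INR. simpl. rewrite IH. ring.
Qed.

Lemma rsum_0 {A} (l : list A) : rsum l (fun _ => 0) = 0.
Proof. rewrite rsum_const. ring. Qed.

Lemma rsum_le {A} (l : list A) f g :
  (forall x, In x l -> f x <= g x) -> rsum l f <= rsum l g.
Proof.
  induction l as [|x l IH]; simpl; intros H; [lra|].
  apply Rplus_le_compat; [apply H; now left|]. apply IH. intros y Hy; apply H; now right.
Qed.

Lemma rsum_nonneg {A} (l : list A) f : (forall x, In x l -> 0 <= f x) -> 0 <= rsum l f.
Proof. intros H. rewrite <- (rsum_0 l). now apply rsum_le. Qed.

Lemma rsum_exchange {A B} (l : list A) (l' : list B) f :
  rsum l (fun x => rsum l' (fun y => f x y)) = rsum l' (fun y => rsum l (fun x => f x y)).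
Proof.
  induction l as [|x l IH]; simpl.
  - now rewrite rsum_0.
  - now rewrite IH, rsum_plus.
Qed.

Lemma rsum_incl {A} (l l' : list A) f :
  NoDup l -> incl l l' -> (forall x, 0 <= f x) -> rsum l f <= rsum l' f.
Proof.
  intros Hl. revert l'. induction Hl as [|x l Hx Hl IH]; intros l' Hi Hf; simpl.
  - now apply rsum_nonneg.
  - destruct (in_split x l' (Hi x (or_introl eq_refl))) as (l1 & l2 & ->).
    rewrite rsum_app. simpl.
    enough (rsum l f <= rsum (l1 ++ l2) f) by (rewrite rsum_app in *; lra).
    apply IH; [|exact Hf]. intros y Hy.
    assert (H := Hi y (or_intror Hy)). apply in_app_iff in H.
    apply in_app_iff. destruct H as [H|[->|H]]; [now left| contradiction | now right].
Qed.

Lemma Cmod_csum_le {A} (l : list A) f : Cmod (csum l f) <= rsum l (fun x => Cmod (f x)).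
Proof.
  induction l as [|x l IH]; simpl; [rewrite Cmod_0; lra|].
  eapply Rle_trans; [apply Cmod_triangle|]. lra.
Qed.

Lemma Cmod_minus_sym (a b : C) : Cmod (a - b) = Cmod (b - a).
Proof. rewrite <- (Cmod_opp (a - b)). f_equal. ring. Qed.

(** * Limits of complex sequences *)

Definition Clim (u : nat -> C) (l : C) : Prop :=
  forall e : R, 0 < e -> exists N : nat, forall n, (N <= n)%nat -> Cmod (u n - l) < e.

Lemma Clim_const c : Clim (fun _ => c) c.
Proof. intros e He. exists O. intros n _. replace (c - c)%C with (RtoC 0) by ring.
now rewrite Cmod_0. Qed.

Lemma Clim_ext u v l : (forall n, u n = v n) -> Clim u l -> Clim v l.
Proof. intros H Hu e He. destruct (Hu e He) as [N HN]. exists N. intros n Hn. rewrite <- H. auto. Qed.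

Lemma Clim_plus u v a b : Clim u a -> Clim v b -> Clim (fun n => u n + v n)%C (a + b)%C.
Proof.
  intros Hu Hv e He.
  destruct (Hu (e / 2)) as [N HN]; [lra|]. destruct (Hv (e / 2)) as [N' HN']; [lra|].
  exists (N + N')%nat. intros n Hn.
  replace (u n + v n - (a + b))%C with ((u n - a) + (v n - b))%C by ring.
  eapply Rle_lt_trans; [apply Cmod_triangle|].
  specialize (HN n ltac:(lia)). specialize (HN' n ltac:(lia)). lra.
Qed.

Lemma Clim_scal u a c : Clim u a -> Clim (fun n => c * u n)%C (c * a)%C.
Proof.
  intros Hu e He. pose proof (Cmod_ge_0 c) as Hc.
  destruct (Hu (e / (Cmod c + 1))) as [N HN]; [apply Rdiv_lt_0_compat; lra|].
  exists N. intros n Hn. specialize (HN n Hn).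
  replace (c * u n - c * a)%C with (c * (u n - a))%C by ring. rewrite Cmod_mult.
  apply Rmult_lt_compat_r with (r := Cmod c + 1) in HN; [|lra].
  unfold Rdiv in HN. rewrite Rmult_assoc, Rinv_l, Rmult_1_r in HN by lra.
  pose proof (Cmod_ge_0 (u n - a)). nra.
Qed.

Lemma Clim_minus u v a b : Clim u a -> Clim v b -> Clim (fun n => u n - v n)%C (a - b)%C.
Proof.
  intros Hu Hv. replace (a - b)%C with (a + (-1) * b)%C by ring.
  apply Clim_ext with (fun n => u n + (-1) * v n)%C; [intros; ring|].
  apply Clim_plus; [easy|]. now apply Clim_scal.
Qed.

Lemma Clim_mult u v a b : Clim u a -> Clim v b -> Clim (fun n => u n * v n)%C (a * b)%C.
Proof.
  intros Hu Hv e He. pose proof (Cmod_ge_0 a). pose proof (Cmod_ge_0 b).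
  set (d := Rmin 1 (e / (Cmod a + Cmod b + 1))).
  assert (Hd : 0 < d) by (apply Rmin_glb_lt; [lra|apply Rdiv_lt_0_compat; lra]).
  assert (Hd1 : d <= 1) by apply Rmin_l.
  assert (Hd2 : d * (Cmod a + Cmod b + 1) <= e).
  { assert (d <= e / (Cmod a + Cmod b + 1)) by apply Rmin_r.
    apply Rmult_le_compat_r with (r := Cmod a + Cmod b + 1) in H1; [|lra].
    unfold Rdiv in H1. rewrite Rmult_assoc, Rinv_l in H1 by lra. lra. }
  destruct (Hu d Hd) as [N HN]. destruct (Hv d Hd) as [N' HN'].
  exists (N + N')%nat. intros n Hn.
  specialize (HN n ltac:(lia)). specialize (HN' n ltac:(lia)).
  replace (u n * v n - a * b)%C with ((u n - a) * (v n - b) + a * (v n - b) + (u n - a) * b)%C by ring.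
  eapply Rle_lt_trans; [apply Cmod_triangle|].
  eapply Rle_lt_trans; [apply Rplus_le_compat_r, Cmod_triangle|].
  rewrite !Cmod_mult.
  pose proof (Cmod_ge_0 (u n - a)). pose proof (Cmod_ge_0 (v n - b)). nra.
Qed.

Lemma Clim_unique u a b : Clim u a -> Clim u b -> a = b.
Proof.
  intros Ha Hb. apply Ceq_minus, Cmod_eq_0.
  destruct (Rle_lt_or_eq_dec 0 (Cmod (a - b)) (Cmod_ge_0 _)) as [H|H]; [|now symmetry].
  destruct (Ha (Cmod (a - b) / 2)) as [N HN]; [lra|].
  destruct (Hb (Cmod (a - b) / 2)) as [N' HN']; [lra|].
  specialize (HN (N + N')%nat ltac:(lia)). specialize (HN' (N + N')%nat ltac:(lia)).
  assert (Cmod (a - b) <= Cmod (u (N + N')%nat - b) + Cmod (u (N + N')%nat - a)).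
  { rewrite (Cmod_minus_sym _ a).
    replace (a - b)%C with ((u (N + N')%nat - b) + (a - u (N + N')%nat))%C by ring.
    apply Cmod_triangle. }
  lra.
Qed.

Lemma Clim_bound u a M : Clim u a -> (forall n, Cmod (u n) <= M) -> Cmod a <= M.
Proof.
  intros Ha HM. apply Rnot_lt_le. intros H.
  destruct (Ha (Cmod a - M)) as [N HN]; [lra|]. specialize (HN N (le_n _)).
  specialize (HM N).
  assert (Cmod a <= Cmod (u N) + Cmod (u N - a)).
  { rewrite (Cmod_minus_sym _ a). replace a with (u N + (a - u N))%C at 1 by ring. apply Cmod_triangle. }
  lra.
Qed.

Lemma Clim_shift u a k : Clim u a -> Clim (fun n => u (n + k)%nat) a.
Proof. intros H e He. destruct (H e He) as [N HN]. exists N. intros n Hn. apply HN. lia. Qed.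

Lemma Clim_rate u a K :
  (forall n : nat, Cmod (u n - a) <= K / (INR n + 1)) -> Clim u a.
Proof.
  intros H e He.
  destruct (archimed (Rmax 0 (K / e))) as [HZ _].
  pose proof (Rmax_l 0 (K / e)). pose proof (Rmax_r 0 (K / e)).
  exists (Z.to_nat (up (Rmax 0 (K / e)))). intros n Hn.
  assert (0 <= up (Rmax 0 (K/e)))%Z by (apply le_IZR; lra).
  eapply Rle_lt_trans; [apply H|].
  assert (Rmax 0 (K / e) < INR n + 1).
  { apply Rlt_le_trans with (1 := HZ).
    apply le_INR in Hn. rewrite INR_IZR_INZ, Z2Nat.id in Hn by easy. lra. }
  assert (K / e < INR n + 1) by lra.
  apply Rmult_lt_compat_r with (r := e) in H4; [|easy].
  unfold Rdiv in H4 at 1. rewrite Rmult_assoc, Rinv_l, Rmult_1_r in H4 by lra.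
  pose proof (pos_INR n).
  apply Rmult_lt_reg_r with (INR n + 1); [lra|].
  unfold Rdiv. rewrite Rmult_assoc, Rinv_l by lra. lra.
Qed.

(** * Dominated sums over the integers *)

(** Adding one frequency of each sign at a time makes these the partial sums of [Zsum]. *)
Definition zrange (N : nat) : list Z :=
  map Z.of_nat (seq 0 (S N)) ++ map (fun n => - Z.of_nat (S n))%Z (seq 0 (S N)).

Lemma in_zrange N k : In k (zrange N) <-> (- (Z.of_nat N + 1) <= k <= Z.of_nat N)%Z.
Proof.
  unfold zrange. rewrite in_app_iff, !in_map_iff. setoid_rewrite in_seq. split.
  - intros [(x & <- & H)|(x & <- & H)]; lia.
  - intros H. destruct (Z_le_dec 0 k).
    + left. exists (Z.to_nat k). lia.
    + right. exists (Z.to_nat (- k - 1)). lia.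
Qed.

Lemma NoDup_zrange N : NoDup (zrange N).
Proof.
  unfold zrange. apply NoDup_app.
  - apply FinFun.Injective_map_NoDup; [intros x y; lia|apply seq_NoDup].
  - apply FinFun.Injective_map_NoDup; [intros x y; lia|apply seq_NoDup].
  - intros k. rewrite !in_map_iff. intros (x & <- & _) (y & H & _). lia.
Qed.

Lemma csum_zrange_0 f : csum (zrange 0) f = (f 0%Z + f (-1)%Z)%C.
Proof. simpl. ring. Qed.

Lemma csum_zrange_S N f :
  csum (zrange (S N)) f = (csum (zrange N) f + (f (Z.of_nat (S N)) + f (- Z.of_nat (S (S N)))%Z))%C.
Proof.
  unfold zrange. rewrite (seq_S (S N)), !map_app, !csum_app. cbn [map csum fold_right Nat.add].
  ring.
Qed.

Lemma rsum_zrange_S N f :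
  rsum (zrange (S N)) f = rsum (zrange N) f + (f (Z.of_nat (S N)) + f (- Z.of_nat (S (S N)))%Z).
Proof.
  unfold zrange. rewrite (seq_S (S N)), !map_app, !rsum_app. cbn [map rsum fold_right Nat.add].
  ring.
Qed.

Lemma Clim_split u a :
  is_lim_seq (fun n => Re (u n)) (Re a) -> is_lim_seq (fun n => Im (u n)) (Im a) -> Clim u a.
Proof.
  intros H1 H2 e He.
  assert (He2 : 0 < e / 2) by lra.
  apply is_lim_seq_spec in H1. apply is_lim_seq_spec in H2.
  destruct (H1 (mkposreal _ He2)) as [N HN]. destruct (H2 (mkposreal _ He2)) as [N' HN'].
  exists (N + N')%nat. intros n Hn.
  specialize (HN n ltac:(lia)). specialize (HN' n ltac:(lia)). simpl in HN, HN'.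
  replace (u n - a)%C with (RtoC (Re (u n) - Re a) + Ci * RtoC (Im (u n) - Im a))%C.
  2:{ destruct (u n), a; unfold Ci; apply injective_projections; simpl; ring. }
  eapply Rle_lt_trans; [apply Cmod_triangle|].
  rewrite Cmod_mult, Cmod_Ci, !Cmod_R. lra.
Qed.

Lemma Re_Im_csum {A} (l : list A) f :
  Re (csum l f) = rsum l (fun x => Re (f x)) /\ Im (csum l f) = rsum l (fun x => Im (f x)).
Proof.
  induction l as [|x l [IH1 IH2]]; cbn [csum rsum fold_right]; [easy|].
  fold (csum l f). now rewrite re_plus, im_plus, IH1, IH2.
Qed.

Lemma rsum_seq_sum_n f N : rsum (seq 0 (S N)) f = sum_n f N.
Proof.
  induction N as [|N IH].
  - rewrite sum_O. simpl. ring.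
  - rewrite sum_Sn, <- IH, (seq_S (S N)), rsum_app. simpl. unfold plus; simpl. ring.
Qed.

Lemma Cseries_lim c :
  ex_series (fun n => Cmod (c n)) -> Clim (fun N => csum (seq 0 (S N)) c) (Cseries c).
Proof.
  intros H.
  assert (HR : ex_series (fun n => Re (c n))).
  { apply (ex_series_le (fun n => Re (c n)) (fun n => Cmod (c n))); [|easy].
    intros n. apply re_le_Cmod. }
  assert (HI : ex_series (fun n => Im (c n))).
  { apply (ex_series_le (fun n => Im (c n)) (fun n => Cmod (c n))); [|easy].
    intros n. eapply Rle_trans; [|apply Rmax_Cmod]. apply Rmax_r. }
  apply Clim_split.
  - apply is_lim_seq_ext with (sum_n (fun n => Re (c n))).
    + intros n. now rewrite (proj1 (Re_Im_csum _ _)), rsum_seq_sum_n.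
    + simpl. apply (Series_correct _ HR).
  - apply is_lim_seq_ext with (sum_n (fun n => Im (c n))).
    + intros n. now rewrite (proj2 (Re_Im_csum _ _)), rsum_seq_sum_n.
    + simpl. apply (Series_correct _ HI).
Qed.

Lemma Zsum_lim c : Zsummable c -> Clim (fun N => csum (zrange N) c) (Zsum c).
Proof.
  intros [H1 H2]. unfold Zsum.
  apply Clim_ext with (fun N => csum (seq 0 (S N)) (fun n => c (Z.of_nat n)) +
                       csum (seq 0 (S N)) (fun n => c (- Z.of_nat (S n))%Z))%C.
  - intros N. unfold zrange. now rewrite csum_app, !csum_map.
  - apply Clim_plus; apply Cseries_lim; easy.
Qed.

(** The weight by which all families over the integers are dominated below. *)
Definition weight (k : Z) : R := / (1 + Rabs (IZR k)) ^ 2.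

Lemma weight_pos k : 0 < weight k.
Proof. unfold weight. apply Rinv_0_lt_compat, pow_lt. pose proof (Rabs_pos (IZR k)). lra. Qed.

Lemma weight_le1 k : weight k <= 1.
Proof.
  unfold weight. rewrite <- Rinv_1. apply Rinv_le_contravar; [lra|].
  pose proof (Rabs_pos (IZR k)). nra.
Qed.

Lemma weight_of_nat n : weight (Z.of_nat n) = / (1 + INR n) ^ 2.
Proof.
  unfold weight. rewrite <- INR_IZR_INZ, Rabs_right; [easy|].
  apply Rle_ge, pos_INR.
Qed.

Lemma weight_opp k : weight (- k) = weight k.
Proof. unfold weight. now rewrite opp_IZR, Rabs_Ropp. Qed.

Lemma inv_sq_telescope x : 1 <= x -> / (1 + x) ^ 2 <= / x - / (x + 1).
Proof.
  intros H. replace (/ x - / (x + 1)) with (/ (x * (x + 1))) by (field; lra).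
  apply Rinv_le_contravar; nra.
Qed.

(** Stated between two finite ranges, so that the tail estimate needs no value for the sum of the
    weight. *)
Lemma weight_tail N k :
  rsum (zrange (N + k)) weight <= rsum (zrange N) weight + 2 / (INR N + 1) - 2 / (INR (N + k) + 1).
Proof.
  induction k as [|k IH].
  - rewrite Nat.add_0_r. lra.
  - replace (N + S k)%nat with (S (N + k)) by lia. rewrite rsum_zrange_S.
    rewrite weight_opp, !weight_of_nat.
    set (x := INR (N + k) + 1) in *.
    assert (Hx : 1 <= x) by (unfold x; pose proof (pos_INR (N + k)); lra).
    assert (E1 : INR (S (N + k)) = x) by (unfold x; now rewrite S_INR).
    assert (E2 : INR (S (S (N + k))) = x + 1) by (now rewrite S_INR, E1).
    rewrite E1, E2.
    pose proof (inv_sq_telescope x Hx).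
    assert (/ (1 + (x + 1)) ^ 2 <= / (1 + x) ^ 2).
    { apply Rinv_le_contravar; [apply pow_lt; lra|]. apply pow_incr. lra. }
    unfold Rdiv in *. lra.
Qed.

Lemma weight_sum N : rsum (zrange N) weight <= 4.
Proof.
  pose proof (weight_tail 0 N) as H. rewrite Nat.add_0_l in H.
  assert (E : rsum (zrange 0) weight <= 2).
  { simpl. pose proof (weight_le1 0). pose proof (weight_le1 (-1)). lra. }
  simpl INR in H. pose proof (pos_INR N).
  assert (0 < 2 / (INR N + 1)) by (apply Rdiv_lt_0_compat; lra). lra.
Qed.

Definition dominated (K : R) (c : Z -> C) : Prop := forall k, Cmod (c k) <= K * weight k.

Lemma dominated_nonneg K c : dominated K c -> 0 <= K.
Proof.
  intros H. specialize (H 0%Z). pose proof (Cmod_ge_0 (c 0%Z)). pose proof (weight_pos 0). nra.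
Qed.

Lemma ex_series_inv_sq : ex_series (fun n => / (1 + INR n) ^ 2).
Proof.
  assert (H : ex_finite_lim_seq (sum_n (fun n => / (1 + INR n) ^ 2))).
  { apply ex_finite_lim_seq_incr with 4.
    - intros n. rewrite sum_Sn. unfold plus; simpl.
      assert (0 < / (1 + INR (S n)) ^ 2).
      { apply Rinv_0_lt_compat, pow_lt. pose proof (pos_INR (S n)). lra. }
      simpl in H. lra.
    - intros n. eapply Rle_trans; [|apply (weight_sum n)].
      rewrite <- rsum_seq_sum_n. unfold zrange. rewrite rsum_app, !rsum_map.
      rewrite (rsum_ext _ (fun x => weight (Z.of_nat x)) (fun n => / (1 + INR n) ^ 2))
        by (intros; apply weight_of_nat).
      assert (0 <= rsum (seq 0 (S n)) (fun x => weight (- Z.of_nat (S x)))).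
      { apply rsum_nonneg. intros. apply Rlt_le, weight_pos. }
      lra. }
  destruct H as [l Hl]. exists l. exact Hl.
Qed.

Lemma dominated_summable K c : dominated K c -> Zsummable c.
Proof.
  intros H. pose proof (dominated_nonneg _ _ H) as HK.
  assert (HS : ex_series (fun n => K * / (1 + INR n) ^ 2))
    by (apply (ex_series_scal K (fun n => / (1 + INR n) ^ 2)), ex_series_inv_sq).
  assert (B : forall k n, weight k <= / (1 + INR n) ^ 2 -> norm (Cmod (c k)) <= K * / (1 + INR n) ^ 2).
  { intros k n Hk. unfold norm; simpl. unfold abs; simpl. rewrite Rabs_pos_eq by apply Cmod_ge_0.
    eapply Rle_trans; [apply H|]. now apply Rmult_le_compat_l. }
  split.
  - apply (ex_series_le (fun n => Cmod (c (Z.of_nat n))) _ (fun n =>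
        B _ n ltac:(rewrite weight_of_nat; apply Rle_refl)) HS).
  - refine (ex_series_le (fun n => Cmod (c (- Z.of_nat (S n))%Z)) _ (fun n => B _ n _) HS).
    rewrite weight_opp, weight_of_nat. apply Rinv_le_contravar.
    + apply pow_lt. pose proof (pos_INR n); lra.
    + apply pow_incr. rewrite S_INR. pose proof (pos_INR n); lra.
Qed.

Lemma dominated_lim K c : dominated K c -> Clim (fun N => csum (zrange N) c) (Zsum c).
Proof. intros H. eapply Zsum_lim, dominated_summable, H. Qed.

Lemma dominated_csum K c N : dominated K c -> Cmod (csum (zrange N) c) <= 4 * K.
Proof.
  intros H. eapply Rle_trans; [apply Cmod_csum_le|].
  eapply Rle_trans; [apply rsum_le; intros x _; apply H|].
  rewrite rsum_scal_l. pose proof (weight_sum N). pose proof (dominated_nonneg _ _ H). nra.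
Qed.

Lemma dominated_Zsum K c : dominated K c -> Cmod (Zsum c) <= 4 * K.
Proof. intros H. eapply Clim_bound; [eapply dominated_lim, H|]. intros n. now apply dominated_csum. Qed.

Lemma dominated_tail K c N :
  dominated K c -> Cmod (csum (zrange N) c - Zsum c) <= 2 * K / (INR N + 1).
Proof.
  intros H. rewrite Cmod_minus_sym. pose proof (dominated_nonneg _ _ H) as HK.
  assert (HL : Clim (fun k => csum (zrange (k
      + N)) c - csum (zrange N) c)%C (Zsum c - csum (zrange N) c)%C).
  { apply Clim_minus; [|apply Clim_const].
    apply (Clim_shift (fun k => csum (zrange k) c)). eapply dominated_lim, H. }
  eapply Clim_bound; [exact HL|]. intros k. clear HL. cbv beta. rewrite (Nat.add_comm k N).
  assert (E : Cmod (csum (zrange (N + k)) c - csum (zrange N) c)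
              <= K * (rsum (zrange (N + k)) weight - rsum (zrange N) weight)).
  { induction k as [|k IH].
    - rewrite Nat.add_0_r. replace (csum (zrange N) c - csum (zrange N) c)%C with (RtoC 0) by ring.
      rewrite Cmod_0. lra.
    - replace (N + S k)%nat with (S (N + k)) by lia. rewrite csum_zrange_S, rsum_zrange_S.
      set (p := Z.of_nat (S (N + k))). set (q := (- Z.of_nat (S (S (N + k))))%Z).
      replace (csum (zrange (N + k)) c + (c p + c q) - csum (zrange N) c)%C
        with ((csum (zrange (N + k)) c - csum (zrange N) c) + (c p + c q))%C by ring.
      eapply Rle_trans; [apply Cmod_triangle|].
      pose proof (Cmod_triangle (c p) (c q)). pose proof (H p). pose proof (H q). lra. }
  eapply Rle_trans; [exact E|].
  pose proof (weight_tail N k). pose proof (pos_INR (N + k)).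
  assert (0 < 2 / (INR (N + k) + 1)) by (apply Rdiv_lt_0_compat; lra).
  replace (2 * K / (INR N + 1)) with (K * (2 / (INR N + 1))) by (unfold Rdiv; ring).
  apply Rmult_le_compat_l; lra.
Qed.

Lemma dominated_scal K c z : dominated K c -> dominated (Cmod z * K) (fun k => z * c k)%C.
Proof.
  intros H k. rewrite Cmod_mult, Rmult_assoc. apply Rmult_le_compat_l; [apply Cmod_ge_0|apply H].
Qed.

Lemma dominated_minus K K' c c' :
  dominated K c -> dominated K' c' -> dominated (K + K') (fun k => c k - c' k)%C.
Proof.
  intros H H' k. unfold Cminus. eapply Rle_trans; [apply Cmod_triangle|].
  rewrite Cmod_opp. specialize (H k). specialize (H' k). lra.
Qed.

Lemma Zsum_minus K K' c c' :
  dominated K c -> dominated K' c' -> Zsum (fun k => c k - c' k)%C = (Zsum c - Zsum c')%C.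
Proof.
  intros H H'. eapply Clim_unique.
  - eapply dominated_lim, dominated_minus; eassumption.
  - eapply Clim_ext; [intros N; symmetry; apply csum_minus|].
    apply Clim_minus; eapply dominated_lim; eassumption.
Qed.

Lemma Zsum_scal K c z : dominated K c -> Zsum (fun k => z * c k)%C = (z * Zsum c)%C.
Proof.
  intros H. eapply Clim_unique.
  - eapply dominated_lim, dominated_scal; eassumption.
  - eapply Clim_ext; [intros N; symmetry; apply csum_scal_l|].
    apply Clim_scal; eapply dominated_lim; eassumption.
Qed.

Lemma Zsum_ext c c' : (forall k, c k = c' k) -> Zsum c = Zsum c'.
Proof. intros H. f_equal. now apply functional_extensionality. Qed.

Lemma dominated_single (f : Z -> C) (a : Z) :
  (forall k, k <> a -> f k = RtoC 0) -> dominated (Cmod (f a) / weight a) f.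
Proof.
  intros H k. pose proof (weight_pos a) as Ha. destruct (Z.eq_dec k a) as [->|Hk].
  - right. field. lra.
  - rewrite (H k Hk), Cmod_0. pose proof (weight_pos k). pose proof (Cmod_ge_0 (f a)).
    apply Rmult_le_pos; [|lra]. apply Rdiv_le_0_compat; lra.
Qed.

Lemma Zsum_single f a : (forall k, k <> a -> f k = RtoC 0) -> Zsum f = f a.
Proof.
  intros H. eapply Clim_unique; [eapply dominated_lim, dominated_single, H|].
  intros e He. exists (Z.to_nat (Z.abs a)). intros n Hn.
  rewrite (csum_single (zrange n) a).
  - replace (f a - f a)%C with (RtoC 0) by ring. now rewrite Cmod_0.
  - apply NoDup_zrange.
  - apply in_zrange. lia.
  - exact H.
Qed.

Arguments zrange : simpl never.
Arguments csum : simpl never.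
Arguments rsum : simpl never.

(** * Iterated sums over integer tuples *)

Fixpoint iter_sum (d : nat) (t : list Z -> C) : C :=
  match d with
  | O => t nil
  | S d => Zsum (fun k => iter_sum d (fun ks => t (k :: ks)))
  end.

Fixpoint box_sum (N d : nat) (t : list Z -> C) : C :=
  match d with
  | O => t nil
  | S d => csum (zrange N) (fun k => box_sum N d (fun ks => t (k :: ks)))
  end.

Definition weights (ks : list Z) : R := fold_right (fun k p => weight k * p) 1 ks.

Lemma weights_pos ks : 0 < weights ks.
Proof.
  induction ks as [|k ks IH]; simpl; [lra|]. apply Rmult_lt_0_compat; [apply weight_pos|easy].
Qed.

(** A product weight keeps the iterated sums absolutely convergent one variable at a time. *)
Definition tuple_dominated (d : nat) (K : R) (t : list Z -> C) : Prop :=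
  forall ks, length ks = d -> Cmod (t ks) <= K * weights ks.

Lemma tuple_dominated_cons d K t k : tuple_dominated (S d) K t ->
    tuple_dominated d (K * weight k) (fun ks => t (k :: ks)).
Proof.
  intros H ks Hk. specialize (H (k :: ks)). simpl in H. rewrite Rmult_assoc. apply H. now rewrite Hk.
Qed.

Lemma tuple_dominated_iter_sum d K t : tuple_dominated d K t -> Cmod (iter_sum d t) <= 4 ^ d * K.
Proof.
  revert K t. induction d as [|d IH]; intros K t H; simpl.
  - specialize (H nil eq_refl). simpl in H. lra.
  - rewrite Rmult_assoc.
    apply dominated_Zsum. intros k. eapply Rle_trans; [apply IH, tuple_dominated_cons, H|]. right; ring.
Qed.

Lemma tuple_dominated_cons_iter_sum d K t :
  tuple_dominated (S d) K t -> dominated (4 ^ d * K) (fun k => iter_sum d (fun ks => t (k :: ks))).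
Proof.
  intros H k. eapply Rle_trans; [apply tuple_dominated_iter_sum, tuple_dominated_cons, H|]. right; ring.
Qed.

Lemma box_sum_ext N d t t' : (forall ks, length ks = d -> t ks = t' ks) ->
    box_sum N d t = box_sum N d t'.
Proof.
  revert t t'. induction d as [|d IH]; intros t t' H; simpl.
  - now apply H.
  - apply csum_ext. intros k _. apply IH. intros ks Hk. apply H. simpl. now rewrite Hk.
Qed.

Lemma iter_sum_minus d K K' t t' :
  tuple_dominated d K t -> tuple_dominated d K' t' ->
      iter_sum d (fun ks => t ks - t' ks)%C = (iter_sum d t - iter_sum d t')%C.
Proof.
  revert K K' t t'. induction d as [|d IH]; intros K K' t t' H H'; simpl; [easy|].
  erewrite Zsum_ext; [|intros k; eapply IH; apply tuple_dominated_cons; eassumption].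
  eapply Zsum_minus; eapply tuple_dominated_cons_iter_sum; eassumption.
Qed.

Lemma box_sum_minus N d t t' : box_sum N d (fun ks => t ks - t' ks)%C
    = (box_sum N d t - box_sum N d t')%C.
Proof.
  revert t t'. induction d as [|d IH]; intros t t'; simpl; [easy|].
  erewrite csum_ext; [|intros k _; apply IH]. apply csum_minus.
Qed.

Lemma iter_sum_scal d K t z : tuple_dominated d K t ->
    iter_sum d (fun ks => z * t ks)%C = (z * iter_sum d t)%C.
Proof.
  revert K t. induction d as [|d IH]; intros K t H; simpl; [easy|].
  erewrite Zsum_ext; [|intros k; eapply IH; apply tuple_dominated_cons; eassumption].
  eapply Zsum_scal; eapply tuple_dominated_cons_iter_sum; eassumption.
Qed.

Lemma box_sum_scal N d t z : box_sum N d (fun ks => z * t ks)%C = (z * box_sum N d t)%C.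
Proof.
  revert t. induction d as [|d IH]; intros t; simpl; [easy|].
  erewrite csum_ext; [|intros k _; apply IH]. apply csum_scal_l.
Qed.

Lemma tuple_dominated_nonneg d K t : tuple_dominated d K t -> 0 <= K.
Proof.
  intros H. specialize (H (repeat 0%Z d) (repeat_length _ _)).
  pose proof (Cmod_ge_0 (t (repeat 0%Z d))). pose proof (weights_pos (repeat 0%Z d)). nra.
Qed.

(** Each of the [d] variables contributes the tail of the weight in that variable and at most a
    factor 4 for each of the others. *)
Lemma box_sum_rate N d K t :
  tuple_dominated d K t -> Cmod (box_sum N d t - iter_sum d t) <= INR d * 4 ^ d * K * (2 / (INR N + 1)).
Proof.
  revert K t. induction d as [|d IH]; intros K t H.
  - simpl. replace (t nil - t nil)%C with (RtoC 0) by ring. rewrite Cmod_0. lra.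
  - pose proof (tuple_dominated_nonneg _ _ _ H) as HK. pose proof (pos_INR N) as HN.
    assert (Hr : 0 < 2 / (INR N + 1)) by (apply Rdiv_lt_0_compat; lra).
    rewrite S_INR. cbn [box_sum iter_sum pow].
    set (c := fun k => iter_sum d (fun ks => t (k :: ks))).
    replace (csum (zrange N) (fun k => box_sum N d (fun ks => t (k :: ks))) - Zsum c)%C
      with (csum (zrange N) (fun k => box_sum N d (fun ks =>
          t (k :: ks)) - c k) + (csum (zrange N) c - Zsum c))%C
      by (rewrite csum_minus; ring).
    eapply Rle_trans; [apply Cmod_triangle|].
    pose proof (dominated_tail _ c N (tuple_dominated_cons_iter_sum _ _ _ H)) as H2.
    assert (H1 : Cmod (csum (zrange N) (fun k => box_sum N d (fun ks => t (k :: ks)) - c k)%C)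
                 <= 4 * (INR d * 4 ^ d * K * (2 / (INR N + 1)))).
    { apply dominated_csum. intros k.
      replace (INR d * 4 ^ d * K * (2 / (INR N + 1)) * weight k)
        with (INR d * 4 ^ d * (K * weight k) * (2 / (INR N + 1))) by ring.
      exact (IH _ _ (tuple_dominated_cons _ _ _ k H)). }
    assert (0 < 4 ^ d) by (apply pow_lt; lra).
    assert (0 <= 4 ^ d * K) by nra.
    replace (2 * (4 ^ d * K) / (INR N + 1)) with (4 ^ d * K * (2 / (INR N + 1))) in H2
      by (unfold Rdiv; ring).
    assert (0 <= 4 ^ d * K * (2 / (INR N + 1))) by nra.
    nra.
Qed.

Lemma box_sum_lim d K t : tuple_dominated d K t -> Clim (fun N => box_sum N d t) (iter_sum d t).
Proof.
  intros H. apply Clim_rate with (INR d * 4 ^ d * K * 2). intros N.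
  eapply Rle_trans; [apply box_sum_rate, H|]. right. unfold Rdiv. ring.
Qed.

(** * A trace inequality for finite Hermitian matrices *)

Lemma rsum_list_prod {A B} (l : list A) (l' : list B) f :
  rsum (list_prod l l') f = rsum l (fun x => rsum l' (fun y => f (x, y))).
Proof.
  induction l as [|x l IH]; [reflexivity|]. cbn [list_prod].
  rewrite rsum_app, rsum_map, IH. reflexivity.
Qed.

Lemma rsum_Cauchy_Schwarz {A} (l : list A) f g :
  (rsum l (fun x => f x * g x)) ^ 2 <= rsum l (fun x => f x ^ 2) * rsum l (fun x => g x ^ 2).
Proof.
  induction l as [|x l IH]; unfold rsum in *; cbn [fold_right]; [lra|].
  fold (rsum l (fun x => f x * g x)) in *. fold (rsum l (fun x => f x ^ 2)) in *.
  fold (rsum l (fun x => g x ^ 2)) in *.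
  assert (HF : 0 <= rsum l (fun x => f x ^ 2)) by (apply rsum_nonneg; intros; apply pow2_ge_0).
  assert (HG : 0 <= rsum l (fun x => g x ^ 2)) by (apply rsum_nonneg; intros; apply pow2_ge_0).
  set (F := rsum l (fun x => f x ^ 2)) in *. set (H := rsum l (fun x => g x ^ 2)) in *.
  set (S := rsum l (fun x => f x * g x)) in *.
  assert (2 * (f x * g x) * S <= f x ^ 2 * H + g x ^ 2 * F).
  { assert (HS : S <= sqrt F * sqrt H /\ - S <= sqrt F * sqrt H).
    { rewrite <- sqrt_mult by easy.
      assert (Rabs S <= sqrt (F * H)).
      { rewrite <- sqrt_Rsqr_abs. apply sqrt_le_1_alt. unfold Rsqr. lra. }
      pose proof (Rle_abs S). pose proof (Rle_abs (- S)). rewrite Rabs_Ropp in *. lra. }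
    pose proof (sqrt_pos F). pose proof (sqrt_pos H).
    pose proof (sqrt_sqrt F HF). pose proof (sqrt_sqrt H HG).
    set (p := sqrt F) in *. set (q := sqrt H) in *. rewrite <- H2, <- H3.
    assert (2 * (f x * g x) * S <= 2 * Rabs (f x * g x) * (p * q)).
    { destruct (Rle_dec 0 (f x * g x)).
      - rewrite Rabs_pos_eq by easy. nra.
      - rewrite Rabs_left by lra. nra. }
    rewrite Rabs_mult in H4.
    rewrite <- (pow2_abs (f x)), <- (pow2_abs (g x)).
    pose proof (pow2_ge_0 (Rabs (f x) * q - Rabs (g x) * p)). nra. }
  nra.
Qed.

Lemma snoc_neq_nil {A} (w : list A) x : w ++ x :: nil <> nil.
Proof. now destruct w. Qed.

Section Matrices.

Context {A : Type} (l : list A).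

Definition mat : Type := A -> A -> C.

Definition mm (X Y : mat) : mat := fun i j => csum l (fun k => X i k * Y k j)%C.

Definition adj (X : mat) : mat := fun i j => Cconj (X j i).

Definition tr (X : mat) : C := csum l (fun i => X i i).

(** The square of the Hilbert-Schmidt norm. *)
Definition hs (X : mat) : R := rsum l (fun i => rsum l (fun j => Cmod (X i j) ^ 2)).

Lemma mm_assoc X Y Z : mm (mm X Y) Z = mm X (mm Y Z).
Proof.
  apply functional_extensionality; intros i. apply functional_extensionality; intros j.
  unfold mm.
  rewrite (csum_ext l _ (fun k => csum l (fun h => X i h * Y h k * Z k j)%C))
    by (intros; now rewrite csum_scal_r).
  rewrite csum_exchange. apply csum_ext. intros h _.
  rewrite <- csum_scal_l. apply csum_ext. intros k _. ring.
Qed.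

Lemma adj_mm X Y : adj (mm X Y) = mm (adj Y) (adj X).
Proof.
  apply functional_extensionality; intros i. apply functional_extensionality; intros j.
  unfold adj, mm. rewrite csum_conj. apply csum_ext. intros k _. rewrite Cmult_conj. ring.
Qed.

Lemma tr_mm_comm X Y : tr (mm X Y) = tr (mm Y X).
Proof.
  unfold tr, mm. rewrite csum_exchange. apply csum_ext. intros i _. apply csum_ext. intros k _. ring.
Qed.

Lemma hs_nonneg X : 0 <= hs X.
Proof. unfold hs. apply rsum_nonneg. intros. apply rsum_nonneg. intros. apply pow2_ge_0. Qed.

Lemma tr_mm_adj X : tr (mm X (adj X)) = RtoC (hs X).
Proof.
  unfold tr, mm, adj, hs. rewrite <- csum_RtoC. apply csum_ext. intros i _.
  rewrite <- csum_RtoC. apply csum_ext. intros j _. now rewrite Cmod2_conj.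
Qed.

Lemma tr_Cauchy_Schwarz X Y : Cmod (tr (mm X Y)) ^ 2 <= hs X * hs Y.
Proof.
  assert (H : Cmod (tr (mm X Y)) <=
              rsum (list_prod l l) (fun p => Cmod (X (fst p) (snd p)) * Cmod (Y (snd p) (fst p)))).
  { rewrite rsum_list_prod. eapply Rle_trans; [apply Cmod_csum_le|]. apply rsum_le. intros i _.
    eapply Rle_trans; [apply Cmod_csum_le|]. apply rsum_le. intros j _. rewrite Cmod_mult.
    apply Rle_refl. }
  eapply Rle_trans; [apply pow_incr; split; [apply Cmod_ge_0|exact H]|].
  eapply Rle_trans; [apply rsum_Cauchy_Schwarz|].
  rewrite !rsum_list_prod. unfold hs. cbn [fst snd].
  rewrite (rsum_exchange l l (fun x y => Cmod (Y y x) ^ 2)). apply Rle_refl.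
Qed.

Context (M : mat) (s : A -> R).
Hypothesis M_herm : forall i j, M i j = Cconj (M j i).
Hypothesis s_invol : forall i, s i * s i = 1.

Definition diag_entry (b : bool) (i : A) : C := if b then RtoC (s i) else RtoC 1.

Definition scale (b : bool) (X : mat) : mat := fun i j => (X i j * diag_entry b j)%C.

(** The letter [false] stands for [M] and [true] for [M diag s].  The extra factor [M] at the end of
    [palin_mx] makes taking adjoints the same as reversing the word. *)
Fixpoint palin_mx (w : list bool) : mat :=
  match w with
  | nil => M
  | x :: w => mm (scale x M) (palin_mx w)
  end.

Fixpoint word_mx (w : list bool) : mat :=
  match w with
  | nil => fun _ _ => RtoC 0
  | x :: nil => scale x M
  | x :: w => mm (scale x M) (word_mx w)
  end.

Lemma word_mx_cons x w : w <> nil -> word_mx (x :: w) = mm (scale x M) (word_mx w).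
Proof. now destruct w. Qed.

Lemma word_mx_app v w : v <> nil -> w <> nil -> word_mx (v ++ w) = mm (word_mx v) (word_mx w).
Proof.
  intros Hv Hw. induction v as [|x v IH]; [easy|]. destruct v as [|y v].
  - simpl app. now rewrite word_mx_cons.
  - change ((x :: y :: v) ++ w) with (x :: ((y :: v) ++ w)).
    rewrite word_mx_cons by easy. rewrite IH by easy.
    rewrite (word_mx_cons x (y :: v)) by easy. now rewrite mm_assoc.
Qed.

Lemma mm_scale b X Y : mm X (scale b Y) = scale b (mm X Y).
Proof.
  apply functional_extensionality; intros i. apply functional_extensionality; intros j.
  unfold mm, scale. rewrite <- csum_scal_r. apply csum_ext. intros; ring.
Qed.

Lemma word_mx_palin_mx w x : word_mx (w ++ x :: nil) = scale x (palin_mx w).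
Proof.
  induction w as [|y w IH]; [reflexivity|].
  change ((y :: w) ++ x :: nil) with (y :: (w ++ x :: nil)).
  rewrite word_mx_cons by (destruct w; easy). rewrite IH. apply mm_scale.
Qed.

Lemma palin_mx_app v x w : palin_mx (v ++ x :: w) = mm (scale x (palin_mx v)) (palin_mx w).
Proof.
  induction v as [|y v IH]; [reflexivity|].
  change ((y :: v) ++ x :: w) with (y :: (v ++ x :: w)). cbn [palin_mx].
  rewrite IH, <- mm_assoc. now rewrite mm_scale.
Qed.

Lemma diag_entry_conj b i : Cconj (diag_entry b i) = diag_entry b i.
Proof. unfold diag_entry, Cconj, RtoC. destruct b; simpl; f_equal; ring. Qed.

Lemma diag_entry_sq b i : (diag_entry b i * diag_entry b i = 1)%C.
Proof. unfold diag_entry. destruct b; [rewrite <- RtoC_mult, s_invol; easy|ring]. Qed.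

Lemma adj_palin_mx w : adj (palin_mx w) = palin_mx (rev w).
Proof.
  induction w as [|x w IH].
  - apply functional_extensionality; intros i. apply functional_extensionality; intros j.
    unfold adj. simpl. symmetry. apply M_herm.
  - cbn [palin_mx rev]. rewrite adj_mm, IH, palin_mx_app. cbn [palin_mx].
    apply functional_extensionality; intros i. apply functional_extensionality; intros j.
    unfold mm, scale, adj. apply csum_ext. intros k _.
    rewrite Cmult_conj, diag_entry_conj, (M_herm k j). ring.
Qed.

(** The last letter disappears from [X adj X] because [diag s] is unitary. *)
Lemma tr_reflect w x :
  tr (word_mx ((w ++ false :: nil) ++ (rev w ++ false :: nil))) = RtoC (hs (word_mx (w ++ x :: nil))).
Proof.
  rewrite word_mx_app by apply snoc_neq_nil.
  rewrite <- tr_mm_adj, !word_mx_palin_mx, <- adj_palin_mx. unfold tr. apply csum_ext. intros i _.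
  unfold mm. apply csum_ext. intros k _. unfold adj, scale.
  rewrite Cmult_conj, diag_entry_conj. unfold diag_entry at 1 2.
  transitivity (palin_mx w i k * Cconj (palin_mx w i k) * (diag_entry x k * diag_entry x k))%C;
      [rewrite diag_entry_sq; ring|ring].
Qed.

Lemma tr_rot v w : tr (word_mx (v ++ w)) = tr (word_mx (w ++ v)).
Proof.
  destruct v as [|x v]; [now rewrite app_nil_r|]. destruct w as [|y w]; [now rewrite app_nil_r|].
  rewrite !word_mx_app by easy. apply tr_mm_comm.
Qed.

Definition word_trace (w : list bool) : R := Cmod (tr (word_mx w)).

(** Cauchy-Schwarz between the two halves of a word. *)
Lemma word_trace_reflect v x w y :
  word_trace ((v ++ x :: nil) ++ (w ++ y :: nil)) ^ 2 <=
  word_trace ((v ++ false :: nil) ++ (rev v ++ false :: nil)) *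
  word_trace ((w ++ false :: nil) ++ (rev w ++ false :: nil)).
Proof.
  unfold word_trace. rewrite (tr_reflect v x), (tr_reflect w y), !Cmod_R.
  rewrite !Rabs_pos_eq by apply hs_nonneg.
  rewrite word_mx_app by apply snoc_neq_nil. apply tr_Cauchy_Schwarz.
Qed.

Fixpoint words (p : nat) : list (list bool) :=
  match p with
  | O => nil :: nil
  | S p => map (cons false) (words p) ++ map (cons true) (words p)
  end.

Lemma in_words p w : length w = p -> In w (words p).
Proof.
  revert p. induction w as [|x w IH]; intros [|p] H; try easy; simpl; [now left|].
  injection H as H. apply in_app_iff. destruct x; [right|left]; apply in_map; auto.
Qed.

Lemma words_length p w : In w (words p) -> length w = p.
Proof.
  revert w. induction p as [|p IH]; intros w; simpl.
  - intros [<-|[]]; easy.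
  - rewrite in_app_iff, !in_map_iff. intros [(v & <- & H)|(v & <- & H)]; simpl; auto.
Qed.

Lemma exists_max {T} (L : list T) (f : T -> R) :
  L <> nil -> exists w, In w L /\ forall v, In v L -> f v <= f w.
Proof.
  induction L as [|x L IH]; [easy|]. intros _. destruct L as [|y L].
  - exists x. split; [now left|]. intros v [<-|[]]. apply Rle_refl.
  - destruct IH as (w & Hw & Hmax); [easy|].
    destruct (Rle_dec (f x) (f w)) as [H|H].
    + exists w. split; [now right|]. intros v [<-|Hv]; auto.
    + exists x. split; [now left|]. intros v [<-|Hv]; [apply Rle_refl|].
      specialize (Hmax v Hv). lra.
Qed.

Lemma split_last (w : list bool) : w <> nil -> exists v x, w = v ++ x :: nil.
Proof.
  intros H. destruct (exists_last H) as (v & x & Hw). now exists v, x.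
Qed.

Lemma repeat_cons_app (r : nat) (b : bool) : repeat b (S r) = repeat b r ++ b :: nil.
Proof. induction r as [|r IH]; [easy|]. simpl. simpl in IH. now rewrite <- IH. Qed.

(** Chessboard estimate.  Among the words of length [2m] take one of maximal value; by
    [word_trace_reflect] both of its reflections are maximal as well, and choosing the axis at the
    end of a run of [false] lengthens that run until it fills the word. *)
Lemma word_trace_le m w : (1 <= m)%nat -> length w = (2 * m)%nat ->
  word_trace w <= word_trace (repeat false (2 * m)).
Proof.
  intros Hm Hw.
  destruct (exists_max (words (2 * m)) word_trace) as (w0 & Hw0 & Hmax).
  { intros E. pose proof (in_words _ w Hw) as H. now rewrite E in H. }
  assert (Hmax' : forall v, length v = (2 * m)%nat -> word_trace v <= word_trace w0)
    by (intros v Hv; apply Hmax; now apply in_words).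
  clear Hmax. apply words_length in Hw0.
  assert (H0 : forall v, 0 <= word_trace v) by (intros; apply Cmod_ge_0).
  assert (Refl : forall v x u y, length v = (m - 1)%nat -> length u = (m - 1)%nat ->
            word_trace ((v ++ x :: nil) ++ (u ++ y :: nil)) = word_trace w0 ->
            word_trace ((v ++ false :: nil) ++ (rev v ++ false :: nil)) = word_trace w0).
  { intros v x u y Hv Hu E. apply Rle_antisym.
    - apply Hmax'. rewrite !length_app, length_rev. simpl. lia.
    - pose proof (word_trace_reflect v x u y) as H. rewrite E in H.
      assert (H' : word_trace ((u ++ false :: nil) ++ rev u ++ false :: nil) <= word_trace w0).
      { apply Hmax'. rewrite !length_app, length_rev. simpl. lia. }
      pose proof (H0 w0). pose proof (H0 ((v ++ false :: nil) ++ rev v ++ false :: nil)). nra. }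
  assert (Run : forall r, (r <= 2 * m)%nat ->
            exists u, length u = (2 * m - r)%nat /\ word_trace (repeat false r ++ u) = word_trace w0).
  { induction r as [|r IH]; intros Hr.
    - exists w0. split; [lia|reflexivity].
    - destruct IH as (u & Hu & E); [lia|].
      destruct (le_lt_dec m r) as [Hmr|Hmr].
      + (* the run already covers one half of the word *)
        destruct (split_last (repeat false (r - m) ++ u)) as (z & y & Hz).
        { intros E'. apply app_eq_nil in E'. destruct E' as [_ ->]. simpl in Hu. lia. }
        assert (Lz : length z = (m - 1)%nat).
        { apply (f_equal (@length bool)) in Hz. rewrite !length_app, repeat_length in Hz.
          simpl in Hz. lia. }
        exists (repeat false (2 * m - S r)). split; [apply repeat_length|].
        rewrite <- (Refl (repeat false (m - 1)) false z y).
        * f_equal. rewrite rev_repeat, <- !repeat_cons_app, <- !repeat_app. f_equal. lia.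
        * apply repeat_length.
        * exact Lz.
        * rewrite <- E. f_equal. rewrite <- Hz, <- repeat_cons_app, app_assoc, <- repeat_app.
          do 2 f_equal. lia.
      + (* rotate so that the run ends at the axis *)
        set (z2 := skipn (m + 1) u). set (z1 := firstn (m + 1) u).
        assert (L2 : length z2 = (m - 1 - r)%nat) by (unfold z2; rewrite length_skipn; lia).
        assert (L1 : length z1 = (m + 1)%nat) by (unfold z1; rewrite length_firstn; lia).
        assert (Ez : u = z1 ++ z2) by (symmetry; apply firstn_skipn).
        destruct z1 as [|x z1]; [simpl in L1; lia|].
        destruct (split_last z1) as (ys & y & Hy).
        { intros ->. simpl in L1. lia. }
        exists (repeat false r ++ rev z2 ++ false :: z2). split.
        * rewrite !length_app, repeat_length, length_rev. simpl. lia.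
        * rewrite <- (Refl (z2 ++ repeat false r) x ys y).
          -- unfold word_trace. f_equal.
             rewrite repeat_cons_app, rev_app_distr, rev_repeat.
             transitivity (tr (word_mx (((repeat false r ++ false :: nil) ++ repeat false r ++ rev z2
                                     ++ false :: nil) ++ z2))).
             ++ do 2 f_equal. rewrite <- !app_assoc. reflexivity.
             ++ rewrite tr_rot. do 2 f_equal. rewrite <- !app_assoc. reflexivity.
          -- rewrite length_app, repeat_length. lia.
          -- apply (f_equal (@length bool)) in Hy. rewrite length_app in Hy. simpl in Hy, L1. lia.
          -- rewrite <- E. unfold word_trace. f_equal. rewrite <- Hy, Ez.
             transitivity (tr (word_mx (z2 ++ (repeat false r ++ x :: z1)))).
             ++ do 2 f_equal. rewrite <- !app_assoc. reflexivity.
             ++ rewrite tr_rot. do 2 f_equal. rewrite <- app_assoc. reflexivity. }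
  destruct (Run (2 * m)%nat (le_n _)) as (u & Hu & E).
  assert (u = nil) as -> by (destruct u; [easy|simpl in Hu; lia]).
  rewrite app_nil_r in E. rewrite E. auto.
Qed.

(** With [B = (M diag s)^m], the reflection of [B] bounds [Tr M^{2m}] from below by [Tr (B adj B)], while
    [adj B = diag s B diag s] turns [Tr B^2] into the sum of [s_i s_j |B_{ij}|^2]. *)
Theorem trace_gap m : (1 <= m)%nat ->
  exists delta : R,
    (tr (word_mx (repeat false (2 * m))) - tr (word_mx (repeat true (2 * m))) = RtoC delta)%C /\
    rsum l (fun i => rsum l (fun j =>
      (1 - s i * s j) * Cmod (word_mx (repeat true m) i j) ^ 2)) <= delta.
Proof.
  intros Hm. destruct m as [|p]; [lia|].
  set (B := word_mx (repeat true (S p))).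
  assert (EB : B = scale true (palin_mx (repeat true p))) by (unfold B;
      now rewrite repeat_cons_app, word_mx_palin_mx).
  assert (HB : forall i j, (B i j * B j i = RtoC (s i * s j * Cmod (B i j) ^ 2))%C).
  { intros i j. rewrite RtoC_mult, Cmod2_conj, EB. unfold scale.
    assert (E : palin_mx (repeat true p) j i = Cconj (palin_mx (repeat true p) i j)).
    { change (Cconj (palin_mx (repeat true p) i j)) with (adj (palin_mx (repeat true p)) j i).
      now rewrite adj_palin_mx, rev_repeat. }
    rewrite E, Cmult_conj, diag_entry_conj. unfold diag_entry. rewrite !RtoC_mult.
    transitivity (palin_mx (repeat true p) i j * Cconj (palin_mx (repeat true p) i j)
        * RtoC (s j) * RtoC (s i)
                  * (RtoC (s j) * RtoC (s j)))%C; [|ring].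
    rewrite <- (RtoC_mult (s j) (s j)), s_invol. ring. }
  assert (E2 : forall b : bool, repeat b (2 * S p) = repeat b (S p) ++ repeat b (S p))
    by (intros b; rewrite <- repeat_app; f_equal; lia).
  assert (T1 : tr (word_mx (repeat true (2 * S p))) =
               RtoC (rsum l (fun i => rsum l (fun j => s i * s j * Cmod (B i j) ^ 2)))).
  { rewrite E2, word_mx_app by easy. fold B. unfold tr, mm. rewrite <- csum_RtoC.
    apply csum_ext. intros i _. rewrite <- csum_RtoC. apply csum_ext. intros j _. apply HB. }
  assert (T2 : exists h, 0 <= h /\ tr (word_mx (repeat false (2 * S p))) = RtoC h).
  { exists (hs (word_mx (repeat false p ++ false :: nil))). split; [apply hs_nonneg|].
    rewrite <- tr_reflect. rewrite rev_repeat, <- !repeat_cons_app. now rewrite E2. }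
  destruct T2 as (h & Hh & T2).
  assert (T3 : hs B <= h).
  { pose proof (tr_reflect (repeat true p) true) as H. rewrite <- repeat_cons_app in H. fold B in H.
    rewrite rev_repeat in H.
    assert (Hle := word_trace_le (S p) ((repeat true p ++ false :: nil) ++ repeat true p ++ false
        :: nil) Hm).
    unfold word_trace in Hle. rewrite H, T2, !Cmod_R, !Rabs_pos_eq in Hle; try apply hs_nonneg; try easy.
    apply Hle. rewrite !length_app, repeat_length. simpl. lia. }
  eexists. split.
  - rewrite T1, T2, <- RtoC_minus. reflexivity.
  - unfold hs in T3.
    match goal with |- ?L <= h - ?K =>
      enough (L + K = rsum l (fun i => rsum l (fun j => Cmod (B i j) ^ 2))) by lra end.
    rewrite <- rsum_plus. apply rsum_ext. intros i _. rewrite <- rsum_plus. apply rsum_ext.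
    intros j _. ring.
Qed.

End Matrices.

(** The entry [(k, h)] of a power of the matrix [K] is the sum of these products over the
    intermediate points [ks]. *)
Fixpoint path_prod (K : Z -> Z -> C) (k : Z) (ks : list Z) (h : Z) : C :=
  match ks with
  | nil => K k h
  | x :: xs => (K k x * path_prod K x xs h)%C
  end.

Lemma word_mx_repeat_box_sum N (M : Z -> Z -> C) s b d k h :
  word_mx (zrange N) M s (repeat b (S d)) k h = box_sum N d (fun ks => path_prod (scale s b M) k ks h).
Proof.
  revert k h. induction d as [|d IH]; intros k h; [reflexivity|].
  change (repeat b (S (S d))) with (b :: repeat b (S d)).
  rewrite word_mx_cons by easy. unfold mm. cbn [box_sum]. apply csum_ext. intros x _.
  rewrite IH, <- box_sum_scal. reflexivity.
Qed.

(** * Calculus of complex-valued functions of a real variable *)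

Definition contC (u : R -> C) : Prop :=
  forall t, continuous (fun s => Re (u s)) t /\ continuous (fun s => Im (u s)) t.

Definition diffC (u : R -> C) : Prop :=
  forall t, ex_derive (fun s => Re (u s)) t /\ ex_derive (fun s => Im (u s)) t.

Definition Cder (u : R -> C) (t : R) : C :=
  (Derive (fun s => Re (u s)) t, Derive (fun s => Im (u s)) t).

Fixpoint Ck (k : nat) (u : R -> C) : Prop :=
  match k with
  | O => contC u
  | S k => diffC u /\ Ck k (Cder u)
  end.

Definition periodic (u : R -> C) : Prop := forall t, u (t + 2 * PI) = u t.

Definition smoothC (u : R -> C) : Prop := periodic u /\ forall k, Ck k u.

Lemma continuous_Rplus (f g : R -> R) t :
  continuous f t -> continuous g t -> continuous (fun s => f s + g s) t.
Proof. intros Hf Hg. apply (continuous_plus f g t Hf Hg). Qed.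

Lemma continuous_Rminus (f g : R -> R) t :
  continuous f t -> continuous g t -> continuous (fun s => f s - g s) t.
Proof. intros Hf Hg. apply (continuous_minus f g t Hf Hg). Qed.

Lemma continuous_Rmult (f g : R -> R) t :
  continuous f t -> continuous g t -> continuous (fun s => f s * g s) t.
Proof. intros Hf Hg. apply (continuous_mult f g t Hf Hg). Qed.

Lemma contC_plus u v : contC u -> contC v -> contC (fun t => u t + v t)%C.
Proof.
  intros Hu Hv t. destruct (Hu t), (Hv t). split; simpl; now apply continuous_Rplus.
Qed.

Lemma contC_minus u v : contC u -> contC v -> contC (fun t => u t - v t)%C.
Proof.
  intros Hu Hv t. destruct (Hu t), (Hv t). split; simpl; now apply continuous_Rminus.
Qed.

Lemma contC_mult u v : contC u -> contC v -> contC (fun t => u t * v t)%C.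
Proof.
  intros Hu Hv t. destruct (Hu t), (Hv t). split; simpl.
  - apply continuous_Rminus; now apply continuous_Rmult.
  - apply continuous_Rplus; now apply continuous_Rmult.
Qed.

Lemma contC_const c : contC (fun _ => c).
Proof. intros t. split; apply continuous_const. Qed.

Lemma diffC_contC u : diffC u -> contC u.
Proof.
  intros H t. destruct (H t) as [H1 H2]. split.
  - apply (ex_derive_continuous (fun s => Re (u s)) t H1).
  - apply (ex_derive_continuous (fun s => Im (u s)) t H2).
Qed.

Lemma diffC_plus u v : diffC u -> diffC v -> diffC (fun t => u t + v t)%C.
Proof.
  intros Hu Hv t. destruct (Hu t), (Hv t).
  split; [apply (ex_derive_plus (fun s => Re (u s)) (fun s => Re (v s)))
         |apply (ex_derive_plus (fun s => Im (u s)) (fun s => Im (v s)))]; assumption.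
Qed.

Lemma diffC_mult u v : diffC u -> diffC v -> diffC (fun t => u t * v t)%C.
Proof.
  intros Hu Hv t. destruct (Hu t), (Hv t). split; simpl.
  - apply (ex_derive_minus (fun s => Re (u s) * Re (v s)) (fun s => Im (u s) * Im (v s)));
      apply ex_derive_mult; assumption.
  - apply (ex_derive_plus (fun s => Re (u s) * Im (v s)) (fun s => Im (u s) * Re (v s)));
      apply ex_derive_mult; assumption.
Qed.

Lemma diffC_const c : diffC (fun _ => c).
Proof. intros t. split; apply ex_derive_const. Qed.

Lemma Cder_plus u v : diffC u -> diffC v ->
    Cder (fun t => u t + v t)%C = (fun t => Cder u t + Cder v t)%C.
Proof.
  intros Hu Hv. apply functional_extensionality; intros t. destruct (Hu t), (Hv t).
  unfold Cder. apply injective_projections; simpl.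
  - now apply (Derive_plus (fun s => Re (u s)) (fun s => Re (v s))).
  - now apply (Derive_plus (fun s => Im (u s)) (fun s => Im (v s))).
Qed.

Lemma Cder_mult u v : diffC u -> diffC v ->
  Cder (fun t => u t * v t)%C = (fun t => Cder u t * v t + u t * Cder v t)%C.
Proof.
  intros Hu Hv. apply functional_extensionality; intros t. destruct (Hu t), (Hv t).
  unfold Cder. apply injective_projections; simpl.
  - rewrite (Derive_minus (fun s => Re (u s) * Re (v s)) (fun s => Im (u s) * Im (v s)))
      by (apply ex_derive_mult; assumption).
    rewrite !Derive_mult by assumption. unfold Re, Im. ring.
  - rewrite (Derive_plus (fun s => Re (u s) * Im (v s)) (fun s => Im (u s) * Re (v s)))
      by (apply ex_derive_mult; assumption).
    rewrite !Derive_mult by assumption. unfold Re, Im. ring.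
Qed.

Lemma Cder_const c : Cder (fun _ => c) = (fun _ => RtoC 0).
Proof.
  apply functional_extensionality; intros t. unfold Cder. now rewrite !Derive_const.
Qed.

Lemma Ck_pred k u : Ck (S k) u -> Ck k u.
Proof.
  revert u. induction k as [|k IH]; intros u [H1 H2].
  - now apply diffC_contC.
  - split; [easy|]. now apply IH.
Qed.

Lemma Ck_plus k u v : Ck k u -> Ck k v -> Ck k (fun t => u t + v t)%C.
Proof.
  revert u v. induction k as [|k IH]; intros u v; [apply contC_plus|].
  intros [Hu Hu'] [Hv Hv']. split; [now apply diffC_plus|].
  rewrite Cder_plus by assumption. now apply IH.
Qed.

Lemma Ck_mult k u v : Ck k u -> Ck k v -> Ck k (fun t => u t * v t)%C.
Proof.
  revert u v. induction k as [|k IH]; intros u v; [apply contC_mult|].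
  intros Hu Hv. pose proof (Ck_pred _ _ Hu). pose proof (Ck_pred _ _ Hv).
  destruct Hu as [Hu Hu'], Hv as [Hv Hv']. split; [now apply diffC_mult|].
  rewrite Cder_mult by assumption. apply Ck_plus; now apply IH.
Qed.

Lemma Ck_const k c : Ck k (fun _ => c).
Proof.
  revert c. induction k as [|k IH]; intros c; [apply contC_const|].
  split; [apply diffC_const|]. rewrite Cder_const. apply IH.
Qed.

Lemma smoothC_plus u v : smoothC u -> smoothC v -> smoothC (fun t => u t + v t)%C.
Proof.
  intros [Pu Hu] [Pv Hv]. split; [intros t; now rewrite Pu, Pv|]. intros k; now apply Ck_plus.
Qed.

Lemma smoothC_mult u v : smoothC u -> smoothC v -> smoothC (fun t => u t * v t)%C.
Proof.
  intros [Pu Hu] [Pv Hv]. split; [intros t; now rewrite Pu, Pv|]. intros k; now apply Ck_mult.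
Qed.

Lemma smoothC_const c : smoothC (fun _ => c).
Proof. split; [easy|]. intros; apply Ck_const. Qed.

Lemma Derive_shift (f : R -> R) t h : Derive (fun s => f (s + h)) t = Derive f (t + h).
Proof.
  unfold Derive. f_equal. apply Lim_ext. intros y. do 2 f_equal. f_equal. ring.
Qed.

Lemma smoothC_Cder u : smoothC u -> smoothC (Cder u).
Proof.
  intros [P H]. split.
  - intros t. unfold Cder. f_equal; rewrite <- Derive_shift; apply Derive_ext; intros s; now rewrite P.
  - intros k. apply (H (S k)).
Qed.

Lemma smoothC_contC u : smoothC u -> contC u.
Proof. intros [_ H]. apply (H O). Qed.

Lemma smoothC_diffC u : smoothC u -> diffC u.
Proof. intros [_ H]. apply (H 1%nat). Qed.

Lemma Cder_RtoC (f : R -> R) : Cder (fun t => RtoC (f t)) = (fun t => RtoC (Derive f t)).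
Proof.
  apply functional_extensionality; intros t. unfold Cder, RtoC. simpl. now rewrite Derive_const.
Qed.

Lemma smooth_on_circle_smoothC a : smooth_on_circle a -> smoothC (fun t => RtoC (a t)).
Proof.
  intros [P H]. split; [intros t; now rewrite P|].
  assert (HE : forall j, diffC (fun t => RtoC (Derive_n a j t))).
  { intros j t. split; [apply (H (S j) t)|]. simpl. apply ex_derive_const. }
  assert (forall k j, Ck k (fun t => RtoC (Derive_n a j t))) as HK.
  { induction k as [|k IH]; intros j.
    - apply diffC_contC, HE.
    - split; [apply HE|]. rewrite Cder_RtoC. apply (IH (S j)). }
  intros k. apply (HK k O).
Qed.

(** ** Exponentials *)

Lemma expi_plus m n t : expi (m + n) t = (expi m t * expi n t)%C.
Proof.
  unfold expi. rewrite plus_IZR, Rmult_plus_distr_r, cos_plus, sin_plus.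
  apply injective_projections; simpl; ring.
Qed.

Lemma expi_0 t : expi 0 t = RtoC 1.
Proof. unfold expi. rewrite Rmult_0_l, cos_0, sin_0. reflexivity. Qed.

Lemma Cmod_expi n t : Cmod (expi n t) = 1.
Proof.
  unfold expi, Cmod. cbn [fst snd].
  replace (cos (IZR n * t) ^ 2 + sin (IZR n * t) ^ 2) with 1; [apply sqrt_1|].
  pose proof (sin2_cos2 (IZR n * t)). unfold Rsqr in H. lra.
Qed.

Lemma expi_conj n t : Cconj (expi n t) = expi (- n) t.
Proof.
  unfold expi, Cconj. rewrite opp_IZR. cbn [fst snd].
  replace (- IZR n * t) with (- (IZR n * t)) by ring. now rewrite cos_neg, sin_neg.
Qed.

Lemma expi_arg_plus n s t : expi n (s + t) = (expi n s * expi n t)%C.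
Proof.
  unfold expi. rewrite Rmult_plus_distr_l, cos_plus, sin_plus.
  apply injective_projections; simpl; ring.
Qed.

Lemma expi_arg_opp n s : expi n (- s) = expi (- n) s.
Proof. unfold expi. rewrite opp_IZR. do 2 f_equal; ring. Qed.

Lemma expi_periodic n : periodic (expi n).
Proof.
  intros t. unfold expi.
  assert (E : forall k : nat, expi (Z.of_nat k) (t + 2 * PI) = expi (Z.of_nat k) t).
  { intros k. unfold expi. rewrite <- INR_IZR_INZ.
    replace (INR k * (t + 2 * PI)) with (INR k * t + 2 * INR k * PI) by ring.
    now rewrite cos_period, sin_period. }
  destruct (Z_le_dec 0 n) as [Hn|Hn].
  - rewrite <- (Z2Nat.id n) by easy. apply E.
  - assert (H : forall s, expi n s = Cconj (expi (- n) s))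
      by (intros s; now rewrite expi_conj, Z.opp_involutive).
    change (expi n (t + 2 * PI) = expi n t). rewrite !H. f_equal.
    rewrite <- (Z2Nat.id (- n)) by lia. apply E.
Qed.

Lemma diffC_expi n : diffC (expi n).
Proof.
  intros t. unfold expi. simpl. split; auto_derive; easy.
Qed.

Lemma Cder_expi n : Cder (expi n) = (fun t => Ci * RtoC (IZR n) * expi n t)%C.
Proof.
  apply functional_extensionality; intros t. unfold Cder.
  assert (H1 : is_derive (fun s => cos (IZR n * s)) t (- IZR n * sin (IZR n * t)))
    by (auto_derive; [easy|ring]).
  assert (H2 : is_derive (fun s => sin (IZR n * s)) t (IZR n * cos (IZR n * t)))
    by (auto_derive; [easy|ring]).
  apply injective_projections; cbn [fst snd].
  - refine (eq_trans (is_derive_unique _ _ _ H1) _). unfold Ci, RtoC. simpl. ring.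
  - refine (eq_trans (is_derive_unique _ _ _ H2) _). unfold Ci, RtoC. simpl. ring.
Qed.

Lemma smoothC_expi n : smoothC (expi n).
Proof.
  split; [apply expi_periodic|]. intros k. induction k as [|k IH].
  - apply diffC_contC, diffC_expi.
  - split; [apply diffC_expi|]. rewrite Cder_expi. apply Ck_mult; [apply Ck_const|easy].
Qed.

Lemma contC_expi n : contC (expi n).
Proof. apply smoothC_contC, smoothC_expi. Qed.

(** * Fourier coefficients *)

Definition Cint (u : R -> C) : C :=
  (RInt (fun t => Re (u t)) 0 (2 * PI), RInt (fun t => Im (u t)) 0 (2 * PI)).

Lemma contC_ex_RInt u a b :
  contC u -> ex_RInt (fun t => Re (u t)) a b /\ ex_RInt (fun t => Im (u t)) a b.
Proof.
  intros H. split; apply (ex_RInt_continuous (V := R_CompleteNormedModule)); intros z _; apply H.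
Qed.

Lemma RInt_Cint u : contC u -> RInt (V := C_R_CompleteNormedModule) u 0 (2 * PI) = Cint u.
Proof.
  intros H. destruct (contC_ex_RInt u 0 (2 * PI) H) as [H1 H2].
  apply is_RInt_unique. apply (is_RInt_fct_extend_pair (U := R_NormedModule) (V := R_NormedModule)).
  - apply (RInt_correct _ _ _ H1).
  - apply (RInt_correct _ _ _ H2).
Qed.

Lemma Cint_ext u v : (forall t, u t = v t) -> Cint u = Cint v.
Proof. intros H. f_equal. now apply functional_extensionality. Qed.

Lemma Cint_plus u v : contC u -> contC v -> Cint (fun t => u t + v t)%C = (Cint u + Cint v)%C.
Proof.
  intros Hu Hv. destruct (contC_ex_RInt u 0 (2 * PI) Hu), (contC_ex_RInt v 0 (2 * PI) Hv).
  unfold Cint. apply injective_projections; simpl.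
  - now apply (RInt_plus (V := R_CompleteNormedModule) (fun t => Re (u t)) (fun t => Re (v t))).
  - now apply (RInt_plus (V := R_CompleteNormedModule) (fun t => Im (u t)) (fun t => Im (v t))).
Qed.

Lemma Cint_scal c u : contC u -> Cint (fun t => c * u t)%C = (c * Cint u)%C.
Proof.
  intros Hu. destruct (contC_ex_RInt u 0 (2 * PI) Hu) as [H1 H2].
  assert (E : forall (k : R) f, ex_RInt f 0 (2 * PI) -> ex_RInt (fun t => k * f t) 0 (2 * PI) /\
                RInt (fun t => k * f t) 0 (2 * PI) = k * RInt f 0 (2 * PI)).
  { intros k f Hf. split.
    - apply (ex_RInt_scal (V := R_NormedModule) f 0 (2 * PI) k Hf).
    - apply (RInt_scal (V := R_CompleteNormedModule) f 0 (2 * PI) k Hf). }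
  unfold Cint. apply injective_projections; simpl.
  - rewrite <- (proj2 (E (fst c) _ H1)), <- (proj2 (E (snd c) _ H2)).
    apply (RInt_minus (V := R_CompleteNormedModule)); now apply E.
  - rewrite <- (proj2 (E (snd c) _ H1)), <- (proj2 (E (fst c) _ H2)).
    apply (RInt_plus (V := R_CompleteNormedModule)); now apply E.
Qed.

Lemma contC_csum {A} (l : list A) (F : A -> R -> C) :
  (forall x, contC (F x)) -> contC (fun t => csum l (fun x => F x t)).
Proof.
  intros H. induction l as [|x l IH]; [apply (contC_const (RtoC 0))|].
  apply (contC_plus (F x) (fun t => csum l (fun x => F x t))); auto.
Qed.

Lemma Cint_csum {A} (l : list A) (F : A -> R -> C) :
  (forall x, contC (F x)) -> Cint (fun t => csum l (fun x => F x t)) = csum l (fun x => Cint (F x)).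
Proof.
  intros H. induction l as [|x l IH].
  - change (csum nil (fun x => Cint (F x))) with (RtoC 0).
    rewrite (Cint_ext _ (fun t => RtoC 0 * RtoC 0)%C) by (intros;
        change (RtoC 0 = RtoC 0 * RtoC 0)%C; ring).
    rewrite Cint_scal by apply contC_const. ring.
  - change (csum (x :: l) (fun x => Cint (F x))) with (Cint (F x) + csum l (fun x => Cint (F x)))%C.
    rewrite <- IH. apply (Cint_plus (F x) (fun t => csum l (fun x => F x t))); [easy|].
    now apply contC_csum.
Qed.

Lemma Cmod_le_Re_Im z : Cmod z <= Rabs (Re z) + Rabs (Im z).
Proof.
  replace z with (RtoC (Re z) + Ci * RtoC (Im z))%C at 1
    by (destruct z; unfold Ci; apply injective_projections; simpl; ring).
  eapply Rle_trans; [apply Cmod_triangle|]. rewrite Cmod_mult, Cmod_Ci, !Cmod_R. lra.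
Qed.

Lemma im_le_Cmod z : Rabs (Im z) <= Cmod z.
Proof. eapply Rle_trans; [|apply Rmax_Cmod]. apply Rmax_r. Qed.

(** The real and imaginary parts are estimated separately, hence twice the optimal constant. *)
Lemma Cint_bound u M :
  contC u -> (forall t, 0 <= t <= 2 * PI -> Cmod (u t) <= M) -> Cmod (Cint u) <= 4 * PI * M.
Proof.
  intros Hu HM. destruct (contC_ex_RInt u 0 (2 * PI) Hu) as [H1 H2]. pose proof PI_RGT_0.
  eapply Rle_trans; [apply Cmod_le_Re_Im|]. unfold Cint. simpl.
  assert (A1 := abs_RInt_le_const (fun t => Re (u t)) 0 (2 * PI) M ltac:(lra) H1
    (fun t Ht => Rle_trans _ _ _ (re_le_Cmod (u t)) (HM t Ht))).
  assert (A2 := abs_RInt_le_const (fun t => Im (u t)) 0 (2 * PI) M ltac:(lra) H2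
    (fun t Ht => Rle_trans _ _ _ (im_le_Cmod (u t)) (HM t Ht))).
  lra.
Qed.

Lemma fourierE u n :
  contC u -> fourier u n = (RtoC (/ (2 * PI)) * Cint (fun t => u t * expi (- n) t))%C.
Proof.
  intros H. unfold fourier. f_equal. apply RInt_Cint. apply contC_mult; [easy|apply contC_expi].
Qed.

Lemma fourier_ext u v n : (forall t, u t = v t) -> fourier u n = fourier v n.
Proof. intros H. f_equal. now apply functional_extensionality. Qed.

Lemma fourier_plus u v n :
  contC u -> contC v -> fourier (fun t => u t + v t)%C n = (fourier u n + fourier v n)%C.
Proof.
  intros Hu Hv. rewrite !fourierE by (assumption || now apply contC_plus).
  rewrite <- Cmult_plus_distr_l. f_equal.
  rewrite <- Cint_plus by (apply contC_mult; [assumption|apply contC_expi]).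
  apply Cint_ext. intros; ring.
Qed.

Lemma fourier_scal c u n : contC u -> fourier (fun t => c * u t)%C n = (c * fourier u n)%C.
Proof.
  intros Hu. rewrite !fourierE by (assumption || (apply contC_mult; [apply contC_const|assumption])).
  rewrite Cmult_assoc, (Cmult_comm c), <- Cmult_assoc. f_equal.
  rewrite <- Cint_scal by (apply contC_mult; [assumption|apply contC_expi]).
  apply Cint_ext. intros; ring.
Qed.

Lemma fourier_minus u v n :
  contC u -> contC v -> fourier (fun t => u t - v t)%C n = (fourier u n - fourier v n)%C.
Proof.
  intros Hu Hv. rewrite (fourier_ext _ (fun t => u t + (-1) * v t)%C) by (intros; ring).
  rewrite fourier_plus, fourier_scal; try assumption; [ring|].
  apply contC_mult; [apply contC_const|assumption].
Qed.

Lemma fourier_expi_mult u j k : contC u -> fourier (fun t => expi j t * u t)%C k = fourier u (k - j).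
Proof.
  intros Hu. rewrite !fourierE by (assumption || (apply contC_mult; [apply contC_expi|assumption])).
  f_equal. apply Cint_ext. intros t.
  replace (- (k - j))%Z with (j + - k)%Z by lia. rewrite expi_plus. ring.
Qed.

Lemma fourier_bound u n M :
  contC u -> (forall t, 0 <= t <= 2 * PI -> Cmod (u t) <= M) -> Cmod (fourier u n) <= 2 * M.
Proof.
  intros Hu HM. rewrite fourierE by assumption. rewrite Cmod_mult, Cmod_R.
  pose proof PI_RGT_0. rewrite Rabs_pos_eq by (apply Rlt_le, Rinv_0_lt_compat; lra).
  assert (HB := Cint_bound (fun t => u t * expi (- n) t)%C M).
  apply Rmult_le_reg_l with (2 * PI); [lra|]. rewrite <- Rmult_assoc, Rinv_r by lra.
  rewrite Rmult_1_l. eapply Rle_trans; [apply HB|lra].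
  - apply contC_mult; [assumption|apply contC_expi].
  - intros t Ht. rewrite Cmod_mult, Cmod_expi. specialize (HM t Ht). lra.
Qed.

Lemma contC_bounded u : contC u -> exists M, forall t, 0 <= t <= 2 * PI -> Cmod (u t) <= M.
Proof.
  intros H. pose proof PI_RGT_0.
  assert (B : forall f : R -> R, (forall t, continuous f t) ->
                exists M, forall t, 0 <= t <= 2 * PI -> Rabs (f t) <= M).
  { intros f Hf.
    destruct (continuity_ab_maj (fun t => Rabs (f t)) 0 (2 * PI)) as (x & Hx & _); [lra| |].
    - intros c _. apply continuity_pt_filterlim.
      apply (continuous_comp f Rabs); [apply Hf|apply continuous_Rabs].
    - exists (Rabs (f x)). exact Hx. }
  destruct (B (fun t => Re (u t))) as [M1 H1]; [intros; apply H|].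
  destruct (B (fun t => Im (u t))) as [M2 H2]; [intros; apply H|].
  exists (M1 + M2). intros t Ht. eapply Rle_trans; [apply Cmod_le_Re_Im|].
  specialize (H1 t Ht). specialize (H2 t Ht). lra.
Qed.

Lemma Cint_Cder u : diffC u -> contC (Cder u) -> periodic u -> Cint (Cder u) = RtoC 0.
Proof.
  intros Hd Hc P. unfold Cint.
  assert (E : u (2 * PI) = u 0) by (rewrite <- (P 0); f_equal; ring).
  apply injective_projections; cbn [fst snd].
  - refine (eq_trans (RInt_Derive (fun s => Re (u s)) 0 (2 * PI) _ _) _).
    + intros z _; exact (proj1 (Hd z)).
    + intros z _; exact (proj1 (Hc z)).
    + rewrite E. simpl. ring.
  - refine (eq_trans (RInt_Derive (fun s => Im (u s)) 0 (2 * PI) _ _) _).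
    + intros z _; exact (proj2 (Hd z)).
    + intros z _; exact (proj2 (Hc z)).
    + rewrite E. simpl. ring.
Qed.

(** Integration by parts; the boundary terms cancel by periodicity. *)
Lemma fourier_Cder u n :
  smoothC u -> fourier (Cder u) n = (Ci * RtoC (IZR n) * fourier u n)%C.
Proof.
  intros Hu. pose proof (smoothC_Cder u Hu) as Hu'.
  rewrite !fourierE by (now apply smoothC_contC).
  pose proof (smoothC_mult _ _ Hu (smoothC_expi (- n))) as Hp.
  assert (H0 := Cint_Cder _ (smoothC_diffC _ Hp) (smoothC_contC _ (smoothC_Cder _ Hp)) (proj1 Hp)).
  rewrite Cder_mult, Cder_expi in H0 by (apply smoothC_diffC; [assumption || apply smoothC_expi]).
  rewrite (Cint_ext _ (fun t => Cder u t * expi (- n) t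
             + (- (Ci * RtoC (IZR n))) * (u t * expi (- n) t))%C) in H0.
  2:{ intros t. rewrite opp_IZR, RtoC_opp. ring. }
  rewrite Cint_plus, Cint_scal in H0.
  - replace (Cint (fun t => Cder u t * expi (- n) t)%C)
      with (Ci * RtoC (IZR n) * Cint (fun t => u t * expi (- n) t)%C)%C; [ring|].
    apply Ceq_minus. apply Ceq_minus in H0.
    rewrite <- (Cplus_0_r (_ - _)), <- H0 at 1. ring.
  - now apply smoothC_contC.
  - apply contC_mult; [now apply smoothC_contC|apply contC_expi].
  - apply contC_mult; [apply contC_const|now apply smoothC_contC].
Qed.

(** For [k <> n] the coefficient vanishes because [i (k - n)] times it is a coefficient of the derivative
    of a constant. *)
Lemma fourier_expi n k : fourier (expi n) k = if Z.eq_dec k n then RtoC 1 else RtoC 0.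
Proof.
  pose proof PI_RGT_0.
  assert (E0 : fourier (fun _ => RtoC 1) 0 = RtoC 1).
  { rewrite fourierE by apply contC_const.
    rewrite (Cint_ext _ (fun _ => RtoC 1)).
    - unfold Cint. simpl. rewrite !RInt_const. unfold scal; simpl. unfold mult; simpl.
      apply injective_projections; simpl; field; lra.
    - intros t. change (- 0)%Z with 0%Z. rewrite expi_0. ring. }
  assert (E1 : forall j, j <> 0%Z -> fourier (fun _ => RtoC 1) j = RtoC 0).
  { intros j Hj. pose proof (fourier_Cder (fun _ => RtoC 1) j (smoothC_const _)) as F.
    rewrite Cder_const in F.
    rewrite (fourier_ext (fun _ => RtoC 0) (fun _ => RtoC 0 * RtoC 1)%C) in F by (intros; ring).
    rewrite fourier_scal, Cmult_0_l in F by apply contC_const.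
    assert (Hn : (Ci * RtoC (IZR j))%C <> RtoC 0).
    { apply Cmult_neq_0; [apply Ci_nz|]. intros E. apply RtoC_inj, eq_IZR in E. contradiction. }
    transitivity (/ (Ci * RtoC (IZR j)) * (Ci * RtoC (IZR j) * fourier (fun _ => RtoC 1) j))%C.
    - rewrite Cmult_assoc, Cinv_l by easy. ring.
    - rewrite <- F. ring. }
  rewrite (fourier_ext _ (fun t => expi n t * RtoC 1)%C) by (intros; ring).
  rewrite fourier_expi_mult by apply contC_const.
  destruct (Z.eq_dec k n) as [->|Hk].
  - now rewrite Z.sub_diag.
  - apply E1. lia.
Qed.

Lemma fourier_D u n : smoothC u -> fourier (Defs.D u) n = (RtoC (IZR n) * fourier u n)%C.
Proof.
  intros Hu. rewrite (fourier_ext _ (fun t => (- Ci) * Cder u t)%C) by easy.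
  rewrite fourier_scal by (now apply smoothC_contC, smoothC_Cder).
  rewrite fourier_Cder by assumption.
  transitivity (- (Ci * Ci) * RtoC (IZR n) * fourier u n)%C; [ring|].
  replace (Ci * Ci)%C with (- (1))%C; [ring|].
  unfold Ci. apply injective_projections; simpl; ring.
Qed.

Lemma smoothC_D u : smoothC u -> smoothC (Defs.D u).
Proof.
  intros Hu. apply (smoothC_mult (fun _ => - Ci)%C (Cder u)); [apply smoothC_const|].
  now apply smoothC_Cder.
Qed.

(** Repeated integration by parts: the Fourier coefficients decay rapidly. *)
Lemma fourier_decay u p :
  smoothC u -> exists K, 0 <= K /\ forall n, Cmod (fourier u n) <= K / (1 + Rabs (IZR n)) ^ p.
Proof.
  intros Hu.
  assert (H : exists M, forall n, Rabs (IZR n) ^ p * Cmod (fourier u n) <= M).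
  { revert u Hu. induction p as [|p IH]; intros u Hu.
    - destruct (contC_bounded u (smoothC_contC _ Hu)) as [M HM]. exists (2 * M). intros n.
      rewrite pow_O, Rmult_1_l. apply fourier_bound; [now apply smoothC_contC|easy].
    - destruct (IH (Defs.D u) (smoothC_D u Hu)) as [M HM]. exists M. intros n.
      specialize (HM n). rewrite fourier_D, Cmod_mult, Cmod_R in HM by assumption. simpl. lra. }
  destruct H as [M HM]. destruct (contC_bounded u (smoothC_contC _ Hu)) as [M' HM'].
  set (K := 2 ^ p * (Rabs M + Rabs (2 * M'))).
  assert (HK : 0 <= K).
  { unfold K. apply Rmult_le_pos; [apply pow_le; lra|].
    pose proof (Rabs_pos M). pose proof (Rabs_pos (2 * M')). lra. }
  exists K. split; [exact HK|]. intros n.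
  assert (H0 : Cmod (fourier u n) <= 2 * M') by (apply fourier_bound; [now apply smoothC_contC|easy]).
  specialize (HM n). set (x := Rabs (IZR n)) in *. assert (Hx : 0 <= x) by apply Rabs_pos.
  set (c := Cmod (fourier u n)) in *. assert (Hc : 0 <= c) by apply Cmod_ge_0.
  assert (Hp : 0 < (1 + x) ^ p) by (apply pow_lt; lra).
  apply Rmult_le_reg_r with ((1 + x) ^ p); [easy|].
  unfold Rdiv. rewrite Rmult_assoc, Rinv_l, Rmult_1_r by lra. unfold K.
  assert (H2 : (1 + x) ^ p <= 2 ^ p * (x ^ p + 1)).
  { assert (P2 : 0 < 2 ^ p) by (apply pow_lt; lra).
    assert (0 <= x ^ p) by (now apply pow_le).
    destruct (Rle_dec x 1).
    - apply Rle_trans with (2 ^ p); [apply pow_incr; lra|]. nra.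
    - apply Rle_trans with ((2 * x) ^ p); [apply pow_incr; lra|]. rewrite Rpow_mult_distr. nra. }
  apply Rle_trans with (c * (2 ^ p * (x ^ p + 1))); [now apply Rmult_le_compat_l|].
  replace (c * (2 ^ p * (x ^ p + 1))) with (2 ^ p * (x ^ p * c + c)) by ring.
  apply Rmult_le_compat_l; [apply pow_le; lra|].
  pose proof (Rle_abs M). pose proof (Rle_abs (2 * M')). lra.
Qed.

(** * Fourier series *)

Lemma contC_uniform_limit (U : nat -> R -> C) w K :
  (forall N, contC (U N)) -> (forall N t, Cmod (U N t - w t) <= K / (INR N + 1)) -> contC w.
Proof.
  intros HU HK.
  assert (G : forall pr : C -> R, (forall z z', pr (z - z')%C = pr z - pr z') ->
     (forall z, Rabs (pr z) <= Cmod z) ->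
     (forall N t, continuous (fun s => pr (U N s)) t) -> forall t, continuous (fun s => pr (w s)) t).
  { intros pr Hpr Hle Hc t. apply continuity_pt_filterlim.
    assert (P1 : 0 < 1) by lra.
    apply (CVU_continuity (fun N s => pr (U N s)) (fun s => pr (w s)) t (mkposreal 1 P1)).
    - intros e He.
      assert (HL : Clim (fun n => RtoC (K / (INR n + 1))) (RtoC 0)).
      { apply Clim_rate with (K := K). intros n. rewrite <- RtoC_minus, Cmod_R, Rminus_0_r.
        rewrite Rabs_pos_eq; [lra|]. eapply Rle_trans; [apply Cmod_ge_0|apply (HK n 0)]. }
      destruct (HL e He) as [N HN]. exists N. intros n y Hn _.
      rewrite <- Hpr. eapply Rle_lt_trans; [apply Hle|]. rewrite Cmod_minus_sym.
      eapply Rle_lt_trans; [apply HK|]. specialize (HN n Hn).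
      rewrite <- RtoC_minus, Cmod_R, Rminus_0_r in HN.
      eapply Rle_lt_trans; [apply Rle_abs|exact HN].
    - intros n y _. apply continuity_pt_filterlim, Hc.
    - unfold Boule. rewrite Rminus_diag, Rabs_R0. simpl. lra. }
  intros t. split.
  - apply (G Re); [intros; reflexivity|apply re_le_Cmod|intros; apply HU].
  - apply (G Im); [intros; reflexivity|apply im_le_Cmod|intros; apply HU].
Qed.

Lemma fourier_csum {A} (l : list A) (F : A -> R -> C) n :
  (forall x, contC (F x)) ->
  fourier (fun t => csum l (fun x => F x t)) n = csum l (fun x => fourier (F x) n).
Proof.
  intros H. rewrite fourierE by (now apply contC_csum).
  rewrite (Cint_ext _ (fun t => csum l (fun x => F x t * expi (- n) t)%C))
    by (intros; now rewrite csum_scal_r).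
  rewrite Cint_csum by (intros; apply contC_mult; [easy|apply contC_expi]).
  rewrite <- csum_scal_l. apply csum_ext. intros x _. now rewrite fourierE.
Qed.

Definition has_series (c : Z -> C) (w : R -> C) : Prop :=
  forall t, w t = Zsum (fun n => c n * expi n t)%C.

Lemma dominated_expi K c t : dominated K c -> dominated K (fun n => c n * expi n t)%C.
Proof. intros H k. rewrite Cmod_mult, Cmod_expi, Rmult_1_r. apply H. Qed.

Lemma series_rate K c w N t : dominated K c -> has_series c w ->
  Cmod (csum (zrange N) (fun n => c n * expi n t)%C - w t) <= 2 * K / (INR N + 1).
Proof. intros H Hw. rewrite Hw. now apply dominated_tail, dominated_expi. Qed.

Lemma contC_partial c N : contC (fun t => csum (zrange N) (fun n => c n * expi n t)%C).
Proof.
  apply (contC_csum (zrange N) (fun n t => c n * expi n t)%C). intros n.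
  apply contC_mult; [apply contC_const|apply contC_expi].
Qed.

Lemma series_contC K c w : dominated K c -> has_series c w -> contC w.
Proof.
  intros H Hw.
  apply contC_uniform_limit with (fun N t => csum (zrange N) (fun n => c n * expi n t)%C) (2 * K).
  - intros N. apply contC_partial.
  - intros N t. now apply series_rate.
Qed.

(** The series converges uniformly, so it may be multiplied by [A] and integrated termwise. *)
Lemma fourier_mult_series K A c w k :
  contC A -> dominated K c -> has_series c w ->
  fourier (fun t => A t * w t)%C k = Zsum (fun x => fourier A (k - x) * c x)%C.
Proof.
  intros HA H Hw. pose proof (series_contC _ _ _ H Hw) as Cw.
  destruct (contC_bounded A HA) as [M HM].
  assert (HM0 : 0 <= M).
  { eapply Rle_trans; [apply Cmod_ge_0|apply (HM 0)]. pose proof PI_RGT_0; lra. }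
  assert (HD : dominated (2 * M * K) (fun x => fourier A (k - x) * c x)%C).
  { intros x. rewrite Cmod_mult. specialize (H x). pose proof (fourier_bound A (k - x) M HA HM).
    pose proof (Cmod_ge_0 (fourier A (k - x))). pose proof (Cmod_ge_0 (c x)).
    rewrite Rmult_assoc. apply Rmult_le_compat; assumption. }
  eapply Clim_unique; [|eapply dominated_lim, HD].
  apply Clim_rate with (2 * (M * (2 * K))). intros N.
  assert (E : csum (zrange N) (fun x => fourier A (k - x) * c x)%C =
              fourier (fun t => A t * csum (zrange N) (fun n => c n * expi n t))%C k).
  { rewrite (fourier_ext _ (fun t => csum (zrange N) (fun n => c n * (expi n t * A t)))%C).
    2:{ intros t. rewrite <- csum_scal_l. apply csum_ext. intros; ring. }
    rewrite (fourier_csum (zrange N) (fun n t => c n * (expi n t * A t))%C).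
    - apply csum_ext. intros x _.
      rewrite fourier_scal, fourier_expi_mult; [ring|easy|].
      apply contC_mult; [apply contC_expi|easy].
    - intros n. repeat apply contC_mult; try apply contC_const; try apply contC_expi; easy. }
  pose proof (contC_partial c N) as CP.
  rewrite E, <- fourier_minus by (now apply contC_mult).
  replace (2 * (M * (2 * K)) / (INR N + 1)) with (2 * (M * (2 * K / (INR N + 1))))
    by (unfold Rdiv; ring).
  apply fourier_bound; [apply contC_minus; now apply contC_mult|].
  intros t Ht.
  replace (A t * csum (zrange N) (fun n => c n * expi n t) - A t * w t)%C
    with (A t * (csum (zrange N) (fun n => c n * expi n t) - w t))%C by ring.
  rewrite Cmod_mult. apply Rmult_le_compat; try apply Cmod_ge_0; [now apply HM|].
  now apply series_rate.
Qed.

(** ** Convergence of the Fourier series of a smooth function *)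

Lemma periodic_Z u k t : periodic u -> u (t + 2 * PI * IZR k) = u t.
Proof.
  intros P.
  assert (H : forall n : nat, forall s, u (s + 2 * PI * INR n) = u s).
  { induction n as [|n IH]; intros s.
    - simpl. f_equal. ring.
    - rewrite S_INR, <- (IH s), <- (P (s + 2 * PI * INR n)). f_equal. ring. }
  destruct (Z_le_dec 0 k).
  - rewrite <- (Z2Nat.id k), <- INR_IZR_INZ by easy. apply H.
  - rewrite <- (H (Z.to_nat (- k)) (t + 2 * PI * IZR k)). f_equal.
    rewrite INR_IZR_INZ, Z2Nat.id, opp_IZR by lia. ring.
Qed.

Lemma reduce_mod_2PI t y : exists k : Z, y <= t + 2 * PI * IZR k <= y + 2 * PI.
Proof.
  pose proof PI_RGT_0. set (q := (t - y) / (2 * PI)).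
  destruct (archimed q) as [H1 H2]. exists (1 - up q)%Z. rewrite minus_IZR.
  assert (Eq : t - y = q * (2 * PI)) by (unfold q; field; lra).
  replace (t + 2 * PI * (1 - IZR (up q))) with (y + 2 * PI * (q + 1 - IZR (up q))) by lra.
  split; nra.
Qed.

Lemma periodic_bounded u : periodic u -> contC u -> exists M, forall t, Cmod (u t) <= M.
Proof.
  intros P H. destruct (contC_bounded u H) as [M HM]. exists M. intros t.
  destruct (reduce_mod_2PI t 0) as [k Hk]. rewrite <- (periodic_Z u k t P). apply HM. lra.
Qed.

Lemma one_minus_cos_lower y : Rabs y <= PI -> y ^ 2 <= 18 * (1 - cos y).
Proof.
  intros Hy. rewrite <- (pow2_abs y).
  assert (E : 1 - cos y = 2 * sin (Rabs y / 2) ^ 2).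
  { assert (Ec : cos y = cos (Rabs y)).
    { unfold Rabs. destruct (Rcase_abs y); [now rewrite cos_neg|easy]. }
    rewrite Ec. replace (Rabs y) with (2 * (Rabs y / 2)) at 1 by field.
    rewrite cos_2a_sin. ring. }
  rewrite E. set (z := Rabs y / 2). assert (Hz : 0 <= z) by (unfold z; pose proof (Rabs_pos y); lra).
  pose proof PI_4. assert (Hz2 : z <= 2) by (unfold z; lra).
  assert (z / 3 <= sin z).
  { destruct (sin_bound z 0) as [H1 _]; [easy|unfold z; pose proof PI_RGT_0; lra|].
    eapply Rle_trans; [|exact H1]. unfold sin_approx, sin_term. simpl. nra. }
  replace (Rabs y) with (2 * z) by (unfold z; field). nra.
Qed.

(** By Taylor's formula [phi] is bounded by a multiple of [(s - x)^2] within half a period of [x], and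
    periodicity extends the bound to all [s]. *)
Lemma double_zero_bound phi x :
  smoothC phi -> phi x = RtoC 0 -> Cder phi x = RtoC 0 ->
  exists K, 0 <= K /\ forall s, Cmod (phi s) <= K * (1 - cos (s - x)).
Proof.
  intros Hphi H0 H1.
  pose proof (smoothC_Cder _ Hphi) as Hp1. pose proof (smoothC_Cder _ Hp1) as Hp2.
  destruct (periodic_bounded (Cder (Cder phi))) as [M HM]; [apply Hp2|now apply smoothC_contC|].
  assert (HM0 : 0 <= M) by (eapply Rle_trans; [apply Cmod_ge_0|apply (HM 0)]).
  (* the mean value theorem twice, for the real and imaginary parts *)
  assert (T : forall f : R -> R, (forall t, ex_derive f t) -> (forall t, ex_derive (Derive f) t) ->
      (forall t, Rabs (Derive (Derive f) t) <= M) -> f x = 0 -> Derive f x = 0 ->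
      forall t, Rabs (f t) <= M * (t - x) ^ 2).
  { intros f Hf Hf' HB E0 E1 t.
    assert (V : forall g : R -> R, (forall t, ex_derive g t) -> g x = 0 -> forall t,
        exists c, Rabs (c - x) <= Rabs (t - x) /\ g t = Derive g c * (t - x)).
    { intros g Hg Eg u. destruct (MVT_gen g x u (Derive g)) as (c & Hc & Ec).
      - intros; now apply Derive_correct.
      - intros; apply continuity_pt_filterlim, (ex_derive_continuous g), Hg.
      - exists c. split; [|lra]. revert Hc. unfold Rmin, Rmax, Rabs.
        destruct (Rle_dec x u), (Rcase_abs (c - x)), (Rcase_abs (u - x)); lra. }
    destruct (V f Hf E0 t) as (c & Hc & ->). destruct (V _ Hf' E1 c) as (d & Hd & ->).
    rewrite !Rabs_mult, <- (pow2_abs (t - x)). specialize (HB d).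
    pose proof (Rabs_pos (Derive (Derive f) d)). pose proof (Rabs_pos (c - x)).
    pose proof (Rabs_pos (t - x)).
    replace (M * Rabs (t - x) ^ 2) with (M * Rabs (t - x) * Rabs (t - x)) by ring.
    apply Rmult_le_compat_r; [easy|]. apply Rmult_le_compat; easy. }
  assert (HK : forall s, Rabs (s - x) <= PI -> Cmod (phi s) <= 36 * M * (1 - cos (s - x))).
  { intros s Hs. eapply Rle_trans; [apply Cmod_le_Re_Im|].
    assert (Re0 : Rabs (Re (phi s)) <= M * (s - x) ^ 2).
    { apply (T (fun s => Re (phi s))).
      - intros; apply (smoothC_diffC _ Hphi).
      - intros; apply (smoothC_diffC _ Hp1).
      - intros t. eapply Rle_trans; [|apply (HM t)]. apply (re_le_Cmod (Cder (Cder phi) t)).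
      - now rewrite H0.
      - apply (f_equal Re) in H1. exact H1. }
    assert (Im0 : Rabs (Im (phi s)) <= M * (s - x) ^ 2).
    { apply (T (fun s => Im (phi s))).
      - intros; apply (smoothC_diffC _ Hphi).
      - intros; apply (smoothC_diffC _ Hp1).
      - intros t. eapply Rle_trans; [|apply (HM t)]. apply (im_le_Cmod (Cder (Cder phi) t)).
      - now rewrite H0.
      - apply (f_equal Im) in H1. exact H1. }
    pose proof (one_minus_cos_lower (s - x) Hs). nra. }
  exists (36 * M). split; [lra|]. intros s.
  destruct (reduce_mod_2PI s (x - PI)) as [k Hk].
  rewrite <- (periodic_Z phi k s (proj1 Hphi)).
  assert (E : cos (s - x) = cos (s + 2 * PI * IZR k - x)).
  { pose proof (periodic_Z (expi 1) k (s - x) (expi_periodic 1)) as E.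
    apply (f_equal Re) in E. unfold expi in E. simpl in E. rewrite !Rmult_1_l in E.
    rewrite <- E. f_equal. ring. }
  rewrite E. apply HK. apply Rabs_le. lra.
Qed.

(** Multiplication by [1 - cos t] is minus half of the second difference in the frequency, so both the
    sum over [n] and the one over [M] telescope. *)
Lemma kernel_telescope N t :
  (RtoC (1 - cos t) * csum (seq 0 (S N)) (fun M => csum (zrange M) (fun n => expi n t)) =
   - (/ 2) * (expi (Z.of_nat N + 1) t - expi 0 t - expi (-1) t + expi (- Z.of_nat N - 2) t))%C.
Proof.
  set (z := expi 1 t). set (w := expi (-1) t).
  assert (Hc : RtoC (1 - cos t) = (1 - / 2 * (z + w))%C).
  { unfold z, w, expi. apply injective_projections; simpl.
    - replace (-1 * t) with (- (1 * t)) by ring. rewrite cos_neg, Rmult_1_l. field.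
    - replace (-1 * t) with (- (1 * t)) by ring. rewrite sin_neg. field. }
  assert (Hz : forall a, (z * expi a t = expi (a + 1) t)%C)
    by (intros a; unfold z; rewrite <- expi_plus; f_equal; lia).
  assert (Hw : forall a, (w * expi a t = expi (a - 1) t)%C)
    by (intros a; unfold w; rewrite <- expi_plus; f_equal; lia).
  assert (H2 : forall a b : C, (a + a = b)%C -> a = (/ 2 * b)%C).
  { intros a b <-. replace (a + a)%C with (2 * a)%C by ring. rewrite Cmult_assoc, Cinv_l; [ring|].
    intros E. apply RtoC_inj in E. lra. }
  assert (Hm : forall a, (RtoC (1 - cos t) * expi a t
                 = - (/ 2) * (expi (a + 1) t - 2 * expi a t + expi (a - 1) t))%C).
  { intros a. rewrite Hc, <- Hz, <- Hw.
    replace (- (/ 2) * (z * expi a t - 2 * expi a t + w * expi a t))%C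
      with ((/ 2 * 2) * expi a t - / 2 * (z + w) * expi a t)%C by ring.
    rewrite Cinv_l; [ring|]. intros E. apply RtoC_inj in E. lra. }
  assert (HE : forall M, (RtoC (1 - cos t) * csum (zrange M) (fun n => expi n t) =
    - (/ 2) * (expi (Z.of_nat M + 1) t - expi (Z.of_nat M) t - expi (- Z.of_nat M - 1) t
               + expi (- Z.of_nat M - 2) t))%C).
  { induction M as [|M IH].
    - rewrite csum_zrange_0, Cmult_plus_distr_l, !Hm. simpl (Z.of_nat 0).
      change (0 + 1)%Z with 1%Z. change (0 - 1)%Z with (-1)%Z. change (-1 + 1)%Z with 0%Z.
      change (-1 - 1)%Z with (-2)%Z. change (- 0 - 1)%Z with (-1)%Z. change (- 0 - 2)%Z with (-2)%Z.
      ring.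
    - rewrite csum_zrange_S, !Cmult_plus_distr_l, IH, !Hm.
      replace (Z.of_nat (S M)) with (Z.of_nat M + 1)%Z by lia.
      replace (- Z.of_nat (S (S M)))%Z with (- Z.of_nat M - 2)%Z by lia.
      replace (Z.of_nat M + 1 - 1)%Z with (Z.of_nat M) by lia.
      replace (- Z.of_nat M - 2 + 1)%Z with (- Z.of_nat M - 1)%Z by lia.
      replace (- (Z.of_nat M + 1) - 1)%Z with (- Z.of_nat M - 2)%Z by lia.
      replace (- (Z.of_nat M + 1) - 2)%Z with (- Z.of_nat M - 2 - 1)%Z by lia.
      ring. }
  induction N as [|N IH].
  - change (csum (seq 0 1) (fun M => csum (zrange M) (fun n => expi n t)))
      with (csum (zrange 0) (fun n => expi n t) + RtoC 0)%C.
    rewrite Cplus_0_r, HE. f_equal.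
  - rewrite (seq_S (S N)), csum_app, Cmult_plus_distr_l, IH.
    change (csum (0 + S N :: nil)%nat (fun M => csum (zrange M) (fun n => expi n t)))
      with (csum (zrange (S N)) (fun n => expi n t) + RtoC 0)%C.
    rewrite Cplus_0_r, HE.
    replace (Z.of_nat (S N)) with (Z.of_nat N + 1)%Z by lia.
    replace (- (Z.of_nat N + 1) - 1)%Z with (- Z.of_nat N - 2)%Z by lia. ring.
Qed.

Lemma kernel_bound N t :
  (1 - cos t) * Cmod (csum (seq 0 (S N)) (fun M => csum (zrange M) (fun n => expi n t))) <= 2.
Proof.
  assert (H : 0 <= 1 - cos t) by (pose proof (COS_bound t); lra).
  rewrite <- (Rabs_pos_eq (1 - cos t)), <- Cmod_R, <- Cmod_mult, kernel_telescope by easy.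
  rewrite Cmod_mult, Cmod_opp, Cmod_inv, Cmod_R, Rabs_pos_eq by (try lra; intros E;
      apply RtoC_inj in E; lra).
  assert (Cmod (expi (Z.of_nat N + 1) t - expi 0 t - expi (-1) t + expi (- Z.of_nat N - 2) t) <= 4).
  { eapply Rle_trans; [apply Cmod_triangle|]. rewrite Cmod_expi.
    assert (Cmod (expi (Z.of_nat N + 1) t - expi 0 t - expi (-1) t) <= 3); [|lra].
    unfold Cminus. eapply Rle_trans; [apply Cmod_triangle|]. rewrite Cmod_opp, Cmod_expi.
    assert (Cmod (expi (Z.of_nat N + 1) t + - expi 0 t) <= 2); [|lra].
    eapply Rle_trans; [apply Cmod_triangle|]. rewrite Cmod_opp, !Cmod_expi. lra. }
  lra.
Qed.

(** Otherwise the partial sums would grow linearly. *)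
Lemma Clim_bounded_sums (S : nat -> C) W K :
  Clim S W -> (forall N, Cmod (csum (seq 0 (Datatypes.S N)) S) <= K) -> W = RtoC 0.
Proof.
  intros HS HK. apply Cmod_eq_0.
  destruct (Rle_lt_or_eq_dec 0 (Cmod W) (Cmod_ge_0 _)) as [H|H]; [exfalso|now symmetry].
  destruct (HS (Cmod W / 2)) as [N0 HN]; [lra|].
  assert (B : forall p, INR p * (Cmod W / 2) <= 2 * K).
  { intros p.
    assert (E : Cmod (csum (seq (Datatypes.S N0) p) S - RtoC (INR p) * W) <= INR p * (Cmod W / 2)).
    { replace (RtoC (INR p) * W)%C with (csum (seq (Datatypes.S N0) p) (fun _ => W)).
      - rewrite <- csum_minus. eapply Rle_trans; [apply Cmod_csum_le|].
        eapply Rle_trans; [apply rsum_le; intros n Hn; apply in_seq in Hn; apply Rlt_le, HN; lia|].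
        rewrite rsum_const, length_seq. lra.
      - generalize (Datatypes.S N0). induction p as [|p IH]; intros n; [simpl;
            change (RtoC 0 = 0 * W)%C; ring|].
        change (seq n (Datatypes.S p)) with (n :: seq (Datatypes.S n) p).
        change (W + csum (seq (Datatypes.S n) p) (fun _ => W) = RtoC (INR (Datatypes.S p)) * W)%C.
        rewrite IH, S_INR, RtoC_plus. ring. }
    assert (F : Cmod (csum (seq (Datatypes.S N0) p) S) <= 2 * K).
    { replace (csum (seq (Datatypes.S N0) p) S)
        with (csum (seq 0 (Datatypes.S (N0 + p))) S - csum (seq 0 (Datatypes.S N0)) S)%C.
      - unfold Cminus. eapply Rle_trans; [apply Cmod_triangle|]. rewrite Cmod_opp.
        pose proof (HK (N0 + p)%nat). pose proof (HK N0). lra.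
      - change (Datatypes.S (N0 + p)) with (Datatypes.S N0 + p)%nat.
        rewrite seq_app, csum_app. simpl (0 + _)%nat. ring. }
    assert (G : Cmod (RtoC (INR p) * W) <= Cmod (csum (seq (Datatypes.S N0) p) S)
                 + Cmod (csum (seq (Datatypes.S N0) p) S - RtoC (INR p) * W)).
    { rewrite (Cmod_minus_sym _ (RtoC (INR p) * W)).
      replace (RtoC (INR p) * W)%C with
        (csum (seq (Datatypes.S N0) p) S
            + (RtoC (INR p) * W - csum (seq (Datatypes.S N0) p) S))%C at 1 by ring.
      apply Cmod_triangle. }
    rewrite Cmod_mult, Cmod_R, Rabs_pos_eq in G by apply pos_INR. lra. }
  destruct (INR_unbounded (2 * K / (Cmod W / 2))) as [p Hp].
  specialize (B p). apply Rmult_gt_compat_r with (r := Cmod W / 2) in Hp; [|lra].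
  replace (2 * K / (Cmod W / 2) * (Cmod W / 2)) with (2 * K) in Hp by (field; lra). lra.
Qed.

Lemma fourier_dominated u : smoothC u -> exists K, dominated K (fourier u).
Proof.
  intros Hu. destruct (fourier_decay u 2 Hu) as (K & _ & H). exists K. intros n. apply H.
Qed.

(** Evaluation at [x] and this functional are both linear and agree on exponentials; inversion says that
    they agree on smooth functions. *)
Definition fourier_sum (u : R -> C) (x : R) : C := Zsum (fun n => fourier u n * expi n x)%C.

Lemma fourier_sum_minus u v x : smoothC u -> smoothC v ->
    fourier_sum (fun t => u t - v t)%C x = (fourier_sum u x - fourier_sum v x)%C.
Proof.
  intros Hu Hv. unfold fourier_sum.
  destruct (fourier_dominated u Hu) as [K HK]. destruct (fourier_dominated v Hv) as [K' HK'].
  erewrite <- Zsum_minus by (apply dominated_expi; eassumption).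
  apply Zsum_ext. intros n. rewrite fourier_minus by (now apply smoothC_contC). ring.
Qed.

Lemma smoothC_scal c u : smoothC u -> smoothC (fun t => c * u t)%C.
Proof. intros H. apply (smoothC_mult (fun _ => c) u); [apply smoothC_const|easy]. Qed.

Lemma smoothC_minus u v : smoothC u -> smoothC v -> smoothC (fun t => u t - v t)%C.
Proof.
  intros Hu Hv. replace (fun t => u t - v t)%C with (fun t => u t + (-1) * v t)%C.
  - apply smoothC_plus; [easy|now apply smoothC_scal].
  - apply functional_extensionality; intros; ring.
Qed.

Lemma fourier_sum_scal u c x : smoothC u -> fourier_sum (fun t => c * u t)%C x = (c * fourier_sum u x)%C.
Proof.
  intros Hu. unfold fourier_sum. destruct (fourier_dominated u Hu) as [K HK].
  erewrite <- Zsum_scal by (apply dominated_expi; eassumption).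
  apply Zsum_ext. intros n. rewrite fourier_scal by (now apply smoothC_contC). ring.
Qed.

Lemma fourier_sum_expi j x : fourier_sum (expi j) x = expi j x.
Proof.
  unfold fourier_sum. rewrite (Zsum_single _ j).
  - rewrite fourier_expi. destruct (Z.eq_dec j j); [ring|easy].
  - intros k Hk. rewrite fourier_expi. destruct (Z.eq_dec k j); [contradiction|ring].
Qed.

Lemma Cder_scal c u : smoothC u -> Cder (fun t => c * u t)%C = (fun t => c * Cder u t)%C.
Proof.
  intros Hu. rewrite (Cder_mult (fun _ => c) u (diffC_const c) (smoothC_diffC u Hu)).
  rewrite Cder_const. apply functional_extensionality; intros; ring.
Qed.

Lemma Cder_minus u v : smoothC u -> smoothC v ->
  Cder (fun t => u t - v t)%C = (fun t => Cder u t - Cder v t)%C.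
Proof.
  intros Hu Hv.
  replace (fun t => u t - v t)%C with (fun t => u t + (-1) * v t)%C
    by (apply functional_extensionality; intros; ring).
  rewrite (Cder_plus u (fun t => (-1) * v t)%C (smoothC_diffC u Hu)
             (smoothC_diffC _ (smoothC_scal (-1) v Hv))).
  rewrite Cder_scal by easy. apply functional_extensionality; intros; ring.
Qed.

(** Fejer's argument.  The partial sums of the Fourier series at [x] are integrals of [phi] against
    Dirichlet kernels; summed over their index, these kernels are bounded by a multiple of
    [1 / (1 - cos)], which the double zero of [phi] compensates.  So the sums of the partial sums stay
    bounded, and the limit of the partial sums is zero. *)
Lemma fourier_sum_double_zero phi x :
  smoothC phi -> phi x = RtoC 0 -> Cder phi x = RtoC 0 -> fourier_sum phi x = RtoC 0.
Proof.
  intros Hphi H0 H1. pose proof (smoothC_contC _ Hphi) as Cphi.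
  destruct (double_zero_bound phi x Hphi H0 H1) as (K & HK0 & HK).
  destruct (fourier_dominated phi Hphi) as [K' HK'].
  apply Clim_bounded_sums with (fun M => csum (zrange M) (fun n => fourier phi n * expi n x)%C) (4 * K).
  - eapply dominated_lim, dominated_expi, HK'.
  - intros N.
    set (conv_ker := fun s => csum (seq 0 (S N)) (fun M => csum (zrange M) (fun n => expi n (x - s)))).
    assert (Ce : forall n, contC (fun s => expi n x * expi (- n) s)%C)
      by (intros n; apply contC_mult; [apply contC_const|apply contC_expi]).
    assert (Ck' : forall M, contC (fun s => csum (zrange M) (fun n =>
        (expi n x * expi (- n) s) * phi s))%C).
    { intros M. apply (contC_csum (zrange M) (fun n s => (expi n x * expi (- n) s) * phi s)%C).
      intros n. now apply contC_mult. }
    assert (E : csum (seq 0 (S N)) (fun M => csum (zrange M) (fun n => fourier phi n * expi n x))%C =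
                (RtoC (/ (2 * PI)) * Cint (fun s => csum (seq 0 (S N)) (fun M =>
                    csum (zrange M) (fun n => (expi n x * expi (- n) s) * phi s))))%C).
    { rewrite (Cint_csum (seq 0 (S N)) (fun M s => csum (zrange M) (fun n =>
          (expi n x * expi (- n) s) * phi s)%C)) by easy.
      rewrite <- csum_scal_l. apply csum_ext. intros M _.
      rewrite (Cint_csum (zrange M) (fun n s => (expi n x * expi (- n) s) * phi s)%C)
        by (intros; now apply contC_mult).
      rewrite <- csum_scal_l. apply csum_ext. intros n _.
      rewrite fourierE by easy.
      rewrite (Cint_ext (fun s => expi n x * expi (- n) s * phi s)%C
                (fun s => expi n x * (phi s * expi (- n) s))%C) by (intros; ring).
      rewrite Cint_scal by (apply contC_mult; [easy|apply contC_expi]). ring. }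
    rewrite E, Cmod_mult, Cmod_R. pose proof PI_RGT_0.
    rewrite Rabs_pos_eq by (apply Rlt_le, Rinv_0_lt_compat; lra).
    apply Rmult_le_reg_l with (2 * PI); [lra|].
    rewrite <- Rmult_assoc, Rinv_r, Rmult_1_l by lra.
    replace (2 * PI * (4 * K)) with (4 * PI * (2 * K)) by ring.
    apply Cint_bound.
    + apply (contC_csum (seq 0 (S N)) (fun M s => csum (zrange M) (fun n =>
          (expi n x * expi (- n) s) * phi s)%C)).
      easy.
    + intros s _.
      replace (csum (seq 0 (S N)) (fun M => csum (zrange M) (fun n =>
          (expi n x * expi (- n) s) * phi s)%C))
        with (conv_ker s * phi s)%C.
      * rewrite Cmod_mult. specialize (HK s).
        pose proof (kernel_bound N (x - s)) as HB. fold (conv_ker s) in HB.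
        replace (cos (x - s)) with (cos (s - x)) in HB by (rewrite <- cos_neg; f_equal; ring).
        pose proof (Cmod_ge_0 (conv_ker s)). pose proof (Cmod_ge_0 (phi s)). nra.
      * unfold conv_ker. rewrite <- csum_scal_r. apply csum_ext. intros M _. rewrite <- csum_scal_r.
        apply csum_ext. intros n _. f_equal.
        replace (x - s) with (x + - s) by ring. now rewrite expi_arg_plus, expi_arg_opp.
Qed.

Theorem fourier_inversion u x : smoothC u -> u x = fourier_sum u x.
Proof.
  intros Hu.
  (* subtract a trigonometric polynomial with the same value and derivative at [x] *)
  set (q := fun t => (Cder u x * (/ (2 * Ci)) * (expi (-1) x * expi 1 t - expi 1 x * expi (-1) t))%C).
  set (p := fun t => (u x * expi 0 t - (-1) * q t)%C).
  assert (Sd : smoothC (fun t => expi (-1) x * expi 1 t - expi 1 x * expi (-1) t)%C)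
    by (apply smoothC_minus; apply smoothC_scal, smoothC_expi).
  assert (Sq : smoothC q) by (apply smoothC_scal, Sd).
  assert (Sp : smoothC p) by (apply smoothC_minus; apply smoothC_scal; [apply smoothC_expi|exact Sq]).
  assert (U : (expi (-1) x * expi 1 x = 1)%C).
  { rewrite <- expi_plus. apply expi_0. }
  assert (N2 : (2 * Ci)%C <> RtoC 0).
  { apply Cmult_neq_0; [intros E; apply RtoC_inj in E; lra|apply Ci_nz]. }
  assert (P0 : p x = u x).
  { unfold p, q. rewrite expi_0.
    transitivity (u x + Cder u x * (/ (2 * Ci)) * (expi (-1) x * expi 1 x - expi (-1) x
        * expi 1 x))%C; ring. }
  assert (P1 : Cder p x = Cder u x).
  { unfold p. rewrite Cder_minus; [|apply smoothC_scal, smoothC_expi|now apply smoothC_scal].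
    rewrite !Cder_scal by (assumption || apply smoothC_expi). unfold q.
    rewrite Cder_scal by assumption. rewrite Cder_minus by (apply smoothC_scal, smoothC_expi).
    rewrite !Cder_scal by apply smoothC_expi. rewrite !Cder_expi.
    transitivity (Cder u x * (/ (2 * Ci) * (2 * Ci)) * (expi (-1) x * expi 1 x))%C.
    - ring.
    - rewrite U, Cinv_l by easy. ring. }
  assert (Fp : fourier_sum p x = p x).
  { unfold p. rewrite fourier_sum_minus; [|apply smoothC_scal, smoothC_expi|now apply smoothC_scal].
    rewrite !fourier_sum_scal by (assumption || apply smoothC_expi). rewrite fourier_sum_expi. unfold q.
    rewrite fourier_sum_scal by assumption.
    rewrite fourier_sum_minus by (apply smoothC_scal, smoothC_expi).
    rewrite !fourier_sum_scal by apply smoothC_expi. now rewrite !fourier_sum_expi. }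
  assert (Z0 : fourier_sum (fun t => u t - p t)%C x = RtoC 0).
  { apply fourier_sum_double_zero.
    - now apply smoothC_minus.
    - rewrite P0. ring.
    - rewrite Cder_minus, P1 by assumption. ring. }
  rewrite fourier_sum_minus, Fp, P0 in Z0 by assumption.
  symmetry. now apply Ceq_minus.
Qed.

(** * Path expansion of the matrix coefficients *)

Definition absZ (n : Z) : R := Rabs (IZR n).

Lemma absZ_pos n : 0 <= absZ n.
Proof. apply Rabs_pos. Qed.

Lemma absZ_triangle x y : absZ (x + y) <= absZ x + absZ y.
Proof. unfold absZ. rewrite plus_IZR. apply Rabs_triang. Qed.

Lemma weight_absZ n : weight n = / (1 + absZ n) ^ 2.
Proof. reflexivity. Qed.

Definition conv_ker (a_hat : Z -> C) (lam : Z -> R) (k h : Z) : C := (a_hat (k - h)%Z * RtoC (lam h))%C.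

(** A product rather than a sum of step lengths, because the decay of the Fourier coefficients is
    multiplicative along the path; it still dominates the distance of any two points of the path. *)
Fixpoint steps_prod (k : Z) (ks : list Z) (h : Z) : R :=
  match ks with
  | nil => 1 + absZ (k - h)
  | x :: xs => (1 + absZ (k - x)) * steps_prod x xs h
  end.

Lemma steps_prod_ge1 k ks h : 1 <= steps_prod k ks h.
Proof.
  revert k. induction ks as [|x xs IH]; intros k; simpl.
  - pose proof (absZ_pos (k - h)). lra.
  - pose proof (absZ_pos (k - x)). specialize (IH x). nra.
Qed.

Lemma steps_prod_endpoint k ks h v :
  v = k \/ In v ks -> 1 + absZ v <= (1 + absZ h) * steps_prod k ks h.
Proof.
  revert k v. induction ks as [|x xs IH]; intros k v Hv; simpl.
  - destruct Hv as [->|[]]. pose proof (absZ_triangle (k - h) h).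
    replace (k - h + h)%Z with k in H by lia.
    pose proof (absZ_pos (k - h)). pose proof (absZ_pos h). nra.
  - pose proof (absZ_pos (k - x)). pose proof (absZ_pos h). pose proof (steps_prod_ge1 x xs h).
    destruct Hv as [->|Hv].
    + pose proof (IH x x (or_introl eq_refl)).
      pose proof (absZ_triangle (k - x) x). replace (k - x + x)%Z with k in H3 by lia.
      pose proof (absZ_pos x). nra.
    + assert (1 + absZ v <= (1 + absZ h) * steps_prod x xs h).
      { apply IH. destruct Hv as [->|Hv]; [now left|now right]. }
      assert (0 <= (1 + absZ h) * steps_prod x xs h) by nra. nra.
Qed.

Lemma steps_prod_from_start k ks h v :
  v = k \/ In v ks \/ v = h -> 1 + absZ (k - v) <= steps_prod k ks h.
Proof.
  revert k v. induction ks as [|x xs IH]; intros k v Hv.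
  - pose proof (steps_prod_ge1 k nil h). simpl in *. destruct Hv as [->|[[]| ->]]; [|lra].
    rewrite Z.sub_diag. unfold absZ at 1. rewrite Rabs_R0. lra.
  - destruct Hv as [->|Hv].
    + rewrite Z.sub_diag. unfold absZ at 1. rewrite Rabs_R0, Rplus_0_r. apply steps_prod_ge1.
    + assert (1 + absZ (x - v) <= steps_prod x xs h).
      { apply IH. destruct Hv as [[->|Hv]|Hv]; auto. }
      simpl. pose proof (absZ_triangle (k - x) (x - v)).
      replace (k - x + (x - v))%Z with (k - v)%Z in H0 by lia.
      pose proof (absZ_pos (k - x)). pose proof (absZ_pos (x - v)). nra.
Qed.

Lemma absZ_sym x y : absZ (x - y) = absZ (y - x).
Proof. unfold absZ. rewrite !minus_IZR. apply Rabs_minus_sym. Qed.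

Lemma steps_prod_distance k ks h u v :
  (u = k \/ In u ks \/ u = h) -> (v = k \/ In v ks \/ v = h) ->
  1 + absZ (u - v) <= steps_prod k ks h.
Proof.
  revert k. induction ks as [|x xs IH]; intros k Hu Hv.
  - destruct Hu as [->|Hu]; [now apply steps_prod_from_start|].
    destruct Hv as [->|Hv]; [rewrite absZ_sym; apply steps_prod_from_start; tauto|].
    destruct Hu as [[]| ->], Hv as [[]| ->].
    rewrite Z.sub_diag. unfold absZ at 1. rewrite Rabs_R0, Rplus_0_r. apply steps_prod_ge1.
  - destruct Hu as [->|Hu]; [now apply steps_prod_from_start|].
    destruct Hv as [->|Hv]; [rewrite absZ_sym; apply steps_prod_from_start; tauto|].
    assert (1 + absZ (u - v) <= steps_prod x xs h).
    { apply IH; [destruct Hu as [[->|Hu]|Hu]|destruct Hv as [[->|Hv]|Hv]]; auto. }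
    simpl. pose proof (absZ_pos (k - x)). pose proof (steps_prod_ge1 x xs h). nra.
Qed.

Definition size_prod (ks : list Z) : R := fold_right (fun x p => absZ x * p) 1 ks.

Lemma size_prod_nonneg ks : 0 <= size_prod ks.
Proof.
  induction ks as [|x xs IH]; simpl; [lra|]. apply Rmult_le_pos; [apply absZ_pos|easy].
Qed.

Lemma path_prod_conv_ker_bound a_hat lam c p k ks h :
  0 <= c -> (forall n, Cmod (a_hat n) <= c / (1 + absZ n) ^ p) -> (forall n, Rabs (lam n) <= absZ n) ->
  Cmod (path_prod (conv_ker a_hat lam) k ks h) * steps_prod k ks h ^ p
      <= c ^ S (length ks) * (size_prod ks * absZ h).
Proof.
  intros Hc Hah Hlam.
  assert (B : forall k x, Cmod (conv_ker a_hat lam k x) * (1 + absZ (k - x)) ^ p <= c * absZ x).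
  { intros k' x. unfold conv_ker. rewrite Cmod_mult, Cmod_R.
    specialize (Hah (k' - x)%Z). specialize (Hlam x).
    assert (Hp : 0 < (1 + absZ (k' - x)) ^ p) by (apply pow_lt; pose proof (absZ_pos (k' - x)); lra).
    apply Rmult_le_compat_r with (r := (1 + absZ (k' - x)) ^ p) in Hah; [|lra].
    unfold Rdiv in Hah. rewrite Rmult_assoc, Rinv_l, Rmult_1_r in Hah by lra.
    pose proof (Cmod_ge_0 (a_hat (k' - x)%Z)). pose proof (Rabs_pos (lam x)).
    replace (Cmod (a_hat (k' - x)%Z) * Rabs (lam x) * (1 + absZ (k' - x)) ^ p)
      with ((Cmod (a_hat (k' - x)%Z) * (1 + absZ (k' - x)) ^ p) * Rabs (lam x)) by ring.
    apply Rmult_le_compat; try assumption. apply Rmult_le_pos; lra. }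
  revert k. induction ks as [|x xs IH]; intros k; cbn [path_prod steps_prod size_prod fold_right length].
  - specialize (B k h). simpl pow at 2. lra.
  - rewrite Cmod_mult, Rpow_mult_distr.
    specialize (B k x). specialize (IH x). fold (size_prod xs).
    replace (Cmod (conv_ker a_hat lam k x) * Cmod (path_prod (conv_ker a_hat lam) x xs h) *
             ((1 + absZ (k - x)) ^ p * steps_prod x xs h ^ p))
      with ((Cmod (conv_ker a_hat lam k x) * (1 + absZ (k - x)) ^ p) *
            (Cmod (path_prod (conv_ker a_hat lam) x xs h) * steps_prod x xs h ^ p)) by ring.
    replace (c ^ S (S (length xs)) * (absZ x * size_prod xs * absZ h))
      with ((c * absZ x) * (c ^ S (length xs) * (size_prod xs * absZ h))) by (simpl; ring).
    pose proof (absZ_pos (k - x)). pose proof (steps_prod_ge1 x xs h).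
    apply Rmult_le_compat; try assumption; apply Rmult_le_pos; try apply Cmod_ge_0;
      apply pow_le; lra.
Qed.

Lemma size_prod_weights R0 S0 ks :
  0 < S0 -> 0 <= R0 -> (forall v, In v ks -> 1 + absZ v <= R0 * S0) ->
  size_prod ks <= (R0 ^ 3 * S0 ^ 3) ^ length ks * weights ks.
Proof.
  intros HS HR. induction ks as [|x xs IH]; intros H; cbn [size_prod weights fold_right length];
      [simpl; lra|].
  fold (size_prod xs). fold (weights xs).
  assert (H1 : size_prod xs <= (R0 ^ 3 * S0 ^ 3) ^ length xs * weights xs)
    by (apply IH; intros; apply H; now right).
  assert (H2 : absZ x <= R0 ^ 3 * S0 ^ 3 * weight x).
  { specialize (H x (or_introl eq_refl)). pose proof (absZ_pos x).
    assert ((1 + absZ x) ^ 3 <= R0 ^ 3 * S0 ^ 3)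
      by (rewrite <- Rpow_mult_distr; apply pow_incr; lra).
    rewrite weight_absZ. apply Rmult_le_reg_r with ((1 + absZ x) ^ 2); [apply pow_lt; lra|].
    rewrite Rmult_assoc, Rinv_l, Rmult_1_r by (apply pow_nonzero; lra). nra. }
  replace ((R0 ^ 3 * S0 ^ 3) ^ S (length xs) * (weight x * weights xs))
    with ((R0 ^ 3 * S0 ^ 3 * weight x) * ((R0 ^ 3 * S0 ^ 3) ^ length xs * weights xs)) by (simpl; ring).
  apply Rmult_le_compat; try assumption; [apply absZ_pos|apply size_prod_nonneg].
Qed.

(** With decay of order [3 (d + 1)], a factor [1 / steps_prod ^ 3] can be spent at each of the [d + 1]
    points [k, ks]: one power of it compensates the multiplier there, two give the weight. *)
Lemma path_prod_dominated a_hat lam c d k ks h R0 :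
  0 <= c -> (forall n, Cmod (a_hat n) <= c / (1 + absZ n) ^ (3 * S d)) ->
  (forall n, Rabs (lam n) <= absZ n) -> length ks = d -> 0 <= R0 ->
  (forall v, v = k \/ In v ks -> 1 + absZ v <= R0 * steps_prod k ks h) ->
  (1 + absZ k) * Cmod (path_prod (conv_ker a_hat lam) k ks h) <=
  c ^ S d * (R0 ^ 3) ^ S d * absZ h * (weight k * weights ks).
Proof.
  intros Hc Hah Hlam Hd HR H.
  pose proof (path_prod_conv_ker_bound a_hat lam c _ k ks h Hc Hah Hlam) as B.
  set (S0 := steps_prod k ks h) in *. assert (HS : 1 <= S0) by apply steps_prod_ge1.
  assert (HW := size_prod_weights R0 S0 ks ltac:(lra) HR (fun v Hv => H v (or_intror Hv))).
  assert (HWk : 1 + absZ k <= R0 ^ 3 * S0 ^ 3 * weight k).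
  { specialize (H k (or_introl eq_refl)). pose proof (absZ_pos k).
    assert ((1 + absZ k) ^ 3 <= R0 ^ 3 * S0 ^ 3)
      by (rewrite <- Rpow_mult_distr; apply pow_incr; lra).
    rewrite weight_absZ. apply Rmult_le_reg_r with ((1 + absZ k) ^ 2); [apply pow_lt; lra|].
    rewrite Rmult_assoc, Rinv_l, Rmult_1_r by (apply pow_nonzero; lra). nra. }
  rewrite Hd in *.
  assert (HSp : 0 < S0 ^ (3 * S d)) by (apply pow_lt; lra).
  apply Rmult_le_reg_r with (S0 ^ (3 * S d)); [easy|].
  set (z := Cmod (path_prod (conv_ker a_hat lam) k ks h)) in *.
  apply Rle_trans with ((1 + absZ k) * (c ^ S d * (size_prod ks * absZ h))).
  { rewrite Rmult_assoc. apply Rmult_le_compat_l; [pose proof (absZ_pos k); lra|exact B]. }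
  replace (c ^ S d * (R0 ^ 3) ^ S d * absZ h * (weight k * weights ks) * S0 ^ (3 * S d))
    with (c ^ S d * absZ h * ((R0 ^ 3 * S0 ^ 3 * weight k) * ((R0 ^ 3 * S0 ^ 3) ^ d * weights ks))).
  2:{ rewrite pow_mult. rewrite !Rpow_mult_distr. simpl pow. ring. }
  replace ((1 + absZ k) * (c ^ S d * (size_prod ks * absZ h)))
    with (c ^ S d * absZ h * ((1 + absZ k) * size_prod ks)) by ring.
  apply Rmult_le_compat_l.
  - apply Rmult_le_pos; [now apply pow_le|apply absZ_pos].
  - apply Rmult_le_compat; try assumption; [pose proof (absZ_pos k); lra|apply size_prod_nonneg].
Qed.

Definition rapid (a_hat : Z -> C) : Prop :=
  forall p, exists c, 0 <= c /\ forall n, Cmod (a_hat n) <= c / (1 + absZ n) ^ p.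

Lemma path_prod_tuple_dominated a_hat lam d h :
  rapid a_hat -> (forall n, Rabs (lam n) <= absZ n) ->
  exists K, 0 <= K /\ forall k, tuple_dominated d (K * weight k / (1 + absZ k)) (fun ks =>
      path_prod (conv_ker a_hat lam) k ks h).
Proof.
  intros Hr Hlam. destruct (Hr (3 * S d)%nat) as (c & Hc & Hah).
  exists (c ^ S d * ((1 + absZ h) ^ 3) ^ S d * absZ h).
  assert (H1 : 0 <= 1 + absZ h) by (pose proof (absZ_pos h); lra).
  split.
  { repeat apply Rmult_le_pos; try apply absZ_pos; repeat apply pow_le; lra. }
  intros k ks Hks. pose proof (absZ_pos k).
  apply Rmult_le_reg_l with (1 + absZ k); [lra|].
  eapply Rle_trans; [apply (path_prod_dominated a_hat lam c d k ks h (1 + absZ h) Hc Hah Hlam Hks H1)|].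
  - intros v Hv. now apply steps_prod_endpoint.
  - right. field. lra.
Qed.

Lemma path_prod_tuple_dominated_weak a_hat lam d h k :
  rapid a_hat -> (forall n, Rabs (lam n) <= absZ n) ->
  exists K, tuple_dominated d K (fun ks => path_prod (conv_ker a_hat lam) k ks h).
Proof.
  intros Hr Hlam. destruct (path_prod_tuple_dominated a_hat lam d h Hr Hlam) as (K & _ & HK).
  eexists. apply (HK k).
Qed.

(** These are the Fourier coefficients of [(a lam)^{d+1} e_h] for a Fourier multiplier [lam], see
    [aLambda_pow] and [aD_pow]. *)
Definition power_coef a_hat lam d h (k : Z) : C := iter_sum d (fun ks =>
    path_prod (conv_ker a_hat lam) k ks h).

Lemma power_coef_dominated a_hat lam d h :
  rapid a_hat -> (forall n, Rabs (lam n) <= absZ n) ->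
  exists K, dominated K (fun x => RtoC (lam x) * power_coef a_hat lam d h x)%C.
Proof.
  intros Hr Hlam. destruct (path_prod_tuple_dominated a_hat lam d h Hr Hlam) as (K & HK0 & HK).
  exists (4 ^ d * K). intros x. pose proof (tuple_dominated_iter_sum d _ _ (HK x)) as B.
  fold (power_coef a_hat lam d h x) in B. rewrite Cmod_mult, Cmod_R.
  pose proof (absZ_pos x). pose proof (Hlam x). pose proof (weight_pos x).
  assert (P4 : 0 < 4 ^ d) by (apply pow_lt; lra).
  apply Rle_trans with ((1 + absZ x) * (4 ^ d * (K * weight x / (1 + absZ x)))).
  - apply Rmult_le_compat; [apply Rabs_pos|apply Cmod_ge_0|lra|exact B].
  - right. field. lra.
Qed.

Lemma power_coef_S a_hat lam d h k :
  rapid a_hat -> (forall n, Rabs (lam n) <= absZ n) ->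
  power_coef a_hat lam (S d) h k = Zsum (fun x =>
      a_hat (k - x)%Z * (RtoC (lam x) * power_coef a_hat lam d h x))%C.
Proof.
  intros Hr Hlam. unfold power_coef at 1. cbn [iter_sum]. apply Zsum_ext. intros x. cbn [path_prod].
  destruct (path_prod_tuple_dominated_weak a_hat lam d h x Hr Hlam) as [K HK].
  rewrite (iter_sum_scal d K _ _ HK). unfold conv_ker at 1, power_coef. ring.
Qed.

(** ** The two operators *)

Section Operators.

Context (a : R -> R).
Hypothesis Ha : smooth_on_circle a.

Definition Cfun : R -> C := fun t => RtoC (a t).
Definition a_hat : Z -> C := fourier Cfun.

Lemma Cfun_smooth : smoothC Cfun.
Proof. now apply smooth_on_circle_smoothC. Qed.

Lemma a_hat_rapid : rapid a_hat.
Proof. intros p. apply (fourier_decay Cfun p Cfun_smooth). Qed.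

Definition mult_Lambda (n : Z) : R := IZR (Z.abs n).
Definition mult_D (n : Z) : R := IZR n.

Lemma mult_Lambda_le n : Rabs (mult_Lambda n) <= absZ n.
Proof. unfold mult_Lambda, absZ. rewrite abs_IZR, Rabs_Rabsolu. lra. Qed.

Lemma mult_D_le n : Rabs (mult_D n) <= absZ n.
Proof. apply Rle_refl. Qed.

Lemma aLambda_step u K :
  contC u -> dominated K (fun n => RtoC (mult_Lambda n) * fourier u n)%C ->
  contC (op_comp (mul_by a) Lambda u) /\
  forall k, fourier (op_comp (mul_by a) Lambda u) k =
            Zsum (fun x => a_hat (k - x)%Z * (RtoC (mult_Lambda x) * fourier u x))%C.
Proof.
  intros Hu HK.
  assert (HS : has_series (fun n => RtoC (mult_Lambda n) * fourier u n)%C (Lambda u))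
      by (intros t; reflexivity).
  pose proof (series_contC _ _ _ HK HS) as HC. pose proof (smoothC_contC _ Cfun_smooth) as CA.
  split.
  - apply (contC_mult Cfun (Lambda u)); assumption.
  - intros k. apply (fourier_mult_series K Cfun _ (Lambda u) k CA HK HS).
Qed.

(** The function [D u] equals the sum of its Fourier series, so multiplication by [a] acts on
    coefficients as a convolution; for [Lambda u] this holds by definition. *)
Lemma aD_step u :
  smoothC u -> smoothC (op_comp (mul_by a) Defs.D u) /\
  forall k, fourier (op_comp (mul_by a) Defs.D u) k =
            Zsum (fun x => a_hat (k - x)%Z * (RtoC (mult_D x) * fourier u x))%C.
Proof.
  intros Hu. pose proof (smoothC_D u Hu) as HD. split.
  - apply (smoothC_mult Cfun (Defs.D u)); [apply Cfun_smooth|exact HD].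
  - intros k. destruct (fourier_dominated _ HD) as [K HK].
    assert (HS : has_series (fourier (Defs.D u)) (Defs.D u))
      by (intros t; now apply fourier_inversion).
    change (fourier (fun t => Cfun t * Defs.D u t)%C k =
            Zsum (fun x => a_hat (k - x)%Z * (RtoC (mult_D x) * fourier u x))%C).
    rewrite (fourier_mult_series K _ (fourier (Defs.D u)) _ k (smoothC_contC _ Cfun_smooth) HK HS).
    apply Zsum_ext. intros x. now rewrite fourier_D.
Qed.

Lemma power_coef_0 lam h k :
  Zsum (fun x => a_hat (k - x)%Z * (RtoC (lam x) * fourier (expi h) x))%C = power_coef a_hat lam 0 h k.
Proof.
  rewrite (Zsum_single _ h).
  - rewrite fourier_expi. destruct (Z.eq_dec h h); [|easy]. unfold power_coef, conv_ker. simpl. ring.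
  - intros x Hx. rewrite fourier_expi. destruct (Z.eq_dec x h); [contradiction|ring].
Qed.

Lemma aLambda_pow d h :
  contC (op_pow (op_comp (mul_by a) Lambda) (S d) (expi h)) /\
  forall k, fourier (op_pow (op_comp (mul_by a) Lambda) (S d) (expi h)) k
      = power_coef a_hat mult_Lambda d h k.
Proof.
  induction d as [|d [IH1 IH2]].
  - destruct (aLambda_step (expi h) (Cmod (RtoC (mult_Lambda h)
        * fourier (expi h) h) / weight h)) as [H1 H2].
    + apply contC_expi.
    + apply (dominated_single (fun n => RtoC (mult_Lambda n) * fourier (expi h) n)%C).
      intros k Hk. rewrite fourier_expi. destruct (Z.eq_dec k h); [contradiction|ring].
    + split; [exact H1|]. intros k. rewrite <- power_coef_0. apply H2.
  - set (u := op_pow (op_comp (mul_by a) Lambda) (S d) (expi h)) in *.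
    change (op_pow (op_comp (mul_by a) Lambda) (S (S d)) (expi h))
      with (op_comp (mul_by a) Lambda u).
    destruct (power_coef_dominated a_hat mult_Lambda d h a_hat_rapid mult_Lambda_le) as [K HK].
    destruct (aLambda_step u K) as [H1 H2].
    + exact IH1.
    + intros n. rewrite IH2. apply HK.
    + split; [exact H1|]. intros k. rewrite H2, power_coef_S
          by (apply a_hat_rapid || apply mult_Lambda_le).
      apply Zsum_ext. intros x. now rewrite IH2.
Qed.

Lemma aD_pow d h :
  smoothC (op_pow (op_comp (mul_by a) Defs.D) (S d) (expi h)) /\
  forall k, fourier (op_pow (op_comp (mul_by a) Defs.D) (S d) (expi h)) k
      = power_coef a_hat mult_D d h k.
Proof.
  induction d as [|d [IH1 IH2]].
  - destruct (aD_step (expi h) (smoothC_expi h)) as [H1 H2].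
    split; [exact H1|]. intros k. rewrite <- power_coef_0. apply H2.
  - set (u := op_pow (op_comp (mul_by a) Defs.D) (S d) (expi h)) in *.
    change (op_pow (op_comp (mul_by a) Defs.D) (S (S d)) (expi h))
      with (op_comp (mul_by a) Defs.D u).
    destruct (aD_step u IH1) as [H1 H2].
    split; [exact H1|]. intros k. rewrite H2, power_coef_S by (apply a_hat_rapid || apply mult_D_le).
    apply Zsum_ext. intros x. now rewrite IH2.
Qed.

(** ** The trace as an absolutely convergent sum over closed paths *)

(** The first point of the list is both the start and the end of the path; the sums over the others
    give the diagonal coefficient, and the sum over all points the trace. *)
Definition closed_path_term (l : list Z) : C :=
  match l with
  | nil => RtoC 0
  | n :: ks => (path_prod (conv_ker a_hat mult_Lambda) n ks n - path_prod (conv_ker a_hat mult_D)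
      n ks n)%C
  end.

Definition mult_prod (lam : Z -> R) (ks : list Z) : R := fold_right (fun x p => lam x * p) 1 ks.

Lemma path_prod_conv_ker_factor lam k ks h :
  path_prod (conv_ker a_hat lam) k ks h
      = (path_prod (fun x y => a_hat (x - y)%Z) k ks h * RtoC (mult_prod lam ks * lam h))%C.
Proof.
  revert k. induction ks as [|x xs IH]; intros k; cbn [path_prod mult_prod fold_right].
  - unfold conv_ker. now rewrite Rmult_1_l.
  - rewrite IH. unfold conv_ker. fold (mult_prod lam xs). rewrite !RtoC_mult. ring.
Qed.

Lemma mult_prod_abs ks : mult_prod mult_Lambda ks = Rabs (mult_prod mult_D ks).
Proof.
  induction ks as [|x xs IH]; cbn [mult_prod fold_right]; [now rewrite Rabs_R1|].
  fold (mult_prod mult_Lambda xs). fold (mult_prod mult_D xs). rewrite IH, Rabs_mult. f_equal.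
  unfold mult_Lambda, mult_D. now rewrite abs_IZR.
Qed.

Lemma closed_path_term_zero n ks : 0 <= mult_prod mult_D ks * mult_D n ->
    closed_path_term (n :: ks) = RtoC 0.
Proof.
  intros H. unfold closed_path_term. rewrite !path_prod_conv_ker_factor, mult_prod_abs.
  replace (mult_Lambda n) with (Rabs (mult_D n)) by (unfold mult_Lambda, mult_D; now rewrite abs_IZR).
  rewrite <- Rabs_mult, Rabs_pos_eq by easy. ring.
Qed.

Lemma mult_prod_nonneg ks : (forall v, In v ks -> (0 <= v)%Z) -> 0 <= mult_prod mult_D ks.
Proof.
  induction ks as [|x xs IH]; intros H; simpl; [lra|].
  apply Rmult_le_pos; [apply IZR_le, H; now left|]. apply IH. intros; apply H; now right.
Qed.

Lemma mult_prod_nonpos ks :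
  (forall v, In v ks -> (v <= 0)%Z) -> 0 <= (-1) ^ length ks * mult_prod mult_D ks.
Proof.
  induction ks as [|x xs IH]; intros H; cbn [length mult_prod fold_right pow]; [lra|].
  fold (mult_prod mult_D xs).
  replace (-1 * (-1) ^ length xs * (mult_D x * mult_prod mult_D xs))
    with (- mult_D x * ((-1) ^ length xs * mult_prod mult_D xs)) by ring.
  apply Rmult_le_pos.
  - pose proof (IZR_le _ _ (H x (or_introl eq_refl))). unfold mult_D. lra.
  - apply IH. intros; apply H; now right.
Qed.

Lemma sign_cases (l : list Z) :
  (forall v, In v l -> (0 <= v)%Z) \/ (forall v, In v l -> (v <= 0)%Z) \/
  (exists u v, In u l /\ In v l /\ (u < 0 < v)%Z).
Proof.
  induction l as [|x l IH]; [left; intros v []|].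
  destruct (Ztrichotomy x 0) as [Hx|[Hx|Hx]].
  - destruct (Forall_Exists_dec (fun v => (v <= 0)%Z) (fun v => Z_le_dec v 0) l) as [F|E].
    + right; left. rewrite Forall_forall in F. intros v [<-|Hv]; [lia|auto].
    + right; right. apply Exists_exists in E. destruct E as (v & Hv & Hv').
      exists x, v. simpl. split; [auto|]. split; [auto|lia].
  - subst x. destruct IH as [H|[H|(u & v & H1 & H2 & H3)]].
    + left. intros v [<-|Hv]; [lia|auto].
    + right; left. intros v [<-|Hv]; [lia|auto].
    + right; right. exists u, v. simpl. auto.
  - destruct (Forall_Exists_dec (fun v => (0 <= v)%Z) (fun v => Z_le_dec 0 v) l) as [F|E].
    + left. rewrite Forall_forall in F. intros v [<-|Hv]; [lia|auto].
    + right; right. apply Exists_exists in E. destruct E as (v & Hv & Hv').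
      exists v, x. simpl. split; [auto|]. split; [auto|lia].
Qed.

(** The terms cancel unless the product of the frequencies is negative.  As their number is even, the
    path then visits both signs, and every point is at most as far from 0 as from a point of the other
    sign, so that its size is controlled by the steps alone. *)
Lemma closed_path_term_tuple_dominated m : exists K, tuple_dominated (2 * S m) K closed_path_term.
Proof.
  set (d := (2 * S m - 1)%nat).
  destruct (a_hat_rapid (3 * S d)%nat) as (c & Hc & Hah).
  exists (2 * c ^ S d). intros l Hl.
  destruct l as [|n ks]; [simpl in Hl; lia|].
  assert (Hd : length ks = d) by (unfold d; simpl in Hl; lia).
  assert (G0 : 0 <= 2 * c ^ S d * weights (n :: ks)).
  { apply Rmult_le_pos; [|apply Rlt_le, weights_pos]. pose proof (pow_le c (S d) Hc). lra. }
  destruct (sign_cases (n :: ks)) as [H|[H|(u & v & Hu & Hv & Huv)]].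
  - rewrite closed_path_term_zero, Cmod_0; [exact G0|].
    apply Rmult_le_pos; [apply mult_prod_nonneg; intros; apply H; now right|].
    apply IZR_le, H. now left.
  - rewrite closed_path_term_zero, Cmod_0; [exact G0|].
    pose proof (mult_prod_nonpos ks (fun v Hv => H v (or_intror Hv))) as Hp.
    replace (length ks) with (S (2 * m)) in Hp by (simpl in Hl; lia).
    rewrite pow_1_odd in Hp. pose proof (IZR_le _ _ (H n (or_introl eq_refl))).
    unfold mult_D at 2. nra.
  - assert (B : forall w, w = n \/ In w ks -> 1 + absZ w <= 1 * steps_prod n ks n).
    { intros w Hw. rewrite Rmult_1_l.
      assert (M : forall z, In z (n :: ks) -> z = n \/ In z ks \/ z = n)
        by (intros z [->|Hz]; auto).
      assert (Hw' : w = n \/ In w ks \/ w = n) by tauto.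
      pose proof (steps_prod_distance n ks n w u Hw' (M u Hu)) as Du.
      pose proof (steps_prod_distance n ks n w v Hw' (M v Hv)) as Dv.
      unfold absZ in *. rewrite minus_IZR in *.
      assert (IZR u < 0) by (apply (IZR_lt u 0); lia). assert (0 < IZR v) by (apply (IZR_lt 0 v); lia).
      revert Du Dv. unfold Rabs. repeat destruct Rcase_abs; lra. }
    assert (P : forall lam, (forall n, Rabs (lam n) <= absZ n) ->
              Cmod (path_prod (conv_ker a_hat lam) n ks n) <= c ^ S d * weights (n :: ks)).
    { intros lam Hlam.
      pose proof (path_prod_dominated a_hat lam c d n ks n 1 Hc Hah Hlam Hd ltac:(lra) B) as Q.
      rewrite !pow1 in Q. pose proof (absZ_pos n). simpl weights. fold (weights ks).
      assert (0 <= c ^ S d * (weight n * weights ks)).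
      { apply Rmult_le_pos; [now apply pow_le|].
        apply Rmult_le_pos; apply Rlt_le; [apply weight_pos|apply weights_pos]. }
      apply Rmult_le_reg_l with (1 + absZ n); [lra|]. nra. }
    unfold closed_path_term, Cminus. eapply Rle_trans; [apply Cmod_triangle|]. rewrite Cmod_opp.
    pose proof (P mult_Lambda mult_Lambda_le). pose proof (P mult_D mult_D_le). lra.
Qed.

Lemma diag_coef_iter_sum m n :
  diag_coef (zeta_operator (S m) a) n = iter_sum (2 * S m - 1) (fun ks => closed_path_term (n :: ks)).
Proof.
  set (d := (2 * S m - 1)%nat).
  unfold diag_coef, zeta_operator, op_sub. replace (2 * S m)%nat with (S d) by (unfold d; lia).
  destruct (aLambda_pow d n) as [L1 L2]. destruct (aD_pow d n) as [D1 D2].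
  rewrite fourier_minus by (assumption || now apply smoothC_contC).
  rewrite L2, D2. unfold power_coef, closed_path_term.
  destruct (path_prod_tuple_dominated_weak a_hat mult_Lambda d n n a_hat_rapid mult_Lambda_le) as [K HK].
  destruct (path_prod_tuple_dominated_weak a_hat mult_D d n n a_hat_rapid mult_D_le) as [K' HK'].
  now rewrite (iter_sum_minus d K K').
Qed.

Lemma zeta_trace m :
  Zsummable (diag_coef (zeta_operator (S m) a)) /\
  Clim (fun N => box_sum N (2 * S m) closed_path_term) (Zsum (diag_coef (zeta_operator (S m) a))).
Proof.
  destruct (closed_path_term_tuple_dominated m) as [K HK].
  assert (E : diag_coef (zeta_operator (S m) a)
      = fun n => iter_sum (2 * S m - 1) (fun ks => closed_path_term (n :: ks)))
    by (apply functional_extensionality; intros; apply diag_coef_iter_sum).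
  rewrite E. split.
  - eapply dominated_summable, tuple_dominated_cons_iter_sum.
    replace (S (2 * S m - 1)) with (2 * S m)%nat by lia.
    exact HK.
  - change (Zsum (fun n => iter_sum (2 * S m - 1) (fun ks => closed_path_term (n :: ks))))
        with (iter_sum (S (2 * S m - 1)) closed_path_term).
    replace (S (2 * S m - 1)) with (2 * S m)%nat by lia. eapply box_sum_lim, HK.
Qed.

End Operators.

(** * Polynomials in an integer variable *)

(** Polynomials of degree at most [d] whose coefficient of degree [d] is [c], on the integers; Horner's
    scheme makes differences and leading coefficients accessible by induction on [d]. *)
Fixpoint poly_of (d : nat) (c : C) (P : Z -> C) : Prop :=
  match d with
  | O => forall x, P x = c
  | S d => exists q Q, poly_of d c Q /\ forall x, P x = (q + RtoC (IZR x) * Q x)%C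
  end.

Lemma poly_of_ext d c P P' : (forall x, P x = P' x) -> poly_of d c P -> poly_of d c P'.
Proof.
  destruct d as [|d]; simpl.
  - intros H HP x. now rewrite <- H.
  - intros H (q & Q & HQ & HP). exists q, Q. split; [easy|]. intros x. now rewrite <- H.
Qed.

Lemma poly_of_add d c c' P P' : poly_of d c P -> poly_of d c' P' ->
    poly_of d (c + c') (fun x => P x + P' x)%C.
Proof.
  revert c c' P P'. induction d as [|d IH]; intros c c' P P'; cbn [poly_of].
  - intros H H' x. now rewrite H, H'.
  - intros (q & Q & HQ & H) (q' & Q' & HQ' & H'). exists (q + q')%C, (fun x => Q x + Q' x)%C.
    split; [now apply IH|]. intros x. rewrite H, H'. ring.
Qed.

Lemma poly_of_scal d c P z : poly_of d c P -> poly_of d (z * c) (fun x => z * P x)%C.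
Proof.
  revert c P. induction d as [|d IH]; intros c P; cbn [poly_of].
  - intros H x. now rewrite H.
  - intros (q & Q & HQ & H). exists (z * q)%C, (fun x => z * Q x)%C.
    split; [now apply IH|]. intros x. rewrite H. ring.
Qed.

Lemma poly_of_mulX d c P : poly_of d c P -> poly_of (S d) c (fun x => RtoC (IZR x) * P x)%C.
Proof. intros H. exists (RtoC 0), P. split; [easy|]. intros x. ring. Qed.

Lemma poly_of_raise d c P : poly_of d c P -> poly_of (S d) 0 P.
Proof.
  revert c P. induction d as [|d IH]; intros c P.
  - intros H. exists c, (fun _ => RtoC 0). split; [easy|]. intros x. rewrite H. ring.
  - intros (q & Q & HQ & H). exists q, Q. split; [now apply (IH c)|easy].
Qed.

Lemma poly_of_shift d c P (h : Z) : poly_of d c P -> poly_of d c (fun x => P (x + h)%Z).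
Proof.
  revert c P. induction d as [|d IH]; intros c P.
  - intros H x. apply H.
  - intros (q & Q & HQ & H). pose proof (IH c Q HQ) as HS.
    apply poly_of_ext with (fun x => RtoC (IZR x) * Q (x + h)%Z + (q + RtoC (IZR h) * Q (x + h)%Z))%C.
    + intros x. rewrite H, plus_IZR, RtoC_plus. ring.
    + replace c with (c + RtoC 0)%C by ring. apply poly_of_add; [now apply poly_of_mulX|].
      replace (RtoC 0) with (RtoC 0 + RtoC 0)%C by ring. apply poly_of_add.
      * clear. revert q. induction d as [|d IH]; intros q.
        -- exists q, (fun _ => RtoC 0). split; [easy|]. intros; ring.
        -- exists q, (fun _ => RtoC 0). split; [apply IH|]. intros; ring.
      * apply (poly_of_raise d (RtoC (IZR h) * c)). now apply poly_of_scal.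
Qed.

Lemma poly_of_diff d c P (h : Z) :
  poly_of (S d) c P -> poly_of d (RtoC (INR (S d) * IZR h) * c) (fun x => P (x + h)%Z - P x)%C.
Proof.
  revert c P. induction d as [|d IH]; intros c P (q & Q & HQ & H).
  - intros x. simpl in HQ. rewrite !H, !HQ, plus_IZR, RtoC_plus. simpl INR. rewrite Rmult_1_l. ring.
  - apply poly_of_ext with (fun x => RtoC (IZR x) * (Q (x + h)%Z - Q x) + RtoC (IZR h) * Q (x + h)%Z)%C.
    + intros x. rewrite !H, plus_IZR, RtoC_plus. ring.
    + replace (RtoC (INR (S (S d)) * IZR h) * c)%C
        with (RtoC (INR (S d) * IZR h) * c + RtoC (IZR h) * c)%C.
      2:{ rewrite (S_INR (S d)), !RtoC_mult, RtoC_plus. ring. }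
      apply poly_of_add.
      * apply poly_of_mulX. now apply IH.
      * apply poly_of_scal. now apply poly_of_shift.
Qed.

Lemma rsum_seq_shift s n (F : nat ->
    R) j : rsum (seq (s + j) n) F = rsum (seq s n) (fun i => F (i + j)%nat).
Proof.
  revert s. induction n as [|n IH]; intros s; [reflexivity|].
  change (F (s + j)%nat + rsum (seq (S s + j) n) F
      = F (s + j)%nat + rsum (seq (S s) n) (fun i => F (i + j)%nat)).
  now rewrite IH.
Qed.

(** The [d]-th difference with step [h] is [d! h^d c]; its binomial coefficients are at most [2^d]. *)
Lemma poly_of_lead_bound d c P x (h : Z) : poly_of d c P ->
  absZ h ^ d * Cmod c <= 2 ^ d * rsum (seq 0 (S d)) (fun i => Cmod (P (x + Z.of_nat i * h)%Z)).
Proof.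
  revert c P. induction d as [|d IH]; intros c P H.
  - unfold rsum. simpl. rewrite (H (x + 0)%Z). lra.
  - pose proof (IH _ _ (poly_of_diff d c P h H)) as B.
    assert (P2 : 0 < 2 ^ d) by (apply pow_lt; lra).
    rewrite Cmod_mult, Cmod_R, Rabs_mult, (Rabs_pos_eq (INR (S d))) in B by apply pos_INR.
    fold (absZ h) in B.
    assert (L : absZ h ^ S d * Cmod c <= absZ h ^ d * (INR (S d) * absZ h * Cmod c)).
    { simpl pow. pose proof (pow_le (absZ h) d (absZ_pos h)).
      assert (1 <= INR (S d)) by (rewrite S_INR; pose proof (pos_INR d); lra).
      assert (0 <= absZ h ^ d * (absZ h * Cmod c))
        by (repeat apply Rmult_le_pos; try easy; [apply absZ_pos|apply Cmod_ge_0]).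
      nra. }
    eapply Rle_trans; [exact L|]. eapply Rle_trans; [exact B|].
    change (2 ^ S d) with (2 * 2 ^ d). rewrite (Rmult_comm 2), Rmult_assoc.
    apply Rmult_le_compat_l; [lra|].
    set (F := fun i : nat => Cmod (P (x + Z.of_nat i * h)%Z)).
    apply Rle_trans with (rsum (seq 0 (S d)) (fun i => F (i + 1)%nat + F i)).
    + apply rsum_le. intros i _. unfold Cminus. eapply Rle_trans; [apply Cmod_triangle|].
      rewrite Cmod_opp. apply Rplus_le_compat_r. right. unfold F. do 2 f_equal. lia.
    + rewrite rsum_plus, <- rsum_seq_shift.
      assert (HF : forall i, 0 <= F i) by (intros; apply Cmod_ge_0).
      assert (rsum (seq (0 + 1) (S d)) F <= rsum (seq 0 (S (S d))) F).
      { apply rsum_incl; [apply seq_NoDup| |exact HF]. intros i. rewrite !in_seq. lia. }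
      assert (rsum (seq 0 (S d)) F <= rsum (seq 0 (S (S d))) F).
      { apply rsum_incl; [apply seq_NoDup| |exact HF]. intros i. rewrite !in_seq. lia. }
      lra.
Qed.

(** The progressions of step [h] starting in [[h, 2h - 1]] tile an interval. *)
Lemma rsum_blocks (F : nat -> R) h m :
  rsum (seq 0 m) (fun i => rsum (seq h h) (fun y => F (y + i * h)%nat)) = rsum (seq h (m * h)) F.
Proof.
  induction m as [|m IH]; [reflexivity|].
  rewrite seq_S, rsum_app, IH. replace (S m * h)%nat with (m * h + h)%nat by lia.
  rewrite seq_app, rsum_app. f_equal. rewrite rsum_seq_shift. unfold rsum at 1. simpl. ring.
Qed.

(** The first factor bounds [(n / h)^(2m+1)] for the step [h] of [poly_of_weighted_bound]; the second one
    is what the Cauchy-Schwarz inequality for a difference of order [m - 1] costs. *)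
Definition bound_const (m : nat) : R := (4 * INR m + 2) ^ (2 * m + 1) * (4 ^ (m - 1) * INR m).

Lemma bound_const_pos m : (1 <= m)%nat -> 0 < bound_const m.
Proof.
  intros H. apply le_INR in H. simpl in H. unfold bound_const.
  apply Rmult_lt_0_compat; [apply pow_lt; lra|].
  apply Rmult_lt_0_compat; [apply pow_lt; lra|lra].
Qed.

(** A polynomial of degree [m - 1] that is small at [1, ..., n - 1] has a small leading
    coefficient as soon as there are [m] such points: average the [(m-1)]-st differences with a
    step [h] proportional to [n], using only points [y] with [h <= y <= n - h]. *)
Lemma poly_of_weighted_bound m n c P : (1 <= m)%nat -> (m + 1 <= n)%nat -> poly_of (m - 1) c P ->
  INR n ^ (2 * m + 1) * Cmod c ^ 2 <=
  bound_const m * rsum (seq 1 (n - 1)) (fun y => INR (n - y) * INR y * Cmod (P (- Z.of_nat y)%Z) ^ 2).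
Proof.
  intros Hm Hn HP. set (d := (m - 1)%nat) in *.
  set (q := (n / (m + 1))%nat). set (h := ((q + 1) / 2)%nat).
  assert (Hq : (n = (m + 1) * q + n mod (m + 1))%nat) by (apply Nat.div_mod; lia).
  assert (Hr : (n mod (m + 1) < m + 1)%nat) by (apply Nat.mod_upper_bound; lia).
  assert (Hq1 : (1 <= q)%nat) by (apply Nat.div_le_lower_bound; lia).
  assert (Hh : (q + 1 = 2 * h + (q + 1) mod 2)%nat) by (apply Nat.div_mod; lia).
  assert (Hh2 : ((q + 1) mod 2 < 2)%nat) by (apply Nat.mod_upper_bound; lia).
  set (r := (n mod (m + 1))%nat) in *. set (e := ((q + 1) mod 2)%nat) in *.
  assert (Hh1 : (1 <= h)%nat) by lia.
  assert (Hqh : (q <= 2 * h)%nat) by lia.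
  assert (Hnh : (n <= (4 * m + 2) * h)%nat) by nia.
  assert (Hlast : ((m + 1) * h + h <= n + 1)%nat) by nia.
  set (G := fun y : nat => Cmod (P (- Z.of_nat y)%Z) ^ 2).
  assert (HG : forall y, 0 <= G y) by (intros; apply pow2_ge_0).
  assert (Hh0 : 1 <= INR h) by (apply le_INR in Hh1; exact Hh1).
  assert (P4 : 0 < 4 ^ d) by (apply pow_lt; lra).
  (* Cauchy-Schwarz for the difference along one progression *)
  assert (S1 : forall y0, (INR h ^ d * Cmod c) ^ 2 <=
             4 ^ d * INR m * rsum (seq 0 m) (fun i => G (y0 + i * h)%nat)).
  { intros y0.
    pose proof (poly_of_lead_bound d c P (- Z.of_nat y0)%Z (- Z.of_nat h)%Z HP) as B.
    replace (absZ (- Z.of_nat h)) with (INR h) in B.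
    2:{ unfold absZ. rewrite opp_IZR, Rabs_Ropp, <- INR_IZR_INZ, Rabs_pos_eq; lra. }
    replace (S d) with m in B by (unfold d; lia).
    set (g := fun i : nat => Cmod (P (- Z.of_nat y0 + Z.of_nat i * - Z.of_nat h)%Z)) in *.
    assert (B2 : (INR h ^ d * Cmod c) ^ 2 <= (2 ^ d * rsum (seq 0 m) g) ^ 2).
    { apply pow_incr. split; [|exact B].
      apply Rmult_le_pos; [apply pow_le; lra|apply Cmod_ge_0]. }
    eapply Rle_trans; [exact B2|]. rewrite Rpow_mult_distr.
    replace ((2 ^ d) ^ 2) with (4 ^ d).
    2:{ rewrite <- pow_mult, Nat.mul_comm, pow_mult. f_equal. ring. }
    rewrite Rmult_assoc. apply Rmult_le_compat_l; [lra|].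
    pose proof (rsum_Cauchy_Schwarz (seq 0 m) (fun _ => 1) g) as CS.
    rewrite (rsum_ext _ (fun x => 1 * g x) g) in CS by (intros; ring).
    rewrite rsum_const, length_seq in CS.
    rewrite (rsum_ext (seq 0 m) (fun i => G (y0 + i * h)%nat) (fun i => g i ^ 2)); [lra|].
    intros i _. unfold G, g. do 3 f_equal. lia. }
  assert (S2 : INR h * (INR h ^ d * Cmod c) ^ 2 <= 4 ^ d * INR m * rsum (seq h (m * h)) G).
  { rewrite <- rsum_blocks, rsum_exchange, <- rsum_scal_l.
    rewrite <- (length_seq h h) at 1. rewrite <- rsum_const. apply rsum_le. intros y _. apply S1. }
  (* the weight [(n - y) y] is at least [h ^ 2] there *)
  set (W := rsum (seq 1 (n - 1)) (fun y => INR (n - y) * INR y * G y)).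
  assert (S3 : INR h ^ 2 * rsum (seq h (m * h)) G <= W).
  { rewrite <- rsum_scal_l.
    apply Rle_trans with (rsum (seq h (m * h)) (fun y => INR (n - y) * INR y * G y)).
    - apply rsum_le. intros y Hy. apply in_seq in Hy.
      assert (Y1 : (h <= y)%nat) by lia. assert (Y2 : (h <= n - y)%nat) by nia.
      apply le_INR in Y1. apply le_INR in Y2.
      apply Rmult_le_compat_r; [apply HG|]. nra.
    - apply rsum_incl; [apply seq_NoDup| |].
      + intros y. rewrite !in_seq. nia.
      + intros y. apply Rmult_le_pos; [apply Rmult_le_pos; apply pos_INR|apply HG]. }
  assert (S4 : INR h ^ (2 * m + 1) * Cmod c ^ 2 <= 4 ^ d * INR m * W).
  { replace (2 * m + 1)%nat with (2 + (1 + (d * 2)))%nat by (unfold d; lia).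
    rewrite !pow_add, pow_mult.
    apply Rle_trans with (INR h ^ 2 * (4 ^ d * INR m * rsum (seq h (m * h)) G)).
    - replace (INR h ^ 2 * (INR h ^ 1 * (INR h ^ d) ^ 2) * Cmod c ^ 2)
        with (INR h ^ 2 * (INR h * (INR h ^ d * Cmod c) ^ 2)) by ring.
      apply Rmult_le_compat_l; [apply pow2_ge_0|exact S2].
    - replace (INR h ^ 2 * (4 ^ d * INR m * rsum (seq h (m * h)) G))
        with (4 ^ d * INR m * (INR h ^ 2 * rsum (seq h (m * h)) G)) by ring.
      apply Rmult_le_compat_l; [|exact S3]. apply Rmult_le_pos; [lra|apply pos_INR]. }
  assert (S5 : INR n ^ (2 * m + 1) <= (4 * INR m + 2) ^ (2 * m + 1) * INR h ^ (2 * m + 1)).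
  { rewrite <- Rpow_mult_distr. apply pow_incr. split; [apply pos_INR|].
    apply le_INR in Hnh. rewrite mult_INR, plus_INR, mult_INR in Hnh. simpl INR in Hnh.
    replace (1 + 1 + 1 + 1) with 4 in Hnh by ring. replace (1 + 1) with 2 in Hnh by ring. exact Hnh. }
  apply Rle_trans with ((4 * INR m + 2) ^ (2 * m + 1) * (INR h ^ (2 * m + 1) * Cmod c ^ 2)).
  - rewrite <- Rmult_assoc. apply Rmult_le_compat_r; [apply pow2_ge_0|exact S5].
  - unfold bound_const. fold d. rewrite Rmult_assoc. apply Rmult_le_compat_l.
    + apply pow_le. pose proof (pos_INR m). lra.
    + exact S4.
Qed.

(** * Polynomial dependence of [(a D)^m e_h] on [h] *)

(** The same for families of functions: the coefficients are smooth functions of [t]. *)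
Fixpoint poly_family (d : nat) (U : Z -> R -> C) (lead : R -> C) : Prop :=
  match d with
  | O => smoothC lead /\ forall h t, U h t = lead t
  | S d => exists q V, smoothC q /\ poly_family d V lead /\ forall h t, U h t
      = (q t + RtoC (IZR h) * V h t)%C
  end.

Lemma poly_family_smooth d U lead h : poly_family d U lead -> smoothC (U h).
Proof.
  revert U lead. induction d as [|d IH]; intros U lead.
  - intros [H E]. replace (U h) with lead; [easy|].
    apply functional_extensionality; intros; now rewrite E.
  - intros (q & V & Hq & HV & E).
    replace (U h) with (fun t => q t + RtoC (IZR h) * V h t)%C
      by (apply functional_extensionality; intros; now rewrite E).
    apply smoothC_plus; [easy|]. apply smoothC_scal. now apply (IH V lead).
Qed.

Lemma poly_family_mulX d U lead : poly_family d U lead ->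
    poly_family (S d) (fun h t => RtoC (IZR h) * U h t)%C lead.
Proof.
  intros H. exists (fun _ => RtoC 0), U. split; [apply smoothC_const|]. split; [easy|]. intros; ring.
Qed.

Lemma poly_family_mul_fun d U lead g : smoothC g -> poly_family d U lead ->
  poly_family d (fun h t => g t * U h t)%C (fun t => g t * lead t)%C.
Proof.
  intros Hg. revert U lead. induction d as [|d IH]; intros U lead; cbn [poly_family].
  - intros [H1 H2]. split; [now apply smoothC_mult|]. intros; now rewrite H2.
  - intros (q & V & H1 & H2 & H3). exists (fun t => g t * q t)%C, (fun h t => g t * V h t)%C.
    split; [now apply smoothC_mult|]. split; [now apply IH|]. intros h t. rewrite H3. ring.
Qed.

Lemma poly_family_add_lower d U V lead lead' : poly_family (S d) U lead -> poly_family d V lead' ->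
  poly_family (S d) (fun h t => U h t + V h t)%C lead.
Proof.
  revert U V lead lead'. induction d as [|d IH]; intros U V lead lead' (q & U1 & H1 & H2 & H3).
  - intros [H4 H5]. exists (fun t => q t + lead' t)%C, U1.
    split; [now apply smoothC_plus|]. split; [easy|]. intros h t. rewrite H3, H5. ring.
  - intros (q' & V1 & H4 & H5 & H6). exists (fun t => q t + q' t)%C, (fun h t => U1 h t + V1 h t)%C.
    split; [now apply smoothC_plus|]. split; [now apply (IH _ _ _ lead')|].
    intros h t. rewrite H3, H6. ring.
Qed.

Lemma D_plus u v : smoothC u -> smoothC v ->
  Defs.D (fun t => u t + v t)%C = (fun t => Defs.D u t + Defs.D v t)%C.
Proof.
  intros Hu Hv. apply functional_extensionality; intros t.
  change ((- Ci * Cder (fun t => u t + v t) t)%C = (- Ci * Cder u t + - Ci * Cder v t)%C).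
  rewrite (Cder_plus u v (smoothC_diffC u Hu) (smoothC_diffC v Hv)). ring.
Qed.

Lemma D_scal c u : smoothC u -> Defs.D (fun t => c * u t)%C = (fun t => c * Defs.D u t)%C.
Proof.
  intros Hu. apply functional_extensionality; intros t.
  change ((- Ci * Cder (fun t => c * u t) t)%C = (c * (- Ci * Cder u t))%C).
  rewrite (Cder_scal c u Hu). ring.
Qed.

Lemma D_expi_mult h u : smoothC u ->
  Defs.D (fun t => expi h t * u t)%C = (fun t => expi h t * (RtoC (IZR h) * u t + Defs.D u t))%C.
Proof.
  intros Hu. apply functional_extensionality; intros t.
  change ((- Ci * Cder (fun t => expi h t * u t) t)%C
          = (expi h t * (RtoC (IZR h) * u t + - Ci * Cder u t))%C).
  rewrite (Cder_mult (expi h) u (diffC_expi h) (smoothC_diffC u Hu)), Cder_expi.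
  transitivity (- (Ci * Ci) * (RtoC (IZR h) * expi h t * u t) - Ci * (expi h t * Cder u t))%C; [ring|].
  replace (Ci * Ci)%C with (- (1))%C; [ring|].
  unfold Ci. apply injective_projections; simpl; ring.
Qed.

Lemma poly_family_D d U lead : poly_family d U lead ->
    poly_family d (fun h => Defs.D (U h)) (Defs.D lead).
Proof.
  revert U lead. induction d as [|d IH]; intros U lead.
  - intros [H1 H2]. split; [now apply smoothC_D|]. intros h t.
    replace (U h) with lead; [easy|]. apply functional_extensionality; intros; now rewrite H2.
  - intros (q & V & H1 & H2 & H3). exists (Defs.D q), (fun h => Defs.D (V h)).
    split; [now apply smoothC_D|]. split; [now apply IH|]. intros h t.
    replace (U h) with (fun t => q t + RtoC (IZR h) * V h t)%C
      by (apply functional_extensionality; intros; now rewrite H3).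
    pose proof (poly_family_smooth d V lead h H2) as HV.
    rewrite (D_plus q _ H1 (smoothC_scal (RtoC (IZR h)) _ HV)).
    now rewrite (D_scal (RtoC (IZR h)) _ HV).
Qed.

Lemma poly_family_fourier d U lead n : poly_family d U lead ->
    poly_of d (fourier lead n) (fun h => fourier (U h) n).
Proof.
  revert U lead. induction d as [|d IH]; intros U lead.
  - intros [H1 H2] h. apply fourier_ext. intros; apply H2.
  - intros (q & V & H1 & H2 & H3). exists (fourier q n), (fun h => fourier (V h) n).
    split; [now apply IH|]. intros h.
    pose proof (smoothC_contC _ (poly_family_smooth d V lead h H2)) as HV.
    rewrite (fourier_ext (U h) (fun t => q t + RtoC (IZR h) * V h t)%C) by (intros; apply H3).
    rewrite fourier_plus, fourier_scal; try assumption; [reflexivity|now apply smoothC_contC|].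
    apply smoothC_contC, smoothC_scal. now apply (poly_family_smooth d V lead).
Qed.

(** Induction on [d] with [D (e_h u) = e_h (h u + D u)]: each step raises the degree in [h] by one and
    multiplies the leading coefficient by [a]. *)
Lemma aD_pow_polynomial a d : smooth_on_circle a ->
  exists U, poly_family d U (fun t => RtoC (a t ^ S d)) /\
    forall h t, op_pow (op_comp (mul_by a) Defs.D) (S d) (expi h) t
                = (expi h t * (RtoC (IZR h) * U h t))%C.
Proof.
  intros Ha. pose proof (Cfun_smooth a Ha) as Sa.
  induction d as [|d (U & HU & E)].
  - exists (fun _ => Cfun a). split.
    + split.
      * replace (fun t => RtoC (a t ^ 1)) with (Cfun a); [exact Sa|].
        apply functional_extensionality; intros t. unfold Cfun. f_equal. ring.
      * intros h t. unfold Cfun. f_equal. ring.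
    + intros h t. change ((Cfun a t * Defs.D (expi h) t)%C = (expi h t * (RtoC (IZR h) * Cfun a t))%C).
      change (Defs.D (expi h) t) with (- Ci * Cder (expi h) t)%C. rewrite Cder_expi.
      transitivity (- (Ci * Ci) * (Cfun a t * (RtoC (IZR h) * expi h t)))%C; [ring|].
      replace (Ci * Ci)%C with (- (1))%C; [ring|].
      unfold Ci. apply injective_projections; simpl; ring.
  - exists (fun h t => Cfun a t * (RtoC (IZR h) * U h t + Defs.D (U h) t))%C. split.
    + replace (fun t => RtoC (a t ^ S (S d))) with (fun t => Cfun a t * RtoC (a t ^ S d))%C
        by (apply functional_extensionality; intros t; unfold Cfun; now rewrite <- RtoC_mult).
      apply poly_family_mul_fun; [exact Sa|].
      eapply poly_family_add_lower; [apply poly_family_mulX; exact HU|apply poly_family_D; exact HU].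
    + intros h t.
      change ((Cfun a t * Defs.D (op_pow (op_comp (mul_by a) Defs.D) (S d) (expi h)) t)%C =
              (expi h t * (RtoC (IZR h) * (Cfun a t * (RtoC (IZR h) * U h t + Defs.D (U h) t))))%C).
      replace (op_pow (op_comp (mul_by a) Defs.D) (S d) (expi h))
        with (fun t => expi h t * (RtoC (IZR h) * U h t))%C
        by (apply functional_extensionality; intros; now rewrite E).
      pose proof (poly_family_smooth d U _ h HU) as SU.
      rewrite (D_expi_mult h _ (smoothC_scal (RtoC (IZR h)) _ SU)), (D_scal _ _ SU). ring.
Qed.

(** * The lower bound *)

Section Bound.

Context (a : R -> R).
Hypothesis Ha : smooth_on_circle a.

Lemma a_hat_conj n : a_hat a (- n) = Cconj (a_hat a n).
Proof.
  unfold a_hat. pose proof (smoothC_contC _ (Cfun_smooth a Ha)) as HC.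
  rewrite !fourierE by exact HC. rewrite Cmult_conj. f_equal.
  - unfold Cconj, RtoC. simpl. f_equal. ring.
  - assert (Hc : contC (fun t => Cfun a t * expi (- n) t)%C) by (apply contC_mult;
        [exact HC|apply contC_expi]).
    destruct (contC_ex_RInt _ 0 (2 * PI) Hc) as [_ H2].
    unfold Cint, Cconj. cbn [fst snd]. f_equal.
    + apply RInt_ext. intros t _. rewrite Z.opp_involutive, <- (expi_conj n).
      unfold Cfun, Cconj, RtoC. simpl. ring.
    + refine (eq_trans _ (RInt_opp (V := R_CompleteNormedModule) _ _ _ H2)).
      apply RInt_ext. intros t _. rewrite Z.opp_involutive, <- (expi_conj n).
      unfold Cfun, Cconj, RtoC, opp. simpl. ring.
Qed.

Definition sqrt_abs (k : Z) : R := sqrt (absZ k).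

Lemma sqrt_abs_sq k : sqrt_abs k * sqrt_abs k = absZ k.
Proof. apply sqrt_sqrt, absZ_pos. Qed.

Lemma sqrt_abs_neq_0 k : k <> 0%Z -> sqrt_abs k <> 0.
Proof.
  intros Hk E. pose proof (sqrt_abs_sq k) as H. rewrite E, Rmult_0_l in H.
  apply Hk, eq_IZR. unfold absZ in H. symmetry in H.
  destruct (Req_dec (IZR k) 0) as [H0|H0]; [exact H0|]. now apply Rabs_no_R0 in H0.
Qed.

(** [Lambda^{1/2} a Lambda^{1/2}] and the sign of [D]. *)
Definition sym_mx (k h : Z) : C := (RtoC (sqrt_abs k) * a_hat a (k - h) * RtoC (sqrt_abs h))%C.

(** The value at 0 is -1 rather than 0, so that this is an involution. *)
Definition sign_D (k : Z) : R := if Z_lt_dec 0 k then 1 else -1.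

Lemma sym_mx_herm k h : sym_mx k h = Cconj (sym_mx h k).
Proof.
  unfold sym_mx. rewrite !Cmult_conj, <- a_hat_conj.
  replace (- (h - k))%Z with (k - h)%Z by lia.
  replace (Cconj (RtoC (sqrt_abs h))) with (RtoC (sqrt_abs h)) by (unfold Cconj, RtoC; simpl;
      f_equal; ring).
  replace (Cconj (RtoC (sqrt_abs k))) with (RtoC (sqrt_abs k)) by (unfold Cconj, RtoC; simpl;
      f_equal; ring).
  ring.
Qed.

Lemma sign_D_invol k : sign_D k * sign_D k = 1.
Proof. unfold sign_D. destruct (Z_lt_dec 0 k); ring. Qed.

Definition mult_sign (b : bool) : Z -> R := if b then mult_D else mult_Lambda.

Lemma mult_sign_sq b h : RtoC (mult_sign b h)
    = (RtoC (sqrt_abs h) * RtoC (sqrt_abs h) * diag_entry sign_D b h)%C.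
Proof.
  rewrite <- RtoC_mult, sqrt_abs_sq. unfold mult_sign, diag_entry, mult_D, mult_Lambda, absZ, sign_D.
  destruct b.
  - rewrite <- RtoC_mult. f_equal. destruct (Z_lt_dec 0 h) as [H|H].
    + apply IZR_lt in H. rewrite Rabs_pos_eq; lra.
    + assert (IZR h <= 0) by (apply IZR_le; lia). rewrite Rabs_left1 by easy. ring.
  - rewrite Cmult_1_r. f_equal. apply abs_IZR.
Qed.

(** Conjugation by [Lambda^{1/2}]: the factors at the intermediate points cancel. *)
Lemma path_prod_sym_mx b k ks h :
  (RtoC (sqrt_abs k) * path_prod (conv_ker (a_hat a) (mult_sign b)) k ks h
      = path_prod (scale sign_D b sym_mx) k ks h * RtoC (sqrt_abs h))%C.
Proof.
  assert (E : forall k x, (RtoC (sqrt_abs k) * conv_ker (a_hat a) (mult_sign b) k x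
      = scale sign_D b sym_mx k x * RtoC (sqrt_abs x))%C).
  { intros i j. unfold conv_ker, scale, sym_mx. rewrite mult_sign_sq. ring. }
  revert k. induction ks as [|x xs IH]; intros k; cbn [path_prod]; [apply E|].
  rewrite Cmult_assoc, E, <- Cmult_assoc, IH. ring.
Qed.

(** On closed paths the conjugation disappears, also at 0 where [Lambda^{1/2}] is not invertible. *)
Lemma path_prod_sym_mx_closed b n ks :
  path_prod (conv_ker (a_hat a) (mult_sign b)) n ks n = path_prod (scale sign_D b sym_mx) n ks n.
Proof.
  destruct (Z.eq_dec n 0) as [->|Hn].
  - rewrite path_prod_conv_ker_factor.
    assert (E : mult_sign b 0 = 0) by (destruct b; reflexivity). rewrite E, Rmult_0_r, Cmult_0_r.
    assert (F : forall x, scale sign_D b sym_mx 0%Z x = RtoC 0).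
    { intros x. unfold scale, sym_mx, sqrt_abs, absZ. rewrite Rabs_R0, sqrt_0. ring. }
    destruct ks; cbn [path_prod]; rewrite F; ring.
  - pose proof (path_prod_sym_mx b n ks n) as H.
    assert (N : RtoC (sqrt_abs n) <> RtoC 0) by (intros E; apply RtoC_inj in E;
        now apply (sqrt_abs_neq_0 n)).
    transitivity (/ RtoC (sqrt_abs n) * (RtoC (sqrt_abs n)
        * path_prod (conv_ker (a_hat a) (mult_sign b)) n ks n))%C.
    + rewrite Cmult_assoc, Cinv_l by easy. ring.
    + rewrite H, (Cmult_comm _ (RtoC (sqrt_abs n))), Cmult_assoc, Cinv_l by easy. ring.
Qed.

Lemma box_sum_closed_path_term N m :
  box_sum N (2 * S m) (closed_path_term a) =
  (tr (zrange N) (word_mx (zrange N) sym_mx sign_D (repeat false (2 * S m)))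
   - tr (zrange N) (word_mx (zrange N) sym_mx sign_D (repeat true (2 * S m))))%C.
Proof.
  replace (2 * S m)%nat with (S (2 * m + 1)) by lia. set (d := (2 * m + 1)%nat).
  cbn [box_sum]. unfold tr. rewrite <- csum_minus. apply csum_ext. intros n _.
  rewrite !word_mx_repeat_box_sum, <- box_sum_minus. apply box_sum_ext. intros ks _.
  unfold closed_path_term.
  now rewrite <- !path_prod_sym_mx_closed.
Qed.

(** Matrix coefficients of [(a D)^{m+1}] and their truncations. *)
Definition aD_coef (m : nat) (k h : Z) : C := power_coef (a_hat a) mult_D m h k.
Definition aD_coef_box (N m : nat) (k h : Z) : C := box_sum N m (fun ks =>
    path_prod (conv_ker (a_hat a) mult_D) k ks h).

Lemma aD_coef_box_lim m k h : Clim (fun N => aD_coef_box N m k h) (aD_coef m k h).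
Proof.
  destruct (path_prod_tuple_dominated_weak (a_hat a) mult_D m h k (a_hat_rapid a Ha) mult_D_le)
      as [K HK].
  eapply box_sum_lim, HK.
Qed.

Lemma word_mx_aD_coef_box N m k h :
  absZ h * Cmod (word_mx (zrange N) sym_mx sign_D (repeat true (S m)) k h) ^ 2
      = absZ k * Cmod (aD_coef_box N m k h) ^ 2.
Proof.
  assert (E : (word_mx (zrange N) sym_mx sign_D (repeat true (S m)) k h * RtoC (sqrt_abs h)
               = RtoC (sqrt_abs k) * aD_coef_box N m k h)%C).
  { rewrite word_mx_repeat_box_sum. unfold aD_coef_box.
    rewrite <- box_sum_scal, Cmult_comm, <- box_sum_scal.
    apply box_sum_ext. intros ks _. rewrite Cmult_comm. symmetry. exact (path_prod_sym_mx true k ks h). }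
  apply (f_equal Cmod) in E. rewrite !Cmod_mult, !Cmod_R in E.
  rewrite (Rabs_pos_eq (sqrt_abs h)), (Rabs_pos_eq (sqrt_abs k)) in E by apply sqrt_pos.
  rewrite <- !sqrt_abs_sq.
  transitivity ((Cmod (word_mx (zrange N) sym_mx sign_D (repeat true (S m)) k h)
      * sqrt_abs h) ^ 2); [ring|].
  rewrite E. ring.
Qed.

(** The part of the squared Hilbert-Schmidt norm of [Lambda^{1/2} f Lambda^{-1/2}] that maps negative to
    positive frequencies, up to frequency [L]. *)
Definition corner_sum (L : nat) (f : Z -> Z -> C) : R :=
  rsum (seq 1 L) (fun k => rsum (seq 1 L) (fun y =>
    INR k / INR y * Cmod (f (Z.of_nat k) (- Z.of_nat y)%Z) ^ 2)).

Lemma Clim_conj u l : Clim u l -> Clim (fun n => Cconj (u n)) (Cconj l).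
Proof.
  intros H e He. destruct (H e He) as [N HN]. exists N. intros n Hn.
  rewrite <- Cminus_conj, Cmod_conj. auto.
Qed.

Lemma Clim_csum {A} (l : list A) (u : nat -> A -> C) v :
  (forall x, In x l -> Clim (fun n => u n x) (v x)) -> Clim (fun n => csum l (u n)) (csum l v).
Proof.
  induction l as [|x l IH]; intros H.
  - apply (Clim_const (RtoC 0)).
  - apply (Clim_plus (fun n => u n x) (fun n => csum l (u n))).
    + apply H. now left.
    + apply IH. intros y Hy. apply H. now right.
Qed.

Lemma corner_sum_lim L m : Clim (fun N =>
    RtoC (corner_sum L (aD_coef_box N m))) (RtoC (corner_sum L (aD_coef m))).
Proof.
  assert (E : forall f, RtoC (corner_sum L f) = csum (seq 1 L) (fun k => csum (seq 1 L) (fun y =>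
     RtoC (INR k / INR y) * (f (Z.of_nat k) (- Z.of_nat y)%Z
         * Cconj (f (Z.of_nat k) (- Z.of_nat y)%Z)))%C)).
  { intros f. unfold corner_sum. rewrite <- csum_RtoC. apply csum_ext. intros k _.
    rewrite <- csum_RtoC. apply csum_ext. intros y _. now rewrite RtoC_mult, Cmod2_conj. }
  rewrite E. eapply Clim_ext; [intros N; symmetry; apply E|].
  apply Clim_csum. intros k _. apply Clim_csum. intros y _. apply Clim_scal.
  apply Clim_mult; [|apply Clim_conj]; apply aD_coef_box_lim.
Qed.

Lemma trace_gap_zeta N m L : (L <= N)%nat ->
  exists delta, box_sum N (2 * S m) (closed_path_term a)
      = RtoC delta /\ 2 * corner_sum L (aD_coef_box N m) <= delta.
Proof.
  intros HL.
  destruct (trace_gap (zrange N) sym_mx sign_D sym_mx_herm sign_D_invol (S m)) as (delta & E & H);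
      [lia|].
  exists delta. split; [now rewrite box_sum_closed_path_term|]. eapply Rle_trans; [|exact H].
  set (B := word_mx (zrange N) sym_mx sign_D (repeat true (S m))).
  set (F := fun i j => (1 - sign_D i * sign_D j) * Cmod (B i j) ^ 2).
  assert (HF : forall i j, 0 <= F i j).
  { intros i j. apply Rmult_le_pos; [|apply pow2_ge_0]. unfold sign_D.
    destruct (Z_lt_dec 0 i), (Z_lt_dec 0 j); lra. }
  (* on rows with positive and columns with negative index the factor [1 - s_i s_j] is 2 *)
  apply Rle_trans with (rsum (map Z.of_nat (seq 1 L)) (fun i =>
     rsum (map (fun y => - Z.of_nat y)%Z (seq 1 L)) (fun j => F i j))).
  - unfold corner_sum. rewrite rsum_map, <- rsum_scal_l. right. apply rsum_ext. intros k Hk.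
    rewrite rsum_map, <- rsum_scal_l. apply rsum_ext. intros y Hy.
    apply in_seq in Hk. apply in_seq in Hy.
    pose proof (word_mx_aD_coef_box N m (Z.of_nat k) (- Z.of_nat y)) as P. fold B in P.
    unfold absZ in P. rewrite opp_IZR, Rabs_Ropp, <- !INR_IZR_INZ in P.
    rewrite !Rabs_pos_eq in P by apply pos_INR.
    assert (Hy0 : 0 < INR y) by (apply lt_0_INR; lia).
    unfold F, sign_D. destruct (Z_lt_dec 0 (Z.of_nat k)); [|lia].
    destruct (Z_lt_dec 0 (- Z.of_nat y)); [lia|].
    apply Rmult_eq_reg_l with (INR y); [|lra].
    replace (INR y * ((1 - 1 * -1) * Cmod (B (Z.of_nat k) (- Z.of_nat y)%Z) ^ 2))
      with (2 * (INR y * Cmod (B (Z.of_nat k) (- Z.of_nat y)%Z) ^ 2)) by ring.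
    rewrite P. field. lra.
  - apply Rle_trans with (rsum (map Z.of_nat (seq 1 L)) (fun i => rsum (zrange N) (fun j => F i j))).
    + apply rsum_le. intros i _. apply rsum_incl; [| |apply HF].
      * apply FinFun.Injective_map_NoDup; [intros x y; lia|apply seq_NoDup].
      * intros j Hj. apply in_map_iff in Hj. destruct Hj as (y & <- & Hy). apply in_seq in Hy.
        apply in_zrange. lia.
    + apply rsum_incl.
      * apply FinFun.Injective_map_NoDup; [intros x y; lia|apply seq_NoDup].
      * intros j Hj. apply in_map_iff in Hj. destruct Hj as (y & <- & Hy). apply in_seq in Hy.
        apply in_zrange. lia.
      * intros i. apply rsum_nonneg. intros; apply HF.
Qed.

(** The truncated traces are real and at least twice the truncated corner; pass to the limit for a fixed
    corner size [L]. *)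
Lemma zeta_real_bound m :
  exists z, is_zeta_invariant (S m) a z /\ forall L, 2 * corner_sum L (aD_coef m) <= z.
Proof.
  destruct (zeta_trace a Ha m) as [HS HL].
  set (w := Zsum (diag_coef (zeta_operator (S m) a))) in *.
  assert (Hre : forall L e, 0 < e -> Rabs (Im w) < e /\ 2 * corner_sum L (aD_coef m) <= Re w + e).
  { intros L e He.
    destruct (HL (e / 2)) as [N1 H1]; [lra|].
    destruct (corner_sum_lim L m (e / 4)) as [N2 H2]; [lra|].
    set (N := (L + N1 + N2)%nat). specialize (H1 N ltac:(lia)). specialize (H2 N ltac:(lia)).
    destruct (trace_gap_zeta N m L ltac:(lia)) as (delta & E & HD).
    rewrite E in H1. rewrite <- RtoC_minus, Cmod_R in H2.
    pose proof (re_le_Cmod (RtoC delta - w)) as R1. pose proof (im_le_Cmod (RtoC delta - w)) as I1.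
    change (Re (RtoC delta - w)) with (delta + - Re w) in R1.
    change (Im (RtoC delta - w)) with (0 + - Im w) in I1.
    rewrite Rplus_0_l, Rabs_Ropp in I1.
    pose proof (Rle_abs (- (delta + - Re w))) as R2. rewrite Rabs_Ropp in R2.
    pose proof (Rle_abs (- (corner_sum L (aD_coef_box N m) - corner_sum L (aD_coef m)))) as Q2.
    pose proof (Rle_abs (delta + - Re w)) as R3. rewrite Rabs_Ropp in Q2. lra. }
  assert (Him : Im w = 0).
  { destruct (Req_dec (Im w) 0) as [H|H]; [exact H|]. exfalso.
    apply Rabs_pos_lt in H. destruct (Hre O (Rabs (Im w)) H). lra. }
  exists (Re w). split.
  - split; [exact HS|]. fold w. destruct w as [x y]. simpl in Him. subst y. reflexivity.
  - intros L. apply Rnot_lt_le. intros H.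
    destruct (Hre L ((2 * corner_sum L (aD_coef m) - Re w) / 2)); lra.
Qed.

(** The anti-diagonals [k + y = n] with [n <= L] lie in the square of side [L]. *)
Lemma rsum_triangle L (F : nat -> nat -> R) : (forall k y, 0 <= F k y) ->
  rsum (seq 1 L) (fun n => rsum (seq 1 (n - 1)) (fun y => F (n - y)%nat y)) <=
  rsum (seq 1 L) (fun k => rsum (seq 1 L) (fun y => F k y)).
Proof.
  intros HF. rewrite (rsum_exchange (seq 1 L) (seq 1 L) F).
  set (G := fun n y => if lt_dec y n then F (n - y)%nat y else 0).
  assert (HG : forall n y, 0 <= G n y) by (intros n y; unfold G; destruct lt_dec; [apply HF|lra]).
  apply Rle_trans with (rsum (seq 1 L) (fun n => rsum (seq 1 L) (fun y => G n y))).
  - apply rsum_le. intros n Hn. apply in_seq in Hn.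
    rewrite (rsum_ext _ _ (fun y => G n y)).
    + apply rsum_incl; [apply seq_NoDup| |auto]. intros y. rewrite !in_seq. lia.
    + intros y Hy. apply in_seq in Hy. unfold G. destruct lt_dec; [easy|lia].
  - rewrite (rsum_exchange (seq 1 L) (seq 1 L) G). apply rsum_le. intros y Hy. apply in_seq in Hy.
    replace (seq 1 L) with (seq 1 y ++ seq (1 + y) (L - y)) by (rewrite <- seq_app; f_equal; lia).
    rewrite !rsum_app.
    rewrite (rsum_ext (seq 1 y) (fun n => G n y) (fun _ => 0)).
    + rewrite rsum_0, Rplus_0_l, (rsum_seq_shift 1 (L - y) (fun n => G n y)).
      rewrite <- rsum_app, <- seq_app. replace (y + (L - y))%nat with L by lia.
      rewrite (rsum_ext _ _ (fun n => F n y)).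
      * apply rsum_incl; [apply seq_NoDup| |auto]. intros x. rewrite !in_seq. lia.
      * intros x Hx. apply in_seq in Hx. unfold G. destruct lt_dec; [f_equal; lia|lia].
    + intros n Hn. apply in_seq in Hn. unfold G. destruct lt_dec; [lia|easy].
Qed.

(** Along the anti-diagonal [k - h = n] the coefficients of [(a D)^m] are [h] times a polynomial
    in [h] with leading coefficient [b_n]. *)
Lemma terms_le_corner_sum m L :
  rsum (seq (m + 2) L) (fun n =>
    INR n ^ (2 * S m + 1) * Cmod (fourier (fun t => RtoC (a t ^ S m)) (Z.of_nat n)) ^ 2)
  <= bound_const (S m) * corner_sum (m + 2 + L) (aD_coef m).
Proof.
  destruct (aD_pow_polynomial a m Ha) as (U & HU & E).
  set (P := fun (n : nat) (h : Z) => fourier (U h) (Z.of_nat n)).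
  assert (HP : forall n, poly_of (S m - 1) (fourier (fun t => RtoC (a t ^ S m)) (Z.of_nat n)) (P n)).
  { intros n. replace (S m - 1)%nat with m by lia. now apply poly_family_fourier. }
  assert (Hc : forall k h, aD_coef m k h = (RtoC (IZR h) * fourier (U h) (k - h))%C).
  { intros k h. destruct (aD_pow a Ha m h) as [_ Hf]. unfold aD_coef. rewrite <- Hf.
    pose proof (smoothC_contC _ (poly_family_smooth m U _ h HU)) as CU.
    rewrite (fourier_ext _ (fun t => expi h t * (RtoC (IZR h) * U h t))%C) by (intros; apply E).
    rewrite fourier_expi_mult by (apply contC_mult; [apply contC_const|exact CU]).
    now rewrite fourier_scal. }
  set (F := fun k y : nat => INR k * INR y * Cmod (P (k + y)%nat (- Z.of_nat y)%Z) ^ 2).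
  assert (HF : forall k y, 0 <= F k y).
  { intros k y. apply Rmult_le_pos; [apply Rmult_le_pos; apply pos_INR|apply pow2_ge_0]. }
  assert (EQ : corner_sum (m + 2 + L) (aD_coef m)
               = rsum (seq 1 (m + 2 + L)) (fun k => rsum (seq 1 (m + 2 + L)) (fun y => F k y))).
  { unfold corner_sum. apply rsum_ext. intros k Hk. apply rsum_ext. intros y Hy. apply in_seq in Hy.
    assert (Hy0 : 0 < INR y) by (apply lt_0_INR; lia).
    rewrite Hc, Cmod_mult, Cmod_R, opp_IZR, Rabs_Ropp, <- INR_IZR_INZ, Rabs_pos_eq by lra.
    unfold F, P. replace (Z.of_nat k - - Z.of_nat y)%Z with (Z.of_nat (k + y)) by lia.
    field. lra. }
  rewrite EQ. pose proof (bound_const_pos (S m) ltac:(lia)) as HK.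
  eapply Rle_trans; [|apply Rmult_le_compat_l; [lra|apply rsum_triangle, HF]].
  rewrite <- rsum_scal_l.
  apply Rle_trans with (rsum (seq (m + 2) L) (fun n =>
     bound_const (S m) * rsum (seq 1 (n - 1)) (fun y => F (n - y)%nat y))).
  - apply rsum_le. intros n Hn. apply in_seq in Hn.
    eapply Rle_trans; [apply (poly_of_weighted_bound (S m) n _ (P n)); [lia|lia|apply HP]|].
    right. f_equal. apply rsum_ext. intros y Hy. apply in_seq in Hy. unfold F.
    replace (n - y + y)%nat with n by lia. reflexivity.
  - apply rsum_incl; [apply seq_NoDup| |].
    + intros n. rewrite !in_seq. lia.
    + intros n. apply Rmult_le_pos; [lra|]. apply rsum_nonneg. intros; apply HF.
Qed.

End Bound.

Lemma nonneg_series_bound (f : nat -> R) M :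
  (forall n, 0 <= f n) -> (forall N, rsum (seq 0 (S N)) f <= M) -> ex_series f /\ Series f <= M.
Proof.
  intros Hf HM.
  assert (H : ex_finite_lim_seq (sum_n f)).
  { apply ex_finite_lim_seq_incr with M.
    - intros n. rewrite sum_Sn. unfold plus; simpl. specialize (Hf (S n)). lra.
    - intros n. rewrite <- rsum_seq_sum_n. apply HM. }
  destruct H as [l Hl].
  assert (HS : is_series f l) by exact Hl.
  split; [now exists l|]. rewrite (is_series_unique _ _ HS).
  apply (is_lim_seq_le (sum_n f) (fun _ => M) l M).
  - intros n. rewrite <- rsum_seq_sum_n. apply HM.
  - exact Hl.
  - apply is_lim_seq_const.
Qed.

Theorem theorem1p1 :
  forall m : nat, (1 <= m)%nat ->
  (exists c : R, 0 < c /\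
     forall a : R -> R, smooth_on_circle a ->
     let b := fun t : R => RtoC (a t ^ m) in
     let term := fun n : nat =>
       INR n ^ (2 * m + 1) * Cmod (fourier b (Z.of_nat n)) ^ 2 in
     exists z : R,
       is_zeta_invariant m a z /\
       ex_series (fun k : nat => term (m + 1 + k)%nat) /\
       z >= c * Series (fun k : nat => term (m + 1 + k)%nat)) /\
  (forall a : R -> R, smooth_on_circle a ->
     exists z : R, is_zeta_invariant m a z /\ z >= 0).
Proof.
  intros m Hm. destruct m as [|m]; [lia|].
  split.
  - pose proof (bound_const_pos (S m) Hm) as HK.
    exists (2 / bound_const (S m)). split; [apply Rdiv_lt_0_compat; lra|].
    intros a Ha b term.
    destruct (zeta_real_bound a Ha m) as (z & Hz & HQ).
    exists z. split; [exact Hz|].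
    destruct (nonneg_series_bound (fun k =>
        term (S m + 1 + k)%nat) (bound_const (S m) / 2 * z)) as [H1 H2].
    + intros k. unfold term. apply Rmult_le_pos; [apply pow_le, pos_INR|apply pow2_ge_0].
    + intros N.
      pose proof (terms_le_corner_sum a Ha m (S N)) as B. fold b in B.
      change (rsum (seq (m + 2) (S N)) term
          <= bound_const (S m) * corner_sum (m + 2 + S N) (aD_coef a m)) in B.
      rewrite (rsum_ext _ _ (fun k => term (k + (m + 2))%nat)) by (intros k _; f_equal; lia).
      rewrite <- rsum_seq_shift. rewrite Nat.add_0_l. eapply Rle_trans; [exact B|].
      specialize (HQ (m + 2 + S N)%nat). nra.
    + split; [exact H1|]. apply Rle_ge.
      apply Rle_trans with (2 / bound_const (S m) * (bound_const (S m) / 2 * z)).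
      * apply Rmult_le_compat_l; [apply Rlt_le, Rdiv_lt_0_compat; lra|exact H2].
      * right. field. lra.
  - intros a Ha. destruct (zeta_real_bound a Ha m) as (z & Hz & HQ).
    exists z. split; [exact Hz|]. specialize (HQ O). unfold corner_sum, rsum in HQ. simpl in HQ. lra.
Qed.
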